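(* Let $n\ge 1$, $1<r\le 2$, $0<\rho<1$, and let $m\in\mathbb{R}$ satisfy $m\le -\frac{n}{r}(1-\rho)$. Let $\sigma\in S^{m}_{\rho,\rho}(\mathbb{R}^n)$. Then there is a constant $C>0$ such that for all $f\in\mathscr{S}(\mathbb{R}^n)$ and all $x\in\mathbb{R}^n$, $$\mathcal{M}^{\sharp}_r\big(T_\sigma f\big)(x)\le C\,\mathrm{M}_r f(x).$$
   Context: For $m\in\mathbb{R}$ and $0\le\delta\le\rho\le1$, $S^m_{\rho,\delta}(\mathbb{R}^n)$ is the set of smooth $\sigma(x,\xi)$ on $\mathbb{R}^n\times\mathbb{R}^n$ such that for all multi-indices $\alpha,\beta$ there is $C_{\alpha,\beta}$ with $|\partial_x^\alpha\partial_\xi^\beta\sigma(x,\xi)|\le C_{\alpha,\beta}(1+|\xi|)^{m+\delta|\alpha|-\rho|\beta|}$. For $f\in\mathscr{S}(\mathbb{R}^n)$, $T_\sigma f(x)=\int_{\mathbb{R}^n}\sigma(x,\xi)\widehat f(\xi)e^{2\pi i\langle x,\xi\rangle}d\xi$, where $\widehat f(\xi)=\int f(x)e^{-2\pi i\langle x,\xi\rangle}dx$. For $0<r<\infty$, $\mathrm{M}_r f(x)=\sup_{Q\ni x}\big(\frac1{|Q|}\int_Q|f|^r\big)^{1/r}$ (supremum over cubes with sides parallel to the axes containing $x$), and the inhomogeneous $L^r$ sharp maximal function is $$\mathcal{M}^\sharp_r f(x)=\sup_{Q\ni x,\,\ell(Q)\ge1}\Big(\frac1{|Q|}\int_Q|f(y)|^rdy\Big)^{1/r}+\sup_{Q\ni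 x,\,\ell(Q)<1}\inf_{c_Q\in\mathbb{C}}\Big(\frac1{|Q|}\int_Q|f(y)-c_Q|^rdy\Big)^{1/r},$$ where $\ell(Q)$ is the side-length of $Q$. *)

(* Defs.v *)
From HB Require Import structures.
From mathcomp Require Import all_boot all_order all_algebra.
From mathcomp Require Import all_classical all_reals all_analysis.
From mathcomp Require Import complex.
Set Implicit Arguments. Unset Strict Implicit. Unset Printing Implicit Defensive.
Import Order.TTheory GRing.Theory Num.Theory.
Import numFieldNormedType.Exports.
Local Open Scope classical_set_scope.
Local Open Scope ring_scope.

Section Defs.
Variable R : realType.
Local Notation C := (complex R).

Definition cre (z : C) : R := @complex.Re R z.
Definition cim (z : C) : R := @complex.Im R z.
Definition cmod (z : C) : R := Num.sqrt (cre z ^+ 2 + cim z ^+ 2).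
Definition expi (t : R) : C := @Complex R (cos t) (sin t).

Definition dotp n (x y : 'rV[R]_n) : R := \sum_(i < n) x ord0 i * y ord0 i.
Definition enorm n (x : 'rV[R]_n) : R := Num.sqrt (dotp x x).
Definition evec n (i : 'I_n) : 'rV[R]_n := delta_mx ord0 i.

Definition mindex n := 'I_n -> nat.
Definition mlen n (a : mindex n) : nat := \sum_(i < n) a i.
Definition mpow n (x : 'rV[R]_n) (b : mindex n) : R := \prod_(i < n) x ord0 i ^+ b i.

Definition pd n (i : 'I_n) (h : 'rV[R]_n -> R) : 'rV[R]_n -> R :=
  fun x => 'D_(evec i) h x.
Fixpoint pdseq n (ds : seq 'I_n) (h : 'rV[R]_n -> R) : 'rV[R]_n -> R :=
  if ds is d :: ds' then pd d (pdseq ds' h) else h.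
Definition mlist n (a : mindex n) : seq 'I_n :=
  flatten [seq nseq (a i) i | i <- enum 'I_n].
Definition cpdseq n (ds : seq 'I_n) (f : 'rV[R]_n -> C) : 'rV[R]_n -> C :=
  fun x => Complex (pdseq ds (fun y => cre (f y)) x) (pdseq ds (fun y => cim (f y)) x).
Definition cDm n (a : mindex n) (f : 'rV[R]_n -> C) := cpdseq (mlist a) f.

Definition smooth n (h : 'rV[R]_n -> R) : Prop :=
  forall ds : seq 'I_n,
    continuous (pdseq ds h) /\ forall (i : 'I_n) x, derivable (pdseq ds h) x (evec i).
Definition csmooth n (f : 'rV[R]_n -> C) : Prop :=
  smooth (fun y => cre (f y)) /\ smooth (fun y => cim (f y)).

Definition schwartz n (f : 'rV[R]_n -> C) : Prop :=
  csmooth f /\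
  forall a b : mindex n, exists M : R, forall x, `|mpow x b| * cmod (cDm a f x) <= M.

Definition joint n (s : 'rV[R]_n -> 'rV[R]_n -> C) : 'rV[R]_(n + n) -> C :=
  fun z => s (lsubmx z) (rsubmx z).
Definition dxdxi n (a b : mindex n) (s : 'rV[R]_n -> 'rV[R]_n -> C) x xi : C :=
  cpdseq ([seq lshift n i | i <- mlist a] ++ [seq rshift n i | i <- mlist b])
    (joint s) (row_mx x xi).

Definition symbol_class n (m rho delta : R) (s : 'rV[R]_n -> 'rV[R]_n -> C) : Prop :=
  csmooth (joint s) /\
  forall a b : mindex n, exists Cab : R, forall x xi,
    cmod (dxdxi a b s x xi) <=
      Cab * (1 + enorm xi) `^ (m + delta * (mlen a)%:R - rho * (mlen b)%:R).

(** Lebesgue integration over R^n, as an iterated Lebesgue integral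
    (x = (x_0, x')  with x' in R^(n-1)). *)
Fixpoint eint (n : nat) : ('rV[R]_n -> \bar R) -> \bar R :=
  match n with
  | 0 => fun h => h 0
  | n'.+1 => fun h =>
      (\int[@lebesgue_measure R]_(t in [set: R])
         eint (fun v : 'rV[R]_n' => h (row_mx (t%:M : 'rV[R]_1) v)))%E
  end.
Fixpoint rint (n : nat) : ('rV[R]_n -> R) -> R :=
  match n with
  | 0 => fun h => h 0
  | n'.+1 => fun h =>
      Rintegral (@lebesgue_measure R) [set: R]
         (fun t => rint (fun v : 'rV[R]_n' => h (row_mx (t%:M : 'rV[R]_1) v)))
  end.
Definition cint n (f : 'rV[R]_n -> C) : C :=
  Complex (rint (fun x => cre (f x))) (rint (fun x => cim (f x))).

Definition fourier n (f : 'rV[R]_n -> C) (xi : 'rV[R]_n) : C :=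
  cint (fun x => f x * expi (- (2 * pi * dotp x xi))).
Definition psido n (s : 'rV[R]_n -> 'rV[R]_n -> C) (f : 'rV[R]_n -> C) (x : 'rV[R]_n) : C :=
  cint (fun xi => s x xi * fourier f xi * expi (2 * pi * dotp x xi)).

Definition cube n (a : 'rV[R]_n) (l : R) : set 'rV[R]_n :=
  [set y | forall i, a ord0 i <= y ord0 i <= a ord0 i + l].

Definition avg_r n (r : R) (g : 'rV[R]_n -> C) (c : C) (a : 'rV[R]_n) (l : R) : \bar R :=
  (((l ^+ n)^-1)%:E *
     eint (fun y => (\1_(cube a l) y * cmod (g y - c) `^ r)%:E)) `^ r^-1.

Definition maxr n (r : R) (f : 'rV[R]_n -> C) (x : 'rV[R]_n) : \bar R :=
  ereal_sup [set v | exists (a : 'rV[R]_n) (l : R),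
                0 < l /\ cube a l x /\ v = avg_r r f 0%R a l].

Definition sharp_maxr n (r : R) (g : 'rV[R]_n -> C) (x : 'rV[R]_n) : \bar R :=
  (ereal_sup [set v | exists (a : 'rV[R]_n) (l : R),
                (1 <= l)%R /\ cube a l x /\ v = avg_r r g 0%R a l]
   + ereal_sup [set v | exists (a : 'rV[R]_n) (l : R),
                (0 < l < 1)%R /\ cube a l x /\
                v = ereal_inf [set avg_r r g c a l | c in [set: C]]])%E.

End Defs.

(* Main.v *)
(** The symbol is cut into dyadic pieces [sigma_j] living at frequency
    [lambda = 2 ^ j], where it is smooth at the scale [h = lambda ^ - rho] in [x]
    and [1 / h] in [xi], with amplitude [(lambda h) ^ (- n / r)]. All estimates
    are for the real operators [Top], with kernel [cos (2 pi (x - y) . xi + k)];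
    the complex operator is a sum of eight of them.

    For one piece a T T* argument, in which the kernel of T T* is summable by
    integration by parts, bounds [L^r] to [L^2] on a cube of side [h]. Since
    [x - y] acts as a frequency derivative of the symbol, the [L^r] norm of [f]
    may be weighted by a power of [1 + |y - c| / h], and the weighted norm is
    controlled by the maximal function. On a cube of side [l] containing the
    given point, Jensen's inequality then yields the bound
    - [l lambda] for the oscillation of the piece, if [l lambda <= 1];
    - [(l lambda) ^ (- n / 2)] if [1 / lambda <= l <= h];
    - [(lambda h) ^ (- n / 2)] if [h <= l], by averaging over subcubes of side [h].
    These numbers are summable in [j], uniformly in [l]. The constant subtracted
    on small cubes is the value at the given point of the pieces with
    [l lambda < 1]; there is none when [l >= 1]. *)

(* At the critical order the amplitude of a piece only just balances the L^r mass that [f] may have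
   in a cube of side [h]: for [m = - (n / r) (1 - rho)] one has
   [lambda ^ m = (lambda h) ^ (- n / r)], and no decay in [j] is left. Summability must come from
   the side of the cube relative to [1 / lambda] and [h], and from [lambda h = lambda ^ (1 - rho)],
   which grows since [rho < 1].

   The L^r to L^2 bound is a composition: the Fourier transform, localized to a frequency box, goes
   from L^r to L^2, and the symbol then acts from L^2 to L^2. Both bounds come from one estimate for
   oscillatory operators, in which a pointwise Young inequality takes the place of interpolation of
   operators and of Hausdorff-Young.

   Derivatives are counted: [2 n] in [x] make kernels integrable, and [4 n] in [xi] pay for a weight
   that splits into two integrable ones; cutoffs of finite smoothness are enough. For a given
   Schwartz function finitely many pieces leave an error no larger than the bound sought, so the
   series of pieces need not be shown to converge. *)
Require Import Defs.
From HB Require Import structures.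
From mathcomp Require Import all_boot all_order all_algebra.
From mathcomp Require Import all_classical all_reals all_analysis.
From mathcomp Require Import complex.
From mathcomp Require Import measurable_realfun ring lra.
Import Order.TTheory GRing.Theory Num.Theory.
Import numFieldNormedType.Exports.
Set Implicit Arguments. Unset Strict Implicit. Unset Printing Implicit Defensive.
Local Open Scope classical_set_scope.
Local Open Scope ring_scope.

(** * Lebesgue integration on the space of row vectors *)

Section approximation.
Variable R : realType.

(** Stands in for measurability of a map into a space that carries only a topology: a pointwise
    limit of countably valued maps with measurable level sets. The class is stable under pairing and
    under continuous maps, and a continuous real function of such a map is measurable. *)
Definition simple_approx d (T : measurableType d) (X : topologicalType) (phi : T -> X) :=
  exists (io : nat -> T -> nat) (q : nat -> nat -> X),
    (forall k m, measurable (io k @^-1` [set m])) /\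
    forall x, (fun k => q k (io k x)) @ \oo --> phi x.

Lemma simple_approx_measurable d (T : measurableType d) (X : topologicalType) (phi : T -> X)
    (h : X -> R) :
  simple_approx phi -> continuous h -> measurable_fun setT (h \o phi).
Proof.
move=> [io [q [mio cq]]] ch.
apply: (@measurable_fun_cvg _ _ _ _ (fun k x => h (q k (io k x)))).
- move=> k _ Y mY; rewrite setTI.
  rewrite (_ : _ @^-1` Y = \bigcup_(m in [set m | Y (h (q k m))]) (io k @^-1` [set m])).
    by apply: bigcup_measurable => m _; exact: mio.
  apply/seteqP; split=> [x /= Yx|x [m /= Ym xm]]; last by rewrite xm.
  by exists (io k x).
- move=> x _; apply: continuous_cvg; first exact: ch.
  exact: cq.
Qed.

Lemma simple_approx_comp d (T : measurableType d) (X Y : topologicalType) (phi : T -> X)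
    (g : X -> Y) :
  simple_approx phi -> continuous g -> simple_approx (g \o phi).
Proof.
move=> [io [q [mio cq]]] cg; exists io, (fun k m => g (q k m)); split=> // x.
by apply: continuous_cvg; [exact: cg|exact: cq].
Qed.

Lemma simple_approx_pre d d' (T : measurableType d) (T' : measurableType d')
    (X : topologicalType) (phi : T -> X) (u : T' -> T) :
  measurable_fun setT u -> simple_approx phi -> simple_approx (phi \o u).
Proof.
move=> mu [io [q [mio cq]]]; exists (fun k => io k \o u), q; split=> [k m|x]; last exact: cq.
by rewrite -[X in measurable X]setTI comp_preimage; exact: mu.
Qed.

Lemma simple_approx_pair d (T : measurableType d)
    (X1 X2 : topologicalType) (phi1 : T -> X1) (phi2 : T -> X2) :
  simple_approx phi1 -> simple_approx phi2 ->
  simple_approx (fun p => (phi1 p, phi2 p)).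
Proof.
move=> [io1 [q1 [m1 c1]]] [io2 [q2 [m2 c2]]].
(* A pair of indices is coded by one natural number, so the pair of approximations is again
   countably valued. *)
exists (fun k p => pickle (io1 k p, io2 k p)),
  (fun k m => let z := odflt (0,0)%N (unpickle m) in (q1 k z.1, q2 k z.2)); split.
  move=> k m; have [[[i j] <-]|nm] := pselect (exists ij : nat * nat, pickle ij = m).
    rewrite (_ : _ @^-1` _ = (io1 k @^-1` [set i]) `&` (io2 k @^-1` [set j])).
      by apply: measurableI; [exact: m1|exact: m2].
    apply/seteqP; split=> x /=.
      by move/(pcan_inj pickleK) => -[-> ->].
    by move=> [-> ->].
  rewrite (_ : _ @^-1` _ = set0); first exact: measurable0.
  apply/seteqP; split=> x //= xm; apply: nm; by eexists; exact: xm.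
move=> x /=; apply: cvg_pair => /=; under eq_fun do rewrite pickleK /=.
  exact: c1.
exact: c2.
Qed.

Lemma simple_approx_id : simple_approx (id : measurableTypeR R -> R).
Proof.
exists (fun k x => pickle (Num.floor (x * k.+1%:R))),
  (fun k m => (odflt 0 (unpickle m : option int))%:~R / k.+1%:R); split.
  move=> k m; have [[z <-]|nm] := pselect (exists z : int, pickle z = m).
    rewrite (_ : _ @^-1` _ = `[z%:~R / k.+1%:R, (z + 1)%:~R / k.+1%:R[%classic); first exact: measurable_itv.
    apply/seteqP; split=> x /=; rewrite in_itv /= ler_pdivrMr ?ltr0n// ltr_pdivlMr ?ltr0n//.
      by move=> /(pcan_inj pickleK) <-; exact: floor_itv.
    by rewrite -floor_eq => /eqP ->.
  rewrite (_ : _ @^-1` _ = set0); first exact: measurable0.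
  apply/seteqP; split=> x //= xm; apply: nm; by eexists; exact: xm.
move=> x /=; under eq_fun do rewrite pickleK /=.
apply/cvgrPdist_le => e e0; near=> k.
have k0 : 0 < k.+1%:R :> R by rewrite ltr0n.
have /andP[f1 f2] := floor_itv (x * k.+1%:R).
rewrite intrD in f2.
rewrite (_ : x - _ = (x * k.+1%:R - (Num.floor (x * k.+1%:R))%:~R) / k.+1%:R); last first.
  by rewrite mulrBl mulfK ?gt_eqF.
rewrite normrM normfV (gtr0_norm k0) ger0_norm ?subr_ge0//.
apply: (@le_trans _ _ (k.+1%:R^-1)).
  by rewrite ler_piMl ?invr_ge0 ?ltW//; lra.
near: k.
have := @cvg_harmonic R; move/cvgrPdist_le => /(_ e e0); apply: filterS => k.
by rewrite sub0r normrN /= gtr0_norm ?invr_gt0 ?ltr0n.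
Unshelve. all: by end_near. Qed.

Lemma continuous_rowP (X : topologicalType) n (g : X -> 'rV[R]_n) :
  (forall j, continuous (fun x => g x ord0 j)) -> continuous g.
Proof.
move=> cg x; apply/cvg_mx_entourageP => A eA.
have H : \forall y \near nbhs x, forall j, A (g x ord0 j, g y ord0 j).
  apply: filter_forall => j.
  by have := cg j x; move/cvg_entourageP => /(_ A eA).
apply: filterS H => y H i j.
by rewrite (ord1 i) inE.
Qed.

End approximation.
(* The library's sigma-finite structure on [m1 \x m2] is masked by the
   subprobability one, so it is rebuilt on a copy of the product measure. *)
Section sigma_finite_product.
Context d1 d2 (T1 : measurableType d1) (T2 : measurableType d2) (R : realType).
Variable m1 : {sigma_finite_measure set T1 -> \bar R}.
Variable m2 : {sigma_finite_measure set T2 -> \bar R}.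

Definition prodm : set (T1 * T2) -> \bar R := (m1 \x m2)%E.

HB.instance Definition _ := Measure.on prodm.

Let prodm_sigma_finite : sigma_finite setT prodm.
Proof.
have /sigma_finiteP[F [TF ndF Foo]] := sigma_finiteT m1.
have /sigma_finiteP[G [TG ndG Goo]] := sigma_finiteT m2.
exists (fun k => F k `*` G k).
  rewrite -setXTT TF TG; apply/seteqP; split=> -[x y] /=.
    move=> [[i _ Fx] [k _ Gy]]; exists (maxn i k) => //; split.
      by move: x Fx; exact/subsetPset/ndF/leq_maxl.
    by move: y Gy; exact/subsetPset/ndG/leq_maxr.
  by move=> [k _ [? ?]]; split; exists k.
move=> k; have [? ?] := Foo k; have [? ?] := Goo k.
split; first exact: measurableX.
by rewrite /prodm product_measure1E// lte_mul_pinfty// ge0_fin_numE.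
Qed.

HB.instance Definition _ := Measure_isSigmaFinite.Build _ _ _ prodm
  prodm_sigma_finite.

End sigma_finite_product.

(** * Euclidean space as an iterated product of lines *)

Section model.
Variable R : realType.

(* [mv] parametrizes 'rV[R]_n by an iterated product of lines; measurability and
   integrals of functions on 'rV[R]_n are always those of the composite with [mv]. *)
Record euclid_model (n : nat) := EuclidModel {
  md : measure_display;
  mT : measurableType md;
  mmu : {sigma_finite_measure set mT -> \bar R};
  mv : mT -> 'rV[R]_n }.

Definition cons_row n (t : R) (v : 'rV[R]_n) : 'rV[R]_n.+1 := row_mx (t%:M : 'rV_1) v.

Definition leb : {sigma_finite_measure set (measurableTypeR R) -> \bar R} :=
  @lebesgue_measure R.

Fixpoint model n : euclid_model n :=
  match n with
  | 0 => @EuclidModel 0 _ unit (@dirac _ unit tt R) (fun=> 0)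
  | n'.+1 => @EuclidModel n'.+1 _ (measurableTypeR R * mT (model n'))%type
     (prodm leb (mmu (model n')))
     (fun p => cons_row p.1 (mv p.2))
  end.

Lemma cons_row0 n t (v : 'rV[R]_n) : cons_row t v ord0 ord0 = t.
Proof.
have t1 : (t%:M : 'rV_1) ord0 ord0 = t by rewrite mxE eqxx.
rewrite -[RHS]t1 -[RHS](row_mxEl (t%:M : 'rV_1) v ord0 ord0).
by congr (row_mx _ _ _ _); exact: val_inj.
Qed.

Lemma cons_rowS n t (v : 'rV[R]_n) i : cons_row t v ord0 (lift ord0 i) = v ord0 i.
Proof.
have := row_mxEr (t%:M : 'rV_1) v ord0 i => <-.
by congr (row_mx _ _ _ _); exact: val_inj.
Qed.

Lemma cons_row_continuous n : continuous (fun p : R * 'rV[R]_n => cons_row p.1 p.2).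
Proof.
apply: continuous_rowP => j.
have [i ->|->] := unliftP ord0 j.
  under eq_fun do rewrite cons_rowS.
  move=> p; apply: (@continuous_comp _ _ _ (fun p => p.2) (fun v : 'rV_n => v ord0 i)).
    exact: cvg_snd.
  exact: coord_continuous.
under eq_fun do rewrite cons_row0.
move=> p; exact: cvg_fst.
Qed.

Lemma mv_approx n : simple_approx (@mv n (model n)).
Proof.
elim: n => [|n IH] /=.
  exists (fun _ _ => 0%N), (fun _ _ => 0); split=> [k m|x]; last exact: cvg_cst.
  by [].
have H : @simple_approx _ (measurableTypeR R * mT (model n))%type (R * 'rV[R]_n)%type
    (fun p => (p.1 : R, mv p.2)).
  apply: (@simple_approx_pair _ (measurableTypeR R * mT (model n))%type R 'rV[R]_n (fun p => (p.1 : R)) (fun p => mv p.2)).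
    exact: (simple_approx_pre measurable_fst (@simple_approx_id R)).
  exact: (simple_approx_pre measurable_snd IH).
exact: (simple_approx_comp H (@cons_row_continuous n)).
Qed.

Lemma mv_surj n (x : 'rV[R]_n) : exists t, @mv _ (model n) t = x.
Proof.
elim: n x => [|n IH] x; first by exists tt; apply/rowP => -[].
have [t tx] := IH (\row_i x ord0 (lift ord0 i)).
exists (x ord0 ord0, t); apply/rowP => j /=.
by have [i ->|->] := unliftP ord0 j; rewrite ?cons_rowS ?cons_row0// tx mxE.
Qed.

Local Open Scope ereal_scope.

Lemma eint_model n (h : 'rV[R]_n -> \bar R) : (forall x, 0 <= h x) ->
  measurable_fun setT (h \o @mv n (model n)) ->
  eint h = \int[mmu (model n)]_x h (mv x).
Proof.
elim: n h => [|n IH] h h0 mh /=.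
  by rewrite integral_dirac//= diracT mul1e.
rewrite (@fubini_tonelli1 _ _ _ _ R _ _ (h \o @mv _ (model n.+1)))//=.
apply: eq_integral => t _; rewrite /fubini_F IH//=.
exact: (measurable_fun_pair2 (f := h \o @mv _ (model n.+1))).
Qed.

Lemma eint_prod n (k : 'I_n -> R -> R) (I : 'I_n -> R) :
  (forall i t, 0 <= k i t)%R -> (forall i, measurable_fun setT (k i)) ->
  (forall i, \int[@lebesgue_measure R]_t (k i t)%:E = (I i)%:E) ->
  eint (fun x => (\prod_(i < n) k i (x ord0 i))%:E) = (\prod_(i < n) I i)%:E.
Proof.
elim: n k I => [|n IH] k I k0 mk kI /=; first by rewrite !big_ord0.
under eq_integral => t _.
  under eq_fun => v.
    rewrite -[row_mx _ _]/(cons_row t v) big_ord_recl cons_row0.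
    under eq_bigr do rewrite cons_rowS.
    over.
  over.
transitivity (\int[@lebesgue_measure R]_t ((k ord0 t)%:E * (\prod_(i < n) I (lift ord0 i))%:E)).
  apply: eq_integral => t _.
  rewrite -(IH (fun i => k (lift ord0 i)))//.
  have mp : measurable_fun setT ((fun x : 'rV[R]_n => (\prod_(i < n) k (lift ord0 i) (x ord0 i))%R) \o @mv n (model n)).
    rewrite /comp; apply: measurable_prod => i _.
    apply: measurableT_comp; first exact: mk.
    have := simple_approx_measurable (@mv_approx n) (@coord_continuous R 1 n ord0 i).
    exact.
  rewrite eint_model; last 2 first.
  - by move=> x; rewrite lee_fin mulr_ge0//; apply: prodr_ge0.
  - apply/measurable_EFinP; apply: measurable_funM => //; exact: measurable_cst.
  rewrite eint_model; last 2 first.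
  - by move=> x; rewrite lee_fin; apply: prodr_ge0.
  - exact/measurable_EFinP.
  under eq_integral do rewrite EFinM.
  rewrite ge0_integralZl//.
  - exact/measurable_EFinP.
  - by move=> x _; rewrite lee_fin; apply: prodr_ge0.
  - by rewrite lee_fin.
rewrite ge0_integralZr//.
- by rewrite kI -EFinM big_ord_recl.
- by apply/measurable_EFinP; exact: mk.
- by move=> x _; rewrite lee_fin.
rewrite lee_fin; apply: prodr_ge0 => i _.
by rewrite -lee_fin -kI integral_ge0// => t _; rewrite lee_fin.
Qed.

End model.

Section integral.
Variables (R : realType) (n : nat).
Local Notation V := 'rV[R]_n.
Local Notation M := (model R n).
Local Notation pt := (@mv R n (model R n)).

Definition mfn (h : V -> R) := measurable_fun setT (fun t => h (pt t)).
Definition mfn2 (h : V -> V -> R) :=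
  measurable_fun setT (fun p : mT M * mT M => h (pt p.1) (pt p.2)).
Definition L1 (h : V -> R) := (mmu M).-integrable setT (fun t => (h (pt t))%:E).
Definition Int (h : V -> R) : R := \int[mmu M]_t h (pt t).

Lemma mfn_cont h : continuous h -> mfn h.
Proof. exact: (simple_approx_measurable (@mv_approx R n)). Qed.

Lemma mfn2_cont h : continuous (fun p : V * V => h p.1 p.2) -> mfn2 h.
Proof.
apply: (@simple_approx_measurable R _ _ _ (fun p : mT M * mT M => (pt p.1, pt p.2))).
apply: (@simple_approx_pair _ (mT M * mT M)%type V V (fun p => pt p.1) (fun p => pt p.2)).
  exact: (simple_approx_pre measurable_fst (@mv_approx R n)).
exact: (simple_approx_pre measurable_snd (@mv_approx R n)).
Qed.

Lemma mfn2_fst h : mfn h -> mfn2 (fun x _ => h x).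
Proof. by move=> mh; exact: (measurableT_comp mh measurable_fst). Qed.

Lemma mfn2_snd h : mfn h -> mfn2 (fun _ y => h y).
Proof. by move=> mh; exact: (measurableT_comp mh measurable_snd). Qed.

Lemma mfn2M h k : mfn2 h -> mfn2 k -> mfn2 (fun x y => h x y * k x y).
Proof. exact: measurable_funM. Qed.

Lemma mfn2_swap h : mfn2 h -> mfn2 (fun x y => h y x).
Proof.
move=> mh; apply: (measurableT_comp (f := fun p : mT M * mT M => h (pt p.1) (pt p.2)) mh
  (g := fun p : mT M * mT M => (p.2, p.1))).
by apply: measurable_fun_pair.
Qed.

Lemma mfn2_l h y : mfn2 h -> mfn (h^~ y).
Proof. have [t <-] := mv_surj y.
by move=> mh; exact: (measurable_fun_pair1 (f := fun p : mT M * mT M => h (pt p.1) (pt p.2))). Qed.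

Lemma mfn2_r h x : mfn2 h -> mfn (h x).
Proof. by move=> /mfn2_swap; exact: mfn2_l. Qed.

Lemma L1_mfn h : L1 h -> mfn h.
Proof. by move=> /measurable_int/measurable_EFinP. Qed.

Lemma L1_dom f g : mfn f -> L1 g -> (forall x, `|f x| <= g x) -> L1 f.
Proof.
move=> mf ig fg; apply: (le_integrable _ _ _ ig) => //.
  exact/measurable_EFinP.
by move=> t _; rewrite lee_fin (le_trans (fg _))// ler_norm.
Qed.

Lemma L1D f g : L1 f -> L1 g -> L1 (fun x => f x + g x).
Proof. by move=> lf lg; exact: (integrableD measurableT lf lg). Qed.

Lemma L1B f g : L1 f -> L1 g -> L1 (fun x => f x - g x).
Proof. by move=> lf lg; exact: (integrableB measurableT lf lg). Qed.

Lemma L1Z c f : L1 f -> L1 (fun x => c * f x).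
Proof. by move=> lf; exact: (integrableZl measurableT c lf). Qed.

Lemma L1_abs f : L1 f -> L1 (fun x => `|f x|).
Proof. by move=> lf; exact: (integrable_norm lf). Qed.

Lemma L1_cst0 : L1 (fun=> 0).
Proof. exact: integrable0. Qed.

Lemma L1_sum (I : Type) (s : seq I) (f : I -> V -> R) :
  (forall i, L1 (f i)) -> L1 (fun x => \sum_(i <- s) f i x).
Proof.
move=> lf; elim: s => [|i s IH].
  by under eq_fun do rewrite big_nil; exact: L1_cst0.
by under eq_fun do rewrite big_cons; exact: L1D.
Qed.

Lemma IntD f g : L1 f -> L1 g -> Int (fun x => f x + g x) = Int f + Int g.
Proof. by move=> lf lg; exact: RintegralD. Qed.

Lemma IntB f g : L1 f -> L1 g -> Int (fun x => f x - g x) = Int f - Int g.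
Proof. by move=> lf lg; exact: RintegralB. Qed.

Lemma IntZ c f : L1 f -> Int (fun x => c * f x) = c * Int f.
Proof. by move=> lf; exact: RintegralZl. Qed.

Lemma Int0 : Int (fun=> 0) = 0.
Proof. by rewrite /Int /Rintegral integral0. Qed.

Lemma Int_sum (I : Type) (s : seq I) (f : I -> V -> R) :
  (forall i, L1 (f i)) -> Int (fun x => \sum_(i <- s) f i x) = \sum_(i <- s) Int (f i).
Proof.
move=> lf; elim: s => [|i s IH].
  by under eq_fun do rewrite big_nil; rewrite Int0 big_nil.
under eq_fun do rewrite big_cons.
by rewrite IntD// ?IH ?big_cons//; exact: L1_sum.
Qed.

Lemma Int_le f g : L1 f -> L1 g -> (forall x, f x <= g x) -> Int f <= Int g.
Proof. by move=> lf lg fg; exact: le_Rintegral. Qed.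

Lemma Int_ge0 f : (forall x, 0 <= f x) -> 0 <= Int f.
Proof. by move=> f0; exact: Rintegral_ge0. Qed.

Lemma Int_abs f : L1 f -> `|Int f| <= Int (fun x => `|f x|).
Proof. by move=> lf; exact: le_normr_Rintegral. Qed.

Lemma Int_abs_le f g : mfn f -> L1 g -> (forall x, `|f x| <= g x) -> `|Int f| <= Int g.
Proof.
move=> mf lg fg; have lf := L1_dom mf lg fg.
by rewrite (le_trans (Int_abs lf))// Int_le//; exact: L1_abs.
Qed.

Lemma L1_eint f : L1 f -> (forall x, 0 <= f x) -> eint (fun x => (f x)%:E) = (Int f)%:E.
Proof.
move=> lf f0; rewrite eint_model; last 2 first.
- by move=> x; rewrite lee_fin.
- by apply/measurable_EFinP; exact: L1_mfn.
by rewrite /Int /Rintegral fineK//; exact: (integrable_fin_num measurableT lf).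
Qed.

Lemma eint_L1 f C : mfn f -> (forall x, 0 <= f x) ->
  (eint (fun x => (f x)%:E) <= C%:E)%E -> L1 f /\ Int f <= C.
Proof.
move=> mf f0; rewrite eint_model; last 2 first.
- by move=> x; rewrite lee_fin.
- exact/measurable_EFinP.
move=> fC; have lf : L1 f.
  apply/integrableP; split; first exact/measurable_EFinP.
  under eq_integral do rewrite gee0_abs ?lee_fin//.
  by rewrite (le_lt_trans fC)// ltry.
split=> //; rewrite -lee_fin /Int /Rintegral fineK//.
exact: (integrable_fin_num measurableT lf).
Qed.

(** Domination by a product [u x * v y] gives integrability on the product space, so that statements
    only mention integrals over a single copy of the space. *)
Lemma fubini2 h u v : mfn2 h -> L1 u -> L1 v -> (forall x y, `|h x y| <= u x * v y) ->
  [/\ L1 (fun x => Int (h x)), L1 (fun y => Int (h^~ y)) &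
   Int (fun x => Int (h x)) = Int (fun y => Int (h^~ y))].
Proof.
move=> mh lu lv huv.
have uv x y : `|h x y| <= `|u x| * `|v y|.
  by rewrite -normrM (le_trans (huv x y))// ler_norm.
pose H := fun p : mT M * mT M => (h (pt p.1) (pt p.2))%:E.
have mH : measurable_fun setT H by exact/measurable_EFinP.
have iH : (mmu M \x mmu M)%E.-integrable setT H.
  apply/(integrable12ltyP _ _ mH).
  apply: (@le_lt_trans _ _ (\int[mmu M]_x ((`|u (pt x)|%:E) * (Int (fun y => `|v y|))%:E))%E).
    apply: ge0_le_integral => //.
    - by move=> x _; exact: integral_ge0.
    - apply: (@measurable_fun_fubini_tonelli_F _ _ _ _ _ (mmu M) (fun p => `|H p|%E)) => //.
      exact: measurableT_comp.
    - apply: emeasurable_funM; last exact: measurable_cst.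
      by apply/measurable_EFinP; exact: (L1_mfn (L1_abs lu)).
    - move=> x _; have iv := L1_abs lv.
      rewrite /Int /Rintegral fineK; last exact: (integrable_fin_num measurableT iv).
      rewrite -ge0_integralZl//.
      + apply: ge0_le_integral => //.
        * by apply: measurableT_comp => //; exact: (measurable_fun_pair2 (f := H)).
        * apply: emeasurable_funM; first exact: measurable_cst.
          exact: (measurable_int _ iv).
        * by move=> y _; rewrite /= lee_fin.
      + exact: (measurable_int _ iv).
  have iu := integrableZr measurableT (Int (fun y => `|v y|)) (L1_abs lu).
  move/integrableP : iu => [_]; apply: le_lt_trans.
  apply: ge0_le_integral => //.
  - by move=> x _; rewrite mule_ge0//= lee_fin; exact: Int_ge0.
  - apply: emeasurable_funM; last exact: measurable_cst.
    by apply/measurable_EFinP; exact: (L1_mfn (L1_abs lu)).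
  - apply: measurableT_comp => //; apply: emeasurable_funM; last exact: measurable_cst.
    by apply/measurable_EFinP; exact: (L1_mfn (L1_abs lu)).
  - by move=> x _; exact: lee_abs.
have FE (x : mT M) : fubini_F (mmu M) H x = (Int (h (pt x)))%:E.
  rewrite /fubini_F /Int /Rintegral fineK//.
  have : L1 (h (pt x)).
    apply: (@L1_dom _ (fun y => `|u (pt x)| * `|v y|)) => //.
    - by apply/measurable_EFinP; exact: (measurable_fun_pair2 (f := H)).
    - by apply: L1Z; exact: L1_abs.
  exact: (integrable_fin_num measurableT).
have GE (y : mT M) : fubini_G (mmu M) H y = (Int (h^~ (pt y)))%:E.
  rewrite /fubini_G /Int /Rintegral fineK//.
  have : L1 (h^~ (pt y)).
    apply: (@L1_dom _ (fun x => `|v (pt y)| * `|u x|)) => //.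
    - by apply/measurable_EFinP; exact: (measurable_fun_pair1 (f := H)).
    - by apply: L1Z; exact: L1_abs.
    - by move=> x; rewrite mulrC.
  exact: (integrable_fin_num measurableT).
have iF := integrable_fubini_F iH; have mG := measurable_fubini_G iH.
split.
- by move: iF; apply: eq_integrable => // x _; rewrite FE.
- apply: (@L1_dom _ (fun y => Int (fun x => `|u x|) * `|v y|)).
  + by apply/measurable_EFinP; move: mG; apply: eq_measurable_fun => y _; rewrite GE.
  + by apply: L1Z; exact: L1_abs.
  + move=> y; rewrite mulrC -IntZ; last exact: L1_abs.
    apply: Int_abs_le.
    * exact: mfn2_l.
    * by apply: L1Z; exact: L1_abs.
    * by move=> x; rewrite mulrC.
rewrite {1}/Int [RHS]/Int /Rintegral; congr fine.
under eq_integral do rewrite -FE; under [RHS]eq_integral do rewrite -GE.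
exact: Fubini.
Qed.
End integral.

(** * Integrals over the real line *)

Section line.
Variable R : realType.
Local Notation mu := (@lebesgue_measure R).

(** Change of variable [s = h (t - a)] in the integral of [1 / (1 + s ^ 2)], whose value [pi] is
    twice the integral over the half line. *)
Lemma integral_cauchy (h a : R) : 0 < h ->
  (\int[mu]_t ((1 + (h * (t - a)) ^+ 2)^-1)%:E = (pi / h)%:E)%E.
Proof.
move=> h0.
have pi0 : (\int[mu]_t ((oneDsqr t)^-1)%:E = (pi : R)%:E)%E.
  rewrite (@ge0_symfun_integralT _ (fun t => (oneDsqr t)^-1)).
  - rewrite -set_itvcy integral0y_oneDsqr -EFinM; congr EFin; lra.
  - by move=> x; rewrite invr_ge0 (le_trans ler01)// oneDsqr_ge1.
  - exact: continuous_oneDsqrV.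
  - by move=> x; rewrite /= /oneDsqr sqrrN.
have dF (x : R) : is_derive x 1 (fun t => h * (t - a)) h.
  by apply: is_derive_eq; rewrite subr0 /GRing.scale /= mulr1.
have F'E : derive1 (fun t : R => h * (t - a)) = cst h.
  by apply/funext => x; rewrite derive1E (@derive_val _ _ _ _ _ _ _ (dF x)).
have mk : measurable_fun setT (fun t : R => (1 + (h * (t - a)) ^+ 2)^-1).
  apply: continuous_measurable_fun => x.
  apply: (@continuous_comp _ _ _ (fun t => h * (t - a)) (fun t => (oneDsqr t)^-1)); last exact: continuous_oneDsqrV.
  apply: differentiable_continuous; apply/derivable1_diffP; exact: ex_derive.
have H : ((pi : R)%:E = \int[mu]_t (h * (1 + (h * (t - a)) ^+ 2)^-1)%:E)%E.
  rewrite -pi0 (@increasing_ge0_integration_by_substitutionT R (fun t => h * (t - a)) (fun t => (oneDsqr t)^-1)).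
  - by rewrite F'E; apply: eq_integral => t _; rewrite mulrC.
  - by move=> x y xy; rewrite ltr_pM2l// ltrD2r.
  - by rewrite F'E => x; exact: cvg_cst.
  - by rewrite F'E; exact: is_cvg_cst.
  - by rewrite F'E; exact: is_cvg_cst.
  - by move=> x; exact: ex_derive.
  - apply/cvgrNyPle => A; near=> t; rewrite -ler_pdivlMl// lerBlDr; near: t.
    by apply: nbhs_ninfty_le; exact: num_real.
  - apply/cvgryPge => A; near=> t; rewrite -ler_pdivrMl// lerBrDr; near: t.
    by apply: nbhs_pinfty_ge; exact: num_real.
  - exact: continuous_oneDsqrV.
  - by move=> x; rewrite invr_ge0 (le_trans ler01)// oneDsqr_ge1.
rewrite mulrC EFinM H -ge0_integralZl//.
- by apply: eq_integral => t _; rewrite -EFinM mulKf// gt_eqF.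
- by apply/measurable_EFinP; apply: measurable_funM => //; exact: measurable_cst.
- by move=> t _; rewrite lee_fin mulr_ge0 ?(ltW h0)// invr_ge0 addr_ge0// sqr_ge0.
- by rewrite lee_fin invr_ge0 ltW.
Unshelve. all: by end_near. Qed.

Lemma integrable_cauchy (C : R) :
  mu.-integrable setT (fun t => (C * (1 + t ^+ 2)^-1)%:E).
Proof.
have mk : measurable_fun setT (fun t : R => (1 + t ^+ 2)^-1).
  by apply: continuous_measurable_fun; exact: continuous_oneDsqrV.
under eq_fun do rewrite EFinM; apply: integrableZl => //.
apply/integrableP; split; first exact/measurable_EFinP.
under eq_integral => t _.
  rewrite gee0_abs; last by rewrite lee_fin invr_ge0 addr_ge0// sqr_ge0.
  rewrite (_ : t ^+ 2 = (1 * (t - 0)) ^+ 2); last by rewrite mul1r subr0.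
  over.
by rewrite integral_cauchy// ltry.
Qed.

(** Fundamental theorem of calculus on [[- k, k]]: the boundary values tend to [0] by the decay of
    [F], and dominated convergence identifies the limit of the integrals. *)
Lemma integral_derive_eq0 (F F' : R -> R) C :
  continuous F' -> (forall x : R, is_derive x 1 F (F' x)) ->
  (forall x, `|F x| <= C * (1 + x ^+ 2)^-1) -> (forall x, `|F' x| <= C * (1 + x ^+ 2)^-1) ->
  \int[mu]_t F' t = 0.
Proof.
move=> cF' dF bF bF'.
have iC := integrable_cauchy C.
have mF' : measurable_fun setT F' by exact: continuous_measurable_fun.
have := @dominated_cvg _ _ _ mu setT measurableT
  (fun k t => ((F' \_ `[- k.+1%:R, k.+1%:R]) t)%:E) (fun t => (F' t)%:E)
  (fun t => (C * (1 + t ^+ 2)^-1)%:E).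
move=> /(_ _ _ _ iC) cvI.
have cF x : {for x, continuous F}.
  by apply: differentiable_continuous; apply/derivable1_diffP; case: (dF x).
have {}cvI : (F k.+1%:R - F (- k.+1%:R))%:E @[k --> \oo] --> (\int[mu]_t (F' t)%:E)%E.
  have E k : (\int[mu]_t ((F' \_ `[- k.+1%:R, k.+1%:R]) t)%:E = (F k.+1%:R - F (- k.+1%:R))%:E)%E.
    have lt : - k.+1%:R < k.+1%:R :> R by rewrite gtrN// ltr0n.
    have := @continuous_FTC2 _ F' F _ _ lt; rewrite EFinB => <-.
    - by rewrite [RHS]integral_mkcond restrict_EFin.
    - exact: continuous_subspaceT.
    - split=> [x _||]; first by case: (dF x).
      + by apply: cvg_at_right_filter; exact: cF.
      + by apply: cvg_at_left_filter; exact: cF.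
    - by move=> x _; rewrite derive1E; case: (dF x).
  under eq_fun do rewrite -E.
  apply: cvI => //.
  - by move=> k; apply/measurable_EFinP/(measurable_restrictT F') => //; exact: (measurable_funS measurableT).
  - move=> x _; apply: cvg_near_cst; near=> k.
    have xk : `|x| < k.+1%:R.
      have xk : `|x| < k%:R by near: k; exact: nbhs_infty_gtr.
      by rewrite (lt_le_trans xk)// ler_nat.
    by rewrite patchE mem_set//= in_itv/= -ler_norml ltW.
  - move=> k x _; rewrite lee_fin patchE; case: ifPn => // _.
    by rewrite normr0 (le_trans _ (bF x)).
have lim0 : (F k.+1%:R - F (- k.+1%:R))%:E @[k --> \oo] --> 0%:E.
  apply: cvg_EFin; first by near=> k.
  apply/cvgr0Pnorm_le => e e0; near=> k.
  have k0 : 0 < k.+1%:R :> R by rewrite ltr0n.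
  have ck : `|2 * C| / e <= k.+1%:R.
    have xk : `|2 * C| / e < k%:R by near: k; exact: nbhs_infty_gtr.
    by rewrite ltW// (lt_le_trans xk)// ler_nat.
  have D0 : 0 < 1 + k.+1%:R ^+ 2 :> R by rewrite ltr_pwDl// sqr_ge0.
  have kD : k.+1%:R <= 1 + k.+1%:R ^+ 2 :> R by nra.
  rewrite (le_trans (ler_normB _ _))//.
  have := bF k.+1%:R; have := bF (- k.+1%:R); rewrite sqrrN => b1 b2.
  rewrite (le_trans (lerD b2 b1))// -mulrDl -mulr2n -[C *+ 2]mulr_natl.
  rewrite ler_pdivrMr// (le_trans (ler_norm _))//.
  by move: ck; rewrite ler_pdivrMr// => ck; rewrite (le_trans ck)// mulrC ler_pM2l.
by rewrite /Rintegral (cvg_unique _ cvI lim0).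
Unshelve. all: by end_near. Qed.
End line.

Section directional.
Variable R : realType.
(** [phi] carries the line through [x] in direction [w] to the line through [phi x] in direction
    [w'], so the two difference quotients are the same function. *)
Lemma is_derive_pull (U V W : normedModType R) (phi : U -> V) (f : V -> W) x w w' d :
  (forall s, phi (s *: w + x) = s *: w' + phi x) ->
  is_derive (phi x) w' f d -> is_derive x w (f \o phi) d.
Proof.
move=> phiE [df dE].
have E : (fun h => h^-1 *: (((f \o phi) \o shift x) (h *: w) - (f \o phi) x)) =
  (fun h => h^-1 *: ((f \o shift (phi x)) (h *: w') - f (phi x))).
  by apply/funext => h /=; rewrite phiE.
split; first by rewrite /derivable E.
by rewrite /derive E.
Qed.
End directional.

(** * The product Cauchy kernel and integrals of derivatives *)

Section cauchy_kernel.
Variable R : realType.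

(** A product of unnormalized Cauchy densities, the integrable majorant used throughout: it is
    positive and at most [1], its integral factors, and its restriction to [x_0 = t] is a multiple
    of the kernel in one dimension less. *)
Definition Pk n (h : R) (x : 'rV[R]_n) : R := \prod_(i < n) (1 + (h * x ord0 i) ^+ 2)^-1.

Lemma Pk_gt0 n h (x : 'rV[R]_n) : 0 < Pk h x.
Proof. by apply: prodr_gt0 => i _; rewrite invr_gt0 ltr_pwDl// sqr_ge0. Qed.

Lemma Pk_ge0 n h (x : 'rV[R]_n) : 0 <= Pk h x.
Proof. exact: ltW (Pk_gt0 h x). Qed.

Lemma Pk_le1 n h (x : 'rV[R]_n) : Pk h x <= 1.
Proof.
apply: prodr_ile1 => i _ /=; have := sqr_ge0 (h * x ord0 i) => s0.
by rewrite invr_ge0 addr_ge0//= invf_le1 ?lerDl// ltr_pwDl.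
Qed.

Lemma PkN n h (x : 'rV[R]_n) : Pk h (- x) = Pk h x.
Proof. by apply: eq_bigr => i _; rewrite mxE mulrN sqrrN. Qed.

Lemma cauchy_continuous (h a : R) : continuous (fun t : R => (1 + (h * (t - a)) ^+ 2)^-1).
Proof.
move=> x; apply: cvgV; first by rewrite gt_eqF// ltr_pwDl// sqr_ge0.
apply: cvgD; first exact: cvg_cst.
rewrite expr2; under eq_fun do rewrite expr2.
by apply: cvgM; (apply: cvgM; [exact: cvg_cst|apply: cvgB; [exact: cvg_id|exact: cvg_cst]]).
Qed.

Lemma L1_Pk n h (a : 'rV[R]_n) : 0 < h ->
  L1 (fun x => Pk h (x - a)) /\ Int (fun x => Pk h (x - a)) = (pi / h) ^+ n.
Proof.
move=> h0; pose k (i : 'I_n) (t : R) := (1 + (h * (t - a ord0 i)) ^+ 2)^-1.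
have E : (fun x => Pk h (x - a)) = (fun x => \prod_(i < n) k i (x ord0 i)).
  by apply/funext => x; apply: eq_bigr => i _; rewrite !mxE.
have := @eint_prod R n k (fun=> pi / h); rewrite prodr_const card_ord => /(_ _ _ _)H.
have mP : mfn (fun x : 'rV[R]_n => \prod_(i < n) k i (x ord0 i)).
  rewrite /mfn; apply: measurable_prod => i _.
  have mk : measurable_fun setT (k i) by apply: continuous_measurable_fun; exact: cauchy_continuous.
  exact: (measurableT_comp mk (mfn_cont (@coord_continuous R 1 n ord0 i))).
have {}H : eint (fun x : 'rV[R]_n => (\prod_(i < n) k i (x ord0 i))%:E) = ((pi / h) ^+ n)%:E.
  apply: H.
  - by move=> i t; rewrite invr_ge0 addr_ge0// sqr_ge0.
  - by move=> i; apply: continuous_measurable_fun; exact: cauchy_continuous.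
  - by move=> i; exact: integral_cauchy.
have P0 (x : 'rV[R]_n) : 0 <= \prod_(i < n) k i (x ord0 i).
  by apply: prodr_ge0 => i _; rewrite invr_ge0 addr_ge0// sqr_ge0.
have [|L _] := eint_L1 (C := (pi / h) ^+ n) mP P0; first by rewrite H.
rewrite E; split=> //; apply: EFin_inj; rewrite -H.
by rewrite -L1_eint.
Qed.

Lemma Pk_cons n h t (v : 'rV[R]_n) : Pk h (cons_row t v) = (1 + (h * t) ^+ 2)^-1 * Pk h v.
Proof.
rewrite /Pk big_ord_recl cons_row0; congr (_ * _).
by apply: eq_bigr => i _; rewrite cons_rowS.
Qed.

(** Every inner integral of the iterated [rint] must be finite to be matched with an integral over
    the product. A multiple of [Pk 1] ensures this on each section, where it is again a multiple of
    [Pk 1]; this drives the induction. *)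
Lemma Int_rint n (h : 'rV[R]_n -> R) C : mfn h -> (forall x, `|h x| <= C * Pk 1 x) ->
  L1 h /\ rint h = Int h.
Proof.
move=> mh bh; split.
  apply: (L1_dom mh _ bh); apply: L1Z.
  by have [] := L1_Pk (0 : 'rV[R]_n) ltr01; under eq_fun do rewrite subr0.
elim: n h C mh bh => [|n IH] h C mh bh.
  rewrite /Int /Rintegral integral_dirac// ; first by rewrite diracT mul1e.
have LP : L1 (fun x : 'rV[R]_n.+1 => C * Pk 1 x).
  apply: L1Z; have [] := L1_Pk (0 : 'rV[R]_n.+1) ltr01.
  by under eq_fun do rewrite subr0.
have Lh : L1 h := L1_dom mh LP bh.
rewrite [RHS]/Int /Rintegral /=.
rewrite -(@integral12_prod_meas1 _ _ _ _ R _ _ (fun p : measurableTypeR R * mT (model R n) => (h (cons_row p.1 (mv p.2)))%:E)); last exact: Lh.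
congr fine; apply: eq_integral => t _; rewrite /fubini_F /=.
have mht : mfn (fun v => h (cons_row t v)).
  exact: (measurable_fun_pair2 (f := fun p : measurableTypeR R * mT (model R n) => h (cons_row p.1 (mv p.2)))).
have bht v : `|h (cons_row t v)| <= (C * (1 + (1 * t) ^+ 2)^-1) * Pk 1 v.
  by rewrite -mulrA -Pk_cons.
rewrite (IH _ _ mht bht) /Int /Rintegral fineK//.
have LPn : L1 (fun x : 'rV[R]_n => (C * (1 + (1 * t) ^+ 2)^-1) * Pk 1 x).
  apply: L1Z; have [] := L1_Pk (0 : 'rV[R]_n) ltr01.
  by under eq_fun do rewrite subr0.
exact: (integrable_fin_num measurableT (L1_dom mht LPn bht)).
Qed.

Lemma evec_lineE n (i j : 'I_n) s (v : 'rV[R]_n) :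
  (s *: evec R i + v) ord0 j = s * (j == i)%:R + v ord0 j.
Proof. by rewrite mxE [X in X + _]mxE [X in _ * X]mxE eqxx. Qed.

Lemma cons_row_evec n t (v : 'rV[R]_n) (i : 'I_n) s :
  cons_row t (s *: evec R i + v) = s *: evec R (lift ord0 i) + cons_row t v.
Proof.
apply/rowP => j; have [k ->|->] := unliftP ord0 j.
  by rewrite evec_lineE !cons_rowS evec_lineE (inj_eq lift_inj).
by rewrite evec_lineE !cons_row0 (_ : _ == _ = false) ?mulr0 ?add0r.
Qed.

Lemma cons_row_evec0 n t (v : 'rV[R]_n) s :
  cons_row (s *: 1 + t) v = s *: evec R ord0 + cons_row t v.
Proof.
apply/rowP => j; have [k ->|->] := unliftP ord0 j.
  by rewrite evec_lineE !cons_rowS (_ : _ == _ = false) ?mulr0 ?add0r.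
by rewrite evec_lineE !cons_row0 eqxx.
Qed.

Lemma cons_row_continuous_r n t : continuous (fun v : 'rV[R]_n => cons_row t v).
Proof.
move=> v; apply: (@continuous_comp _ _ _ (fun v : 'rV[R]_n => (t, v)) (fun p : R * 'rV[R]_n => cons_row p.1 p.2)).
  by apply: (@cvg_pair _ _ _ (nbhs v) (nbhs t) (nbhs v)) => /=; [exact: cvg_cst|exact: cvg_id].
exact: cons_row_continuous.
Qed.

Lemma cons_row_continuous_l n (v : 'rV[R]_n) : continuous (fun t : R => cons_row t v).
Proof.
move=> t; apply: (@continuous_comp _ _ _ (fun t : R => (t, v)) (fun p : R * 'rV[R]_n => cons_row p.1 p.2)).
  by apply: (@cvg_pair _ _ _ (nbhs t) (nbhs t) (nbhs v)) => /=; [exact: cvg_id|exact: cvg_cst].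
exact: cons_row_continuous.
Qed.

(** Induction on the dimension. A coordinate other than the first is treated inside the inner
    integral; for the first one the order of integration is exchanged and the one-dimensional
    statement applies on each line. *)
Lemma Int_derive_eq0 n (i : 'I_n) (H H' : 'rV[R]_n -> R) C :
  continuous H' -> (forall x, is_derive x (evec R i) H (H' x)) ->
  (forall x, `|H x| <= C * Pk 1 x) -> (forall x, `|H' x| <= C * Pk 1 x) ->
  Int H' = 0.
Proof.
move=> cH' dH bH bH'.
have [LH' <-] := Int_rint (mfn_cont cH') bH'.
elim: n i H H' C cH' dH bH bH' LH' => [[]//|n IH] i H H' C cH' dH bH bH' LH'.
have bt (G : 'rV[R]_n.+1 -> R) t v : (forall x, `|G x| <= C * Pk 1 x) ->
    `|G (cons_row t v)| <= (C * (1 + (1 * t) ^+ 2)^-1) * Pk 1 v.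
  by move=> bG; rewrite -mulrA -Pk_cons.
have ct t : continuous (fun v => H' (cons_row t v)).
  by move=> v; apply: continuous_comp; [exact: cons_row_continuous_r|exact: cH'].
have [k ik|i0] := unliftP ord0 i.
  rewrite /= (_ : (fun t => _) = cst 0); first by rewrite /Rintegral integral0.
  apply/funext => t /=.
  have [L _] := Int_rint (mfn_cont (ct t)) (fun v => bt _ t v bH').
  apply: (IH k (H \o cons_row t) (fun v => H' (cons_row t v)) (C * (1 + (1 * t) ^+ 2)^-1)) => //.
  - move=> v; have dv := dH (cons_row t v); rewrite ik in dv.
    by apply: (is_derive_pull _ dv) => s; exact: cons_row_evec.
  - by move=> v; exact: bt.
  - by move=> v; exact: bt.
have [_ ->] := Int_rint (mfn_cont cH') bH'.
rewrite /Int /Rintegral /=.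
rewrite -(@integral21_prod_meas1 _ _ _ _ R _ _ (fun p : measurableTypeR R * mT (model R n) => (H' (cons_row p.1 (mv p.2)))%:E)); last exact: LH'.
rewrite integral0_eq// => v _; rewrite /fubini_G /=.
set w := mv v.
have b1 (G : 'rV[R]_n.+1 -> R) t : (forall x, `|G x| <= C * Pk 1 x) ->
    `|G (cons_row t w)| <= (C * Pk 1 w) * (1 + t ^+ 2)^-1.
  by move=> bG; rewrite (le_trans (bt _ _ _ bG))// mul1r mulrAC.
have cw : continuous (fun t => H' (cons_row t w)).
  by move=> t; apply: continuous_comp; [exact: cons_row_continuous_l|exact: cH'].
have I0 : \int[@lebesgue_measure R]_t H' (cons_row t w) = 0.
  apply: (@integral_derive_eq0 R (fun t => H (cons_row t w)) _ (C * Pk 1 w) cw).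
  - move=> t; have dv := dH (cons_row t w); rewrite i0 in dv.
    by apply: (@is_derive_pull _ _ _ _ (fun t => cons_row t w) _ _ _ _ _ _ dv) => s; exact: cons_row_evec0.
  - by move=> t; exact: b1.
  - by move=> t; exact: b1.
rewrite -[LHS]fineK; first by rewrite -[fine _]/(\int[@lebesgue_measure R]_t H' (cons_row t w)) I0.
apply: integrable_fin_num => //.
apply: (le_integrable _ _ _ (integrable_cauchy (C * Pk 1 w))) => //.
  by apply/measurable_EFinP; exact: continuous_measurable_fun.
by move=> t _; rewrite lee_fin (le_trans (b1 _ _ bH'))// ler_norm.
Qed.
End cauchy_kernel.

(** * Oscillatory integrals and cutoff functions *)

Section continuity.
Variables (R : realType) (X : topologicalType).

Lemma ctsD (f g : X -> R) : continuous f -> continuous g -> continuous (fun x => f x + g x).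
Proof. by move=> cf cg x; apply: cvgD; [exact: cf|exact: cg]. Qed.

Lemma ctsB (f g : X -> R) : continuous f -> continuous g -> continuous (fun x => f x - g x).
Proof. by move=> cf cg x; apply: cvgB; [exact: cf|exact: cg]. Qed.

Lemma ctsM (f g : X -> R) : continuous f -> continuous g -> continuous (fun x => f x * g x).
Proof. by move=> cf cg x; apply: cvgM; [exact: cf|exact: cg]. Qed.

Lemma cts_cst (Y : topologicalType) (c : Y) : continuous (fun _ : X => c).
Proof. by move=> x; exact: cvg_cst. Qed.

Lemma cts_comp (Y Z : topologicalType) (f : X -> Y) (g : Y -> Z) :
  continuous f -> continuous g -> continuous (fun x => g (f x)).
Proof. by move=> cf cg x; apply: continuous_comp; [exact: cf|exact: cg]. Qed.

Lemma cts_pair (Y Z : topologicalType) (f : X -> Y) (g : X -> Z) :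
  continuous f -> continuous g -> continuous (fun x => (f x, g x)).
Proof. by move=> cf cg x; apply: cvg_pair; [exact: cf|exact: cg]. Qed.

End continuity.

Lemma continuous_sum (R : realType) (X : topologicalType) (I : Type) (s : seq I) (f : I -> X -> R) :
  (forall i, continuous (f i)) -> continuous (fun x => \sum_(i <- s) f i x).
Proof.
move=> cf; elim: s => [|i s IH].
  by under eq_fun do rewrite big_nil; move=> x; exact: cvg_cst.
by under eq_fun do rewrite big_cons; move=> x; apply: cvgD; [exact: cf|exact: IH].
Qed.

Lemma continuous_prod (R : realType) (X : topologicalType) (I : Type) (s : seq I) (f : I -> X -> R) :
  (forall i, continuous (f i)) -> continuous (fun x => \prod_(i <- s) f i x).
Proof.
move=> cf; elim: s => [|i s IH].
  by under eq_fun do rewrite big_nil; move=> x; exact: cvg_cst.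
by under eq_fun do rewrite big_cons; move=> x; apply: cvgM; [exact: cf|exact: IH].
Qed.

Section oscillation.
Variables (R : realType) (n : nat).
Local Notation V := 'rV[R]_n.

Definition Der (i : 'I_n) (F F' : V -> R) := forall x, is_derive x (evec R i) F (F' x).

Lemma is_derive_line (W : normedModType R) (F : W -> R) (x v : W) (d : R) :
  is_derive (0 : R) 1 (fun s : R => F (s *: v + x)) d -> is_derive x v F d.
Proof.
move=> [df dE].
have E : (fun h : R => h^-1 *: ((F \o shift x) (h *: v) - F x)) =
  (fun h : R => h^-1 *: (((fun s : R => F (s *: v + x)) \o shift 0) (h *: (1 : R)) -
                          F ((0 : R) *: v + x))).
  by apply/funext => h /=; rewrite scale0r add0r addr0 [h *: 1]mulr1.
split; first by rewrite /derivable E.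
by rewrite /derive E.
Qed.

Lemma DerM i F F' G G' : Der i F F' -> Der i G G' ->
  Der i (fun x => F x * G x) (fun x => F' x * G x + F x * G' x).
Proof.
move=> dF dG x; have := is_deriveM (dF x) (dG x).
by rewrite addrC [G x *: _]mulrC.
Qed.

Lemma DerD i F F' G G' : Der i F F' -> Der i G G' ->
  Der i (fun x => F x + G x) (fun x => F' x + G' x).
Proof. by move=> dF dG x; exact: is_deriveD. Qed.

Lemma Der_cst i c : Der i (fun=> c) (fun=> 0).
Proof. by move=> x; exact: is_derive_cst. Qed.

Lemma dotp_line (x z : V) s i : dotp (s *: evec R i + x) z = s * z ord0 i + dotp x z.
Proof.
rewrite /dotp (eq_bigr (fun j => s * (j == i)%:R * z ord0 j + x ord0 j * z ord0 j)).
  rewrite big_split /=; congr (_ + _).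
  rewrite (bigD1 i)//= eqxx mulr1 big1 ?addr0// => j /negbTE ->.
  by rewrite mulr0 mul0r.
by move=> j _; rewrite evec_lineE mulrDl.
Qed.

Lemma coord_cont (i : 'I_n) : continuous (fun x : V => x ord0 i).
Proof. exact: coord_continuous. Qed.

Lemma dotp_continuous : continuous (fun p : V * V => dotp p.1 p.2).
Proof.
rewrite /dotp; apply: continuous_sum => i p; apply: cvgM.
  by apply: (@continuous_comp _ _ _ fst (fun x : V => x ord0 i)); [exact: cvg_fst|exact: coord_cont].
by apply: (@continuous_comp _ _ _ snd (fun x : V => x ord0 i)); [exact: cvg_snd|exact: coord_cont].
Qed.

(** A real plane wave with a phase. Differentiation shifts the phase by [pi / 2] and a change of
    sign shifts it by [pi], so this real family is closed under the operations for which one would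
    use a complex exponential. *)
Definition wave (k : R) (x z : V) : R := cos (2 * pi * dotp x z + k).

Lemma sin_wave (x z : V) : sin (2 * pi * dotp x z) = wave (- (pi / 2)) x z.
Proof. by rewrite /wave -cosN opprD opprK cosDpihalf sinN opprK. Qed.

Lemma cos_wave (x z : V) : cos (2 * pi * dotp x z) = wave 0 x z.
Proof. by rewrite /wave addr0. Qed.

Lemma wave_pi k (x z : V) : wave (k + pi) x z = - wave k x z.
Proof. by rewrite /wave addrA cosDpi. Qed.

Lemma wave_le1 k x z : `|wave k x z| <= 1.
Proof. by rewrite /wave ler_norml cos_geN1 cos_le1. Qed.

Lemma wave_continuous k : continuous (fun p : V * V => wave k p.1 p.2).
Proof.
move=> p; apply: continuous_comp; last exact: continuous_cos.
by apply: cvgD; [apply: cvgM; [exact: cvg_cst|exact: dotp_continuous]|exact: cvg_cst].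
Qed.

Lemma wave_continuous_l k z : continuous (fun x : V => wave k x z).
Proof.
move=> x; apply: (@continuous_comp _ _ _ (fun x : V => (x, z)) (fun p : V * V => wave k p.1 p.2)).
  by apply: (@cvg_pair _ _ _ (nbhs x) (nbhs x) (nbhs z)) => /=; [exact: cvg_id|exact: cvg_cst].
exact: wave_continuous.
Qed.

Lemma Der_wave i k z : Der i (fun x => wave k x z)
  (fun x => 2 * pi * z ord0 i * wave (k + pi / 2) x z).
Proof.
move=> x; apply: is_derive_line; rewrite /wave.
under eq_fun do rewrite dotp_line.
have d1 : is_derive (0 : R) (1 : R) (fun s : R => 2 * pi * (s * z ord0 i + dotp x z) + k) (2 * pi * z ord0 i).
  by apply: is_derive_eq; rewrite /GRing.scale /=; ring.
have := is_derive1_comp (is_derive_cos _) d1.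
by rewrite mul0r add0r addrA cosDpihalf => /is_derive_eq; apply; rewrite mulrC.
Qed.

Definition nice (F : V -> R) := continuous F /\ exists C, forall x, `|F x| <= C * Pk 1 x.

Lemma nice_L1 F : nice F -> L1 F.
Proof.
move=> [cF [C FC]]; apply: (L1_dom (mfn_cont cF) _ FC); apply: L1Z.
by have [] := L1_Pk (0 : V) ltr01; under eq_fun do rewrite subr0.
Qed.

Lemma L1_wave F k z : L1 F -> L1 (fun x => F x * wave k x z).
Proof.
move=> lF; apply: (L1_dom _ (L1_abs lF)).
  by apply: measurable_funM; [exact: L1_mfn|exact: (mfn_cont (@wave_continuous_l k z))].
by move=> x; rewrite normrM ler_piMr// wave_le1.
Qed.

(** The product of [F] with the wave and its derivative are dominated by [Pk 1], so the integral of
    that derivative is zero: there is no boundary term. *)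
Lemma Int_by_parts i F F' k z : nice F -> nice F' -> Der i F F' ->
  Int (fun x => F' x * wave k x z) =
  - (2 * pi * z ord0 i) * Int (fun x => F x * wave (k + pi / 2) x z).
Proof.
move=> nF nF' dF.
have lF := nice_L1 nF; have lF' := nice_L1 nF'.
have H := @Int_derive_eq0 R n i (fun x => F x * wave k x z)
  (fun x => F' x * wave k x z + F x * (2 * pi * z ord0 i * wave (k + pi / 2) x z)).
case: nF nF' => cF [C FC] [cF' [C' FC']].
have C0 : 0 <= C.
  by have := le_trans (normr_ge0 _) (FC 0); rewrite pmulr_lge0// Pk_gt0.
have C'0 : 0 <= C'.
  by have := le_trans (normr_ge0 _) (FC' 0); rewrite pmulr_lge0// Pk_gt0.
have : Int (fun x => F' x * wave k x z + F x * (2 * pi * z ord0 i * wave (k + pi / 2) x z)) = 0.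
  apply: (H (C + C' + C * `|2 * pi * z ord0 i|)).
  - apply: ctsD; first by apply: ctsM => //; exact: wave_continuous_l.
    by apply: ctsM => //; apply: ctsM; [exact: cts_cst|exact: wave_continuous_l].
  - by apply: DerM => //; exact: Der_wave.
  - move=> x; rewrite normrM; apply: (@le_trans _ _ (C * Pk 1 x)).
      by rewrite (le_trans _ (FC x))// ler_piMr// wave_le1.
    by rewrite ler_pM2r ?Pk_gt0// -addrA lerDl addr_ge0// mulr_ge0.
  - move=> x; rewrite (le_trans (ler_normD _ _))// !normrM.
    apply: (@le_trans _ _ (C' * Pk 1 x + C * Pk 1 x * (`|2| * `|pi| * `|z ord0 i|))).
      apply: lerD; first by rewrite (le_trans _ (FC' x))// ler_piMr// wave_le1.
      by apply: ler_pM => //; rewrite ler_piMr ?wave_le1// !mulr_ge0.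
    rewrite -mulrA [Pk 1 x * _]mulrC mulrA -mulrDl ler_pM2r ?Pk_gt0//.
    by rewrite lerD2r lerDr.
rewrite IntD; last 2 first.
- exact: L1_wave.
- by under eq_fun do rewrite mulrCA; apply: L1Z; exact: L1_wave.
under [X in _ + Int X = _]eq_fun do rewrite mulrCA.
rewrite IntZ; last exact: L1_wave.
by move/eqP; rewrite addr_eq0 => /eqP ->; rewrite mulNr.
Qed.

(** A chain of [p] derivatives in one direction, from [F] down to [G]; all members are dominated by
    the kernel, so that each integration by parts is legitimate. *)
Fixpoint nderiv (i : 'I_n) (p : nat) (F G : V -> R) : Prop :=
  nice F /\ match p with
  | 0 => F = G
  | p'.+1 => exists F', Der i F F' /\ nderiv i p' F' G
  end.

Lemma nderiv_nice i p F G : nderiv i p F G -> nice F.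
Proof. by case: p => [|p] []. Qed.

Lemma nderiv_wave i p F G k (z : V) : nderiv i p F G ->
  `|2 * pi * z ord0 i| ^+ p * `|Int (fun x => F x * wave k x z)| <= Int (fun x => `|G x|).
Proof.
elim: p F k => [|p IH] F k /=.
  move=> [nF <-]; rewrite expr0 mul1r; have lF := nice_L1 nF.
  apply: Int_abs_le.
  - exact: (L1_mfn (L1_wave k z lF)).
  - exact: L1_abs.
  - by move=> x; rewrite normrM ler_piMr// wave_le1.
move=> [nF [F' [dF cF']]].
(* The phase is lowered in advance, since integration by parts raises it by [pi / 2], back to
   [k]. *)
have := IH F' (k - pi / 2) cF'.
rewrite (Int_by_parts _ _ nF (nderiv_nice cF') dF) subrK mulNr normrN [X in _ * X <= _]normrM mulrA.
by rewrite -exprSr.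
Qed.

(** Pure derivatives of order [2 n] suffice: the product over the coordinates of
    [max(1, (h z_i) ^ 2)] is at most the [n]-th power of its largest factor, and derivatives in that
    one direction pay for this power. The factor [2 ^ n] comes from
    [1 + t ^ 2 <= 2 max(1, t ^ 2)]. *)
Lemma oscillation F h D k (z : V) : 0 < h -> L1 F -> Int (fun x => `|F x|) <= D ->
  (forall i, exists2 G, nderiv i (2 * n) F G & Int (fun x => `|G x|) <= D * h ^- (2 * n)) ->
  `|Int (fun x => F x * wave k x z)| <= 2 ^+ n * D * Pk h z.
Proof.
move=> h0 lF FD HG; set X := `|_|.
have XD : X <= D.
  apply: le_trans FD; apply: Int_abs_le.
  - exact: (L1_mfn (L1_wave k z lF)).
  - exact: L1_abs.
  - by move=> x; rewrite normrM ler_piMr// wave_le1.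
have X0 : 0 <= X := normr_ge0 _.
have XzD i : X * ((h * z ord0 i) ^+ 2) ^+ n <= D.
  have [G cG GD] := HG i.
  have := le_trans (nderiv_wave k z cG) GD; rewrite -/X.
  rewrite ler_pdivlMr ?exprn_gt0// => H.
  apply: le_trans H; rewrite mulrAC [leLHS]mulrC ler_wpM2r// -exprMn -exprM.
  rewrite -[leLHS]ger0_norm; last by rewrite exprM exprn_ge0// sqr_ge0.
  rewrite normrX lerXn2r ?nnegrE//; first by rewrite mulr_ge0// ltW.
  rewrite [leRHS]mulrC [leLHS]normrM (gtr0_norm h0) ler_wpM2l ?(ltW h0)//.
  rewrite normrM ler_peMl// ger0_norm ?mulr_ge0 ?pi_ge0//.
  have := pi_ge2 R; lra.
pose b i := Num.max 1 ((h * z ord0 i) ^+ 2).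
have Xb : X * \prod_(i < n) b i <= D.
  have [n0|n0] := posnP n.
    by rewrite big1 ?mulr1// => i; exfalso; move: (leq_ltn_trans (leq0n _) (ltn_ord i)); rewrite n0.
  pose i0 : 'I_n := Ordinal n0.
  have [j _ jm] := @arg_maxP _ _ _ i0 predT b isT.
  apply: (@le_trans _ _ (X * \prod_(i < n) b j)).
    rewrite ler_wpM2l// ler_prod// => i _; apply/andP; split; last exact: jm.
    by rewrite (le_trans ler01)// le_max lexx.
  rewrite prodr_const card_ord /b; have [c1|c1] := leP 1 ((h * z ord0 j) ^+ 2).
    exact: XzD.
  by rewrite expr1n mulr1.
rewrite /Pk prodfV ler_pdivlMr; last first.
  by apply: prodr_gt0 => i _; rewrite ltr_pwDl// sqr_ge0.
apply: (@le_trans _ _ (X * \prod_(i < n) (2 * b i))).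
  rewrite ler_wpM2l// ler_prod// => i _; rewrite addr_ge0 ?sqr_ge0//=.
  have : 1 <= b i by rewrite le_max lexx.
  have : (h * z ord0 i) ^+ 2 <= b i by rewrite le_max lexx orbT.
  lra.
by rewrite big_split /= prodr_const card_ord mulrCA ler_wpM2l ?exprn_ge0.
Qed.

End oscillation.

(** * Bounds on successive derivatives at a given scale *)

Section jets.
Variables (R : realType) (E : Type).
Variable D : (E -> R) -> (E -> R) -> Prop.
Implicit Types (Bd : (E -> R) -> R -> Prop) (F G : E -> R).

(* The q-th derivative of [F] in the sense of [D], for [q <= p], satisfies the bound
   [Bd] with the constant [A / h ^ q]. *)
Fixpoint jet Bd (p : nat) (h A : R) F : Prop :=
  Bd F A /\ match p with
  | 0 => True
  | p'.+1 => exists F', D F F' /\ jet Bd p' h (A / h) F'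
  end.

Lemma jet_bd Bd p h A F : jet Bd p h A F -> Bd F A.
Proof. by case: p => [|p] []. Qed.

Lemma jet_trunc Bd p h A F : jet Bd p.+1 h A F -> jet Bd p h A F.
Proof.
elim: p A F => [|p IH] A F; first by move=> [].
move=> [bF [F' [dF jF']]]; split=> //; exists F'; split=> //; exact: IH.
Qed.

Lemma jet_mono Bd1 Bd2 p h A B F : 0 < h ->
  (forall F A B, A <= B -> Bd1 F A -> Bd2 F B) -> A <= B ->
  jet Bd1 p h A F -> jet Bd2 p h B F.
Proof.
move=> h0 Bd12; elim: p A B F => [|p IH] A B F AB /=.
  by move=> [bF _]; split=> //; exact: Bd12 bF.
move=> [bF [F' [dF jF']]]; split; first exact: Bd12 bF.
by exists F'; split=> //; apply: IH jF'; rewrite ler_pM2r ?invr_gt0.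
Qed.

Lemma jetD Bd p h A B F G :
  (forall F G A B, Bd F A -> Bd G B -> Bd (fun x => F x + G x) (A + B)) ->
  (forall F F' G G', D F F' -> D G G' -> D (fun x => F x + G x) (fun x => F' x + G' x)) ->
  jet Bd p h A F -> jet Bd p h B G -> jet Bd p h (A + B) (fun x => F x + G x).
Proof.
move=> BdD DD; elim: p A B F G => [|p IH] A B F G /=.
  by move=> [bF _] [bG _]; split=> //; exact: BdD.
move=> [bF [F' [dF jF']]] [bG [G' [dG jG']]]; split; first exact: BdD.
by exists (fun x => F' x + G' x); split; [exact: DD|rewrite mulrDl; exact: IH].
Qed.

(** The Leibniz rule doubles the number of terms at each order, hence [2 ^ p]. Three bounds are
    allowed because the factors and the product may be controlled in different senses, as when a
    symbol known only on a shell meets a cutoff supported there. *)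
Lemma jetM Bd1 Bd2 Bd3 p h A B F G : 0 < h ->
  (forall F A B, A <= B -> Bd3 F A -> Bd3 F B) ->
  (forall F G A B, Bd3 F A -> Bd3 G B -> Bd3 (fun x => F x + G x) (A + B)) ->
  (forall F G A B, Bd1 F A -> Bd2 G B -> 0 <= A * B /\ Bd3 (fun x => F x * G x) (A * B)) ->
  (forall F F' G G', D F F' -> D G G' -> D (fun x => F x + G x) (fun x => F' x + G' x)) ->
  (forall F F' G G', D F F' -> D G G' ->
    D (fun x => F x * G x) (fun x => F' x * G x + F x * G' x)) ->
  jet Bd1 p h A F -> jet Bd2 p h B G -> jet Bd3 p h (2 ^+ p * (A * B)) (fun x => F x * G x).
Proof.
move=> h0 mono BdD BdM DD DM; elim: p A B F G => [|p IH] A B F G.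
  by move=> [bF _] [bG _]; split=> //; rewrite expr0 mul1r; exact: (BdM _ _ _ _ bF bG).2.
move=> jF jG; have [bF [F' [dF jF']]] := jF; have [bG [G' [dG jG']]] := jG.
have [AB0 bFG] := BdM _ _ _ _ bF bG.
split.
  by apply: mono bFG; rewrite ler_peMl// exprn_ege1// ler1n.
exists (fun x => F' x * G x + F x * G' x); split; first exact: DM.
have -> : 2 ^+ p.+1 * (A * B) / h = 2 ^+ p * (A / h * B) + 2 ^+ p * (A * (B / h)).
  by rewrite exprS; field; rewrite gt_eqF.
by apply: jetD => //; apply: IH => //; exact: jet_trunc.
Qed.

Lemma jetZ Bd p h A B c F :
  (forall F A, Bd F A -> Bd (fun x => F x * c) (A * B)) ->
  (forall F F', D F F' -> D (fun x => F x * c) (fun x => F' x * c)) ->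
  jet Bd p h A F -> jet Bd p h (A * B) (fun x => F x * c).
Proof.
move=> BdZ DZ; elim: p A F => [|p IH] A F /=.
  by move=> [bF _]; split=> //; exact: BdZ.
move=> [bF [F' [dF jF']]]; split; first exact: BdZ.
by exists (fun x => F' x * c); split; [exact: DZ|rewrite mulrAC; exact: IH].
Qed.

Lemma jet0 Bd p h A : 0 < h -> 0 <= A -> (forall A, 0 <= A -> Bd (fun=> 0) A) ->
  D (fun=> 0) (fun=> 0) -> jet Bd p h A (fun=> 0).
Proof.
move=> h0 A0 Bd0 D0; elim: p A A0 => [|p IH] A A0; split=> //; try exact: Bd0.
by exists (fun=> 0); split=> //; apply: IH; rewrite divr_ge0// ltW.
Qed.

(** Carries along a property inherited by derivatives, such as vanishing off a set, so that it can
    enter the bound at every order. *)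
Lemma jet_with Bd (Z : (E -> R) -> Prop) p h A F :
  (forall F F', D F F' -> Z F -> Z F') -> Z F ->
  jet Bd p h A F -> jet (fun F A => Bd F A /\ Z F) p h A F.
Proof.
move=> DZ; elim: p A F => [|p IH] A F ZF /=; first by move=> [].
move=> [bF [F' [dF jF']]]; split=> //; exists F'; split=> //; apply: IH => //.
exact: DZ ZF.
Qed.

End jets.

Lemma jet_map (R : realType) (E E' : Type) (D : (E -> R) -> (E -> R) -> Prop)
    (D' : (E' -> R) -> (E' -> R) -> Prop) (phi : E' -> E) Bd Bd' p h A F :
  (forall F A, Bd F A -> Bd' (F \o phi) A) ->
  (forall F F', D F F' -> D' (F \o phi) (F' \o phi)) ->
  jet D Bd p h A F -> jet D' Bd' p h A (F \o phi).
Proof.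
move=> BB DD; elim: p A F => [|p IH] A F /=; first by move=> [bF _]; split=> //; exact: BB.
move=> [bF [F' [dF jF']]]; split; first exact: BB.
by exists (F' \o phi); split; [exact: DD|exact: IH].
Qed.

(** * Cutoff functions on the line *)

Section line_cutoff.
Variable R : realType.

Definition Der1 (F F' : R -> R) := forall t : R, is_derive t 1 F (F' t).
Definition bdd1 (F : R -> R) (A : R) := continuous F /\ forall t, `|F t| <= A.
(** Qualitative [C^p] regularity, phrased as a jet with constant [0] so that the sum and Leibniz
    rules for jets apply to it. *)
Definition Cp (p : nat) (F : R -> R) := jet Der1 (fun F A => continuous F /\ 0 <= A) p 1 0 F.

Lemma Der1M F F' G G' : Der1 F F' -> Der1 G G' ->
  Der1 (fun x => F x * G x) (fun x => F' x * G x + F x * G' x).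
Proof.
move=> dF dG x; have := is_deriveM (dF x) (dG x).
by rewrite addrC [G x *: _]mulrC.
Qed.

Lemma Der1D F F' G G' : Der1 F F' -> Der1 G G' ->
  Der1 (fun x => F x + G x) (fun x => F' x + G' x).
Proof. by move=> dF dG x; exact: is_deriveD. Qed.

Lemma Cp_cts p F : Cp p F -> continuous F.
Proof. by move/jet_bd => []. Qed.

Lemma CpM p F G : Cp p F -> Cp p G -> Cp p (fun x => F x * G x).
Proof.
move=> cF cG; pose Bd (f : R -> R) (A : R) := continuous f /\ 0 <= A.
have := @jetM R R Der1 Bd Bd Bd p 1 0 0 F G ltr01 _ _ _ Der1D Der1M cF cG.
rewrite !mulr0; apply.
- by move=> f A B AB [cf A0]; split=> //; exact: le_trans AB.
- by move=> f g A B [cf A0] [cg B0]; split; [exact: ctsD|exact: addr_ge0].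
- by move=> f g A B [cf A0] [cg B0]; have AB0 := mulr_ge0 A0 B0; split=> //; split=> //; exact: ctsM.
Qed.

Lemma CpD p F G : Cp p F -> Cp p G -> Cp p (fun x => F x + G x).
Proof.
move=> cF cG; pose Bd (f : R -> R) (A : R) := continuous f /\ 0 <= A.
have := @jetD R R Der1 Bd p 1 0 0 F G _ Der1D cF cG.
rewrite addr0; apply.
by move=> f g A B [cf A0] [cg B0]; split; [exact: ctsD|exact: addr_ge0].
Qed.

Lemma Cp_cst p c : Cp p (fun=> c).
Proof.
have c0 q : Cp q (fun=> 0).
  apply: jet0 => //; first by move=> A A0; split=> //; exact: cts_cst.
  by move=> t; exact: is_derive_cst.
case: p => [|p]; split=> //; try by split=> //; exact: cts_cst.
by exists (fun=> 0); split; [move=> t; exact: is_derive_cst|rewrite mul0r; exact: c0].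
Qed.

Lemma CpS p F F' : continuous F -> Der1 F F' -> Cp p F' -> Cp p.+1 F.
Proof. by move=> cF dF cF'; split=> //; exists F'; split=> //; rewrite mul0r. Qed.

Lemma CpSP p F : Cp p.+1 F -> exists F', Der1 F F' /\ Cp p F'.
Proof. by move=> [_ [F' [dF cF']]]; exists F'; split=> //; rewrite mul0r in cF'. Qed.

Lemma Der1_affine F F' a b : Der1 F F' -> Der1 (fun t => F (a * t + b)) (fun t => F' (a * t + b) * a).
Proof.
move=> dF t.
have da : is_derive t (1 : R) (fun t : R => a * t + b) a.
  by apply: is_derive_eq; rewrite /GRing.scale /=; ring.
exact: (is_derive1_comp (dF _) da).
Qed.

Lemma Cp_affine p F a b : Cp p F -> Cp p (fun t => F (a * t + b)).
Proof.
have ca : continuous (fun t : R => a * t + b).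
  by apply: ctsD; [apply: ctsM; [exact: cts_cst|move=> t; exact: cvg_id]|exact: cts_cst].
elim: p F => [|p IH] F.
  by move=> /Cp_cts cF; split=> //; split=> //; apply: (cts_comp ca cF).
move=> cF; have [F' [dF cF']] := CpSP cF.
apply: (CpS (cts_comp ca (Cp_cts cF)) (Der1_affine a b dF)).
by apply: CpM; [exact: IH|exact: Cp_cst].
Qed.

Lemma Cp_inv p F : (forall t, F t != 0) -> Cp p F -> Cp p (fun t => (F t)^-1).
Proof.
move=> F0; elim: p => [|p IH] cF.
  by split=> //; split=> // t; apply: cvgV => //; exact: (Cp_cts cF).
have [F' [dF cF']] := CpSP cF.
apply: (@CpS _ _ (fun t => (F' t * -1) * ((F t)^-1 * (F t)^-1))).
- by move=> t; apply: cvgV => //; exact: (Cp_cts cF).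
- move=> t; have := is_deriveV (F0 t) (dF t).
  by rewrite /GRing.scale /= => /is_derive_eq; apply; rewrite expr2 invfM; ring.
- have iF := IH (jet_trunc cF).
  by apply: CpM; [apply: CpM => //; exact: Cp_cst|exact: CpM].
Qed.

(** A truncated power: it has [q - 1] continuous derivatives, and a fixed finite number is all that
    the cutoffs must have. *)
Definition posX (q : nat) (t : R) := Num.max 0 t ^+ q.

Lemma posX_cts q : continuous (posX q).
Proof.
have cm : continuous (fun t : R => Num.max 0 t).
  by move=> t; apply: continuous_max; [exact: cvg_cst|exact: cvg_id].
exact: (cts_comp cm (@exprn_continuous R q)).
Qed.

Lemma Der1_posX q : Der1 (posX q.+2) (fun t => posX q.+1 t * q.+2%:R).
Proof.
move=> t; have [t0|t0|->] := ltgtP t 0.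
- have -> : posX q.+1 t = 0 by rewrite /posX max_l ?ltW// expr0n.
  rewrite mul0r; apply: (@near_eq_is_derive _ _ _ (cst 0)).
  near=> x; rewrite /posX max_l ?expr0n//; apply: ltW; near: x; exact: lt_nbhsl.
- apply: (@near_eq_is_derive _ _ _ (fun x : R => x ^+ q.+2)).
    near=> x; rewrite /posX max_r//; apply: ltW; near: x; exact: lt_nbhsr.
  have := is_deriveX q.+2 (is_derive_id t (1 : R)); rewrite exprfctE => /is_derive_eq; apply.
  by rewrite /posX max_r ?ltW// /GRing.scale /= mulr1 mulrC.
(* At the origin the difference quotient of [posX q.+2] is [posX q.+1], which is continuous and
   vanishes there. *)
apply/is_derive1_caratheodory; exists (posX q.+1); split.
- move=> z; rewrite {2}/posX max_l// expr0n subr0 subr0 /posX.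
  by have [z0|z0] := leP 0 z; rewrite ?exprSr ?mulr0 ?mul0r.
- exact: posX_cts.
- by rewrite /posX max_l// expr0n mul0r.
Unshelve. all: by end_near. Qed.

Lemma Cp_posX p : Cp p (posX p.+1).
Proof.
elim: p => [|p IH]; first by split=> //; split=> //; exact: posX_cts.
apply: (CpS (@posX_cts p.+2) (@Der1_posX p)).
by apply: CpM => //; exact: Cp_cst.
Qed.

(** The terms of the denominator vanish for [t <= 0] and for [t >= 1] respectively, never together,
    so the quotient runs from [0] to [1] with the regularity of its ingredients. *)
Definition step (p : nat) (t : R) := posX p.+1 t * (posX p.+1 t + posX p.+1 (-1 * t + 1))^-1.

Lemma posX_ge0 q t : 0 <= posX q t.
Proof. by rewrite exprn_ge0// le_max lexx. Qed.

Lemma posX_gt0 q t : 0 < t -> 0 < posX q t.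
Proof. by move=> t0; rewrite exprn_gt0// lt_max t0 orbT. Qed.

Lemma step_den p t : 0 < posX p.+1 t + posX p.+1 (-1 * t + 1).
Proof.
have [t0|t0] := ltP 0 t; first by rewrite ltr_pwDl ?posX_gt0// posX_ge0.
by rewrite ltr_wpDl ?posX_ge0// posX_gt0//; lra.
Qed.

Lemma Cp_step p : Cp p (step p).
Proof.
apply: CpM; first exact: Cp_posX.
apply: Cp_inv; first by move=> t; rewrite gt_eqF// step_den.
by apply: CpD; [exact: Cp_posX|apply: Cp_affine; exact: Cp_posX].
Qed.

Lemma step_itv p t : 0 <= step p t <= 1.
Proof.
rewrite /step mulr_ge0 ?posX_ge0 ?invr_ge0 ?(ltW (step_den _ _))//=.
by rewrite ler_pdivrMr ?step_den// mul1r lerDl posX_ge0.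
Qed.

Lemma step1 p t : 1 <= t -> step p t = 1.
Proof.
move=> t1; have d := step_den p t; rewrite /step.
have e : posX p.+1 (-1 * t + 1) = 0 by rewrite /posX max_l ?expr0n//; lra.
by rewrite e addr0 divff//; rewrite e addr0 in d; rewrite gt_eqF.
Qed.

Lemma step0 p t : t <= 0 -> step p t = 0.
Proof. by move=> t0; rewrite /step /posX max_l// expr0n mul0r. Qed.

Definition bump (p : nat) (t : R) := step p (-1 * t + 2) * step p (1 * t + 2).

Lemma bump_itv p t : 0 <= bump p t <= 1.
Proof.
have /andP[a0 a1] := step_itv p (-1 * t + 2); have /andP[b0 b1] := step_itv p (1 * t + 2).
by rewrite /bump mulr_ge0//= mulr_ile1.
Qed.

Lemma bump1 p t : `|t| <= 1 -> bump p t = 1.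
Proof. by rewrite ler_norml => /andP[a b]; rewrite /bump !step1 ?mulr1//; lra. Qed.

Lemma bump0 p t : 2 <= `|t| -> bump p t = 0.
Proof.
rewrite ler_normr => /orP[t2|t2]; rewrite /bump; last by rewrite [X in _ * X]step0 ?mulr0//; lra.
by rewrite step0 ?mul0r//; lra.
Qed.

Lemma bdd_of_support (F : R -> R) : continuous F -> (forall t, 2 < `|t| -> F t = 0) ->
  exists2 A, 0 <= A & forall t, `|F t| <= A.
Proof.
move=> cF F0.
have cN : continuous (fun t : R => `|F t| : R) by move=> t; apply: cvg_norm; exact: cF.
have le22 : -2 <= 2 :> R by lra.
have [c _ cM] := EVT_max le22 (continuous_subspaceT cN).
exists `|F c|; first exact: normr_ge0.
move=> t; have [t2|t2] := ltP 2 `|t|; first by rewrite F0// normr0.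
by apply: cM; rewrite in_itv /= -ler_norml.
Qed.

(** Vanishing is required on the open set [2 < |t|], so it passes to each derivative, which is then
    bounded by its maximum over [[-2, 2]]. *)
Lemma Cp_bdd p (F : R -> R) : Cp p F -> (forall t, 2 < `|t| -> F t = 0) ->
  exists2 A, 1 <= A & jet Der1 bdd1 p 1 A F.
Proof.
have mono : forall (f : R -> R) A B, A <= B -> bdd1 f A -> bdd1 f B.
  by move=> f A B AB [cf fA]; split=> // t; exact: le_trans AB.
elim: p F => [|p IH] F cF F0.
  have [A A0 FA] := bdd_of_support (Cp_cts cF) F0.
  exists (1 + A); first by rewrite lerDl.
  by split=> //; split=> [|t]; [exact: Cp_cts cF|rewrite (le_trans (FA t))// lerDr].
have [F' [dF cF']] := CpSP cF.
have [|A' A1' jF'] := IH F' cF'.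
  move=> t t2; rewrite -(@derive_val _ _ _ _ _ _ _ (dF t)).
  rewrite (@near_eq_derive _ _ _ _ (cst 0)) ?derive_cst//.
  near=> x; apply: F0; near: x.
  have cn : {for t, continuous (fun x : R => `|x|)} by apply: norm_continuous.
  by apply: (cn [set y | 2 < y]); exact: lt_nbhsr.
have [A A0 FA] := bdd_of_support (Cp_cts cF) F0.
exists (A' + A); first by rewrite (le_trans A1')// lerDl.
split; first by split=> [|t]; [exact: Cp_cts cF|rewrite (le_trans (FA t))// lerDr (le_trans _ A1')].
exists F'; split=> //; apply: (jet_mono ltr01 mono _ jF').
by rewrite divr1 lerDl.
Unshelve. all: by end_near. Qed.

Lemma bump_jet p : exists2 A, 1 <= A & jet Der1 bdd1 p 1 A (bump p).
Proof.
apply: Cp_bdd; last by move=> t t2; rewrite bump0// ltW.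
by apply: CpM; apply: Cp_affine; exact: Cp_step.
Qed.

End line_cutoff.

Section tonelli.
Variables (R : realType) (n : nat).
Local Notation V := 'rV[R]_n.

(** Counterpart of [fubini2] for nonnegative integrands without a product majorant, such as
    [|G w| ^ r * Kr z w]: finiteness comes from a majorant [u] of the inner integrals in one
    order. *)
Lemma tonelli2 (h : V -> V -> R) (u : V -> R) : mfn2 h -> (forall x y, 0 <= h x y) ->
  (forall x, L1 (h x)) -> (forall y, L1 (h^~ y)) ->
  L1 u -> (forall y, Int (h^~ y) <= u y) ->
  [/\ L1 (fun x => Int (h x)), L1 (fun y => Int (h^~ y)) &
   Int (fun x => Int (h x)) = Int (fun y => Int (h^~ y))].
Proof.
move=> mh h0 lx ly lu hu.
pose M := model R n; pose pt := @mv R n M.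
pose H := fun p : mT M * mT M => (h (pt p.1) (pt p.2))%:E.
have mH : measurable_fun setT H by exact/measurable_EFinP.
have FE (x : mT M) : fubini_F (mmu M) H x = (Int (h (pt x)))%:E.
  by rewrite /fubini_F /Int /Rintegral fineK//; exact: (integrable_fin_num measurableT (lx (pt x))).
have GE (y : mT M) : fubini_G (mmu M) H y = (Int (h^~ (pt y)))%:E.
  by rewrite /fubini_G /Int /Rintegral fineK//; exact: (integrable_fin_num measurableT (ly (pt y))).
have iH : (mmu M \x mmu M)%E.-integrable setT H.
  apply/(integrable21ltyP _ _ mH).
  have /integrableP[_] := lu; apply: le_lt_trans.
  apply: ge0_le_integral => //.
  - by move=> y _; exact: integral_ge0.
  - apply: (@measurable_fun_fubini_tonelli_G _ _ _ _ _ (mmu M) (fun p => `|H p|%E)) => //.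
    exact: measurableT_comp.
  - by apply: measurableT_comp => //; apply/measurable_EFinP; exact: L1_mfn.
  - move=> y _; under eq_integral do rewrite gee0_abs ?lee_fin//.
    have := GE y; rewrite /fubini_G => ->; rewrite lee_fin.
    by rewrite (le_trans (hu _))// ler_norm.
have iF := integrable_fubini_F iH; have mG := measurable_fubini_G iH.
split.
- by move: iF; apply: eq_integrable => // x _; rewrite FE.
- apply: (L1_dom _ lu).
    by apply/measurable_EFinP; move: mG; apply: eq_measurable_fun => y _; rewrite GE.
  by move=> y; rewrite ger0_norm//; exact: Int_ge0.
rewrite {1}/Int [RHS]/Int /Rintegral; congr fine.
under eq_integral do rewrite -FE; under [RHS]eq_integral do rewrite -GE.
exact: Fubini.
Qed.

Lemma indic_cubeE (a : V) l x :
  \1_(cube a l) x = \prod_(i < n) \1_(`[a ord0 i, a ord0 i + l]%classic) (x ord0 i) :> R.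
Proof.
rewrite indicE; have [ax|ax] := boolP (x \in cube a l).
  rewrite big1// => i _; rewrite indicE mem_set//= in_itv/=.
  by move: ax; rewrite inE => /(_ i).
have : ~ cube a l x by move=> H; move/negP: ax; apply; rewrite inE.
move=> /existsNP[i ni]; rewrite (bigD1 i)//= indicE memNset ?mul0r//.
Qed.

Lemma L1_cube (a : V) l : 0 <= l -> L1 (\1_(cube a l) : V -> R) /\ Int (\1_(cube a l) : V -> R) = l ^+ n.
Proof.
move=> l0; pose k (i : 'I_n) : R -> R := \1_(`[a ord0 i, a ord0 i + l]%classic).
have mk i : measurable_fun setT (k i).
  by apply: measurable_indic; exact: measurable_itv.
have E : (\1_(cube a l) : V -> R) = (fun x => \prod_(i < n) k i (x ord0 i)).
  by apply/funext => x; rewrite indic_cubeE.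
have mP : mfn (fun x : V => \prod_(i < n) k i (x ord0 i)).
  rewrite /mfn; apply: measurable_prod => i _.
  exact: (measurableT_comp (mk i) (mfn_cont (@coord_continuous R 1 n ord0 i))).
have k0 i t : 0 <= k i t by rewrite /k indicE.
have := @eint_prod R n k (fun=> l) k0 mk; rewrite prodr_const card_ord => H.
have {}H : eint (fun x : V => (\prod_(i < n) k i (x ord0 i))%:E) = (l ^+ n)%:E.
  apply: H => i; rewrite /k integral_indic//= setIT.
  rewrite lebesgue_measure_itv /= lte_fin ltrDl.
  case: ltP => [_|l1]; first by rewrite -EFinB addrAC subrr add0r.
  by congr EFin; apply/eqP; rewrite eq_le l0 l1.
have P0 (x : V) : 0 <= \prod_(i < n) k i (x ord0 i) by apply: prodr_ge0.
have [|L _] := eint_L1 (C := l ^+ n) mP P0; first by rewrite H.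
by rewrite E; split=> //; apply: EFin_inj; rewrite -H -L1_eint.
Qed.

End tonelli.

(** * Derivative bounds and box cutoffs in several variables *)

Section vector_jets.
Variables (R : realType) (n : nat).
Local Notation V := 'rV[R]_n.

(** The profile [S] is either [1] or the indicator of a set; in the second case the bound also
    records the support, hence integrability over a box. *)
Definition bddS (S : V -> R) (F : V -> R) (A : R) :=
  [/\ continuous F, 0 <= A & forall x, `|F x| <= A * S x].

Definition sjet S i p h A F := jet (Der i) (bddS S) p h A F.
Local Notation xjet := (sjet (fun=> 1)).

Lemma bddS_mono S F A B : (forall x, 0 <= S x) -> A <= B -> bddS S F A -> bddS S F B.
Proof.
move=> S0 AB [cF A0 FA]; split=> //; first exact: le_trans AB.
by move=> x; rewrite (le_trans (FA x))// ler_wpM2r.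
Qed.

Lemma bddSD S F G A B : bddS S F A -> bddS S G B -> bddS S (fun x => F x + G x) (A + B).
Proof.
move=> [cF A0 FA] [cG B0 GB]; split; [exact: ctsD|exact: addr_ge0|move=> x].
by rewrite (le_trans (ler_normD _ _))// mulrDl lerD.
Qed.

Lemma bddSM S F G A B : bddS S F A -> bddS (fun=> 1) G B -> bddS S (fun x => F x * G x) (A * B).
Proof.
move=> [cF A0 FA] [cG B0 GB]; split; [exact: ctsM|exact: mulr_ge0|move=> x].
by rewrite normrM mulrAC ler_pM// (le_trans (GB x))// mulr1.
Qed.

Lemma sjet_ge0 S i p h A F : sjet S i p h A F -> 0 <= A.
Proof. by move=> /jet_bd[]. Qed.

Lemma sjet_cts S i p h A F : sjet S i p h A F -> continuous F.
Proof. by move=> /jet_bd[]. Qed.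

Lemma sjet_le S i p h A F : sjet S i p h A F -> forall x, `|F x| <= A * S x.
Proof. by move=> /jet_bd[]. Qed.

Lemma sjet_mono S i p h A B F : (forall x, 0 <= S x) -> 0 < h -> A <= B -> sjet S i p h A F -> sjet S i p h B F.
Proof. by move=> S0 h0; apply: jet_mono => // f a b; exact: bddS_mono. Qed.

Lemma sjetM S i p h A B F G : (forall x, 0 <= S x) -> 0 < h -> sjet S i p h A F -> xjet i p h B G ->
  sjet S i p h (2 ^+ p * (A * B)) (fun x => F x * G x).
Proof.
move=> S0 h0; apply: jetM => //.
- by move=> f a b; exact: bddS_mono.
- by move=> f g a b; exact: bddSD.
- move=> f g a b bf bg; split; last exact: bddSM.
  by case: bf bg => _ a0 _ [_ b0 _]; exact: mulr_ge0.
- by move=> f f' g g'; exact: DerD.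
- by move=> f f' g g'; exact: DerM.
Qed.

Lemma DerZ (i : 'I_n) (F F' : V -> R) c : Der i F F' -> Der i (fun x => F x * c) (fun x => F' x * c).
Proof.
move=> dF; have := DerM dF (Der_cst i c).
by under [X in Der _ _ X -> _]eq_fun do rewrite mulr0 addr0.
Qed.

Lemma sjetZ S i p h A c F : sjet S i p h A F -> sjet S i p h (A * `|c|) (fun x => F x * c).
Proof.
apply: jetZ; last by move=> f f'; exact: DerZ.
move=> f a [cf a0 fa]; split; [|exact: mulr_ge0|].
  by apply: ctsM => //; exact: cts_cst.
by move=> x; rewrite normrM mulrAC ler_wpM2r.
Qed.

Lemma sjet0 S i p h A : (forall x, 0 <= S x) -> 0 < h -> 0 <= A -> sjet S i p h A (fun=> 0).
Proof.
move=> S0 h0 A0; apply: jet0 => //; last exact: Der_cst.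
move=> B B0; split=> //; first exact: cts_cst.
by move=> x; rewrite normr0 mulr_ge0.
Qed.

Lemma xjet_cst i p h c : 0 < h -> xjet i p h `|c| (fun=> c).
Proof.
move=> h0; have bc : bddS (fun=> 1) (fun=> c) `|c|.
  by split=> //; [exact: cts_cst|move=> x; rewrite mulr1].
case: p => [|p]; first by split.
split=> //; exists (fun=> 0); split; first exact: Der_cst.
by apply: sjet0 => //; rewrite divr_ge0// ltW.
Qed.

Lemma xjet_axis i k p L c A (f : R -> R) : 0 < L -> 0 <= A -> jet (@Der1 R) (@bdd1 R) p 1 A f ->
  xjet i p L A (fun x => f ((x ord0 k - c) / L)).
Proof.
move=> L0; elim: p A f => [|p IH] A f A0 jf.
all: have [cf fA] := jet_bd jf.
all: have bf : bddS (fun=> 1) (fun x : V => f ((x ord0 k - c) / L)) A.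
1,3: split=> //; last by move=> x; rewrite mulr1.
1,2: apply: (cts_comp (f := fun x : V => (x ord0 k - c) / L)) => //.
1,2: apply: ctsM; last exact: cts_cst.
1,2: by apply: ctsB; [exact: coord_cont|exact: cts_cst].
  by split.
have [_ [f' [df jf']]] := jf; split=> //.
rewrite divr1 in jf'.
have [ik|ik] := eqVneq k i.
  exists (fun x => f' ((x ord0 k - c) / L) * L^-1); split; last first.
    rewrite -[A / L](_ : A * `|L^-1| = _); last by rewrite gtr0_norm ?invr_gt0.
    by apply: sjetZ; exact: IH.
  move=> x; apply: is_derive_line.
  have d1 : is_derive (0 : R) (1 : R) (fun s : R => L^-1 * s + (x ord0 k - c) / L) L^-1.
    by apply: is_derive_eq; rewrite /GRing.scale /=; ring.
  have := is_derive1_comp (df _) d1; rewrite mulr0 add0r.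
  congr is_derive; apply/funext => s /=; rewrite evec_lineE ik eqxx mulr1; congr f; ring.
exists (fun=> 0); split; last by apply: sjet0 => //; rewrite divr_ge0// ltW.
move=> x; apply: is_derive_line.
under eq_fun do rewrite evec_lineE (negbTE ik) mulr0 add0r.
exact: is_derive_cst.
Qed.

Definition box (c : V) (L : R) : set V := [set x | forall i, `|x ord0 i - c ord0 i| <= L].

Definition boxbump p (c : V) (L : R) (x : V) : R := \prod_(k < n) bump p ((x ord0 k - c ord0 k) / L).

(** One Leibniz rule per coordinate, each costing [2 ^ p], hence the [n]-th power. *)
Lemma boxbump_jet p : exists2 A, 0 <= A & forall i c L, 0 < L -> xjet i p L A (boxbump p c L).
Proof.
have [A A1 jA] := bump_jet R p.
have A0 : 0 <= A by exact: le_trans A1.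
exists ((2 ^+ p * A) ^+ n); first by rewrite exprn_ge0// mulr_ge0// exprn_ge0.
move=> i c L L0; rewrite /boxbump.
have : forall s : seq 'I_n, xjet i p L ((2 ^+ p * A) ^+ size s)
    (fun x => \prod_(k <- s) bump p ((x ord0 k - c ord0 k) / L)).
  elim=> [|k s IH].
    under [X in sjet _ _ _ _ _ X]eq_fun do rewrite big_nil.
    by have := xjet_cst i p 1 L0; rewrite normr1.
  under [X in sjet _ _ _ _ _ X]eq_fun do rewrite big_cons.
  rewrite /= exprS -mulrA; apply: sjetM => //; first by apply: xjet_axis.
by move=> /(_ (index_enum 'I_n)); rewrite -[index_enum _]enumT size_enum_ord.
Qed.

Lemma boxbump_itv p c L x : 0 <= boxbump p c L x <= 1.
Proof.
apply/andP; split.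
  by apply: prodr_ge0 => i _; case/andP: (bump_itv p ((x ord0 i - c ord0 i) / L)).
by apply: prodr_ile1 => i _; exact: bump_itv.
Qed.

Lemma boxbump1 p c L x : 0 < L -> box c L x -> boxbump p c L x = 1.
Proof.
move=> L0 bx; rewrite /boxbump big1// => i _; rewrite bump1//.
by rewrite normrM normfV (gtr0_norm L0) ler_pdivrMr// mul1r.
Qed.

Lemma boxbump0 p c L x : 0 < L -> ~ box c (2 * L) x -> boxbump p c L x = 0.
Proof.
move=> L0 /existsNP[i /negP]; rewrite -ltNge => xi.
rewrite /boxbump (bigD1 i)//= bump0 ?mul0r//.
by rewrite normrM normfV (gtr0_norm L0) ler_pdivlMr// ltW.
Qed.

Lemma box_cube c L : box c L = cube (\row_i (c ord0 i - L)) (2 * L).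
Proof.
apply/seteqP; split=> x bx i; have := bx i; rewrite !mxE ler_norml.
  by move=> /andP[a b]; apply/andP; split; lra.
by move=> /andP[a b]; apply/andP; split; lra.
Qed.

Lemma L1_box (c : V) L : 0 <= L -> L1 (\1_(box c L) : V -> R) /\ Int (\1_(box c L) : V -> R) = (2 * L) ^+ n.
Proof. by move=> L0; rewrite box_cube; apply: L1_cube; rewrite mulr_ge0. Qed.

Lemma near_notbox (c : V) L x : ~ box c L x -> \forall y \near nbhs x, ~ box c L y.
Proof.
move=> /existsNP[i /negP]; rewrite -ltNge => xi.
have cn : continuous (fun y : V => `|y ord0 i - c ord0 i|).
  have c1 : continuous (fun y : V => y ord0 i - c ord0 i).
    by apply: ctsB; [exact: coord_cont|exact: cts_cst].
  by apply: (cts_comp c1 (g := fun x : R => `|x|)); exact: norm_continuous.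
have : nbhs x [set y : V | L < `|y ord0 i - c ord0 i|].
  by apply: (cn x [set y | L < y]); exact: lt_nbhsr.
by apply: filterS => y Ly /(_ i); rewrite leNgt; move: Ly => /= ->.
Qed.

Lemma Der_supp (K : set V) i F F' : (forall x, ~ K x -> \forall y \near nbhs x, ~ K y) ->
  Der i F F' -> (forall x, ~ K x -> F x = 0) -> forall x, ~ K x -> F' x = 0.
Proof.
move=> oK dF F0 x Kx; rewrite -(@derive_val _ _ _ _ _ _ _ (dF x)).
rewrite (@near_eq_derive _ _ _ _ (cst 0)) ?derive_cst//.
by apply: filterS (oK x Kx) => y; exact: F0.
Qed.

(** The complement of [K] is open, so the derivatives vanish there as well and the uniform bound may
    be multiplied by the indicator of [K]. *)
Lemma sjet_supp (K : set V) i p h A F : (forall x, ~ K x -> \forall y \near nbhs x, ~ K y) ->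
  0 < h -> xjet i p h A F -> (forall x, ~ K x -> F x = 0) -> sjet \1_K i p h A F.
Proof.
move=> oK h0 jF F0.
have := jet_with (Z := fun f : V -> R => forall x, ~ K x -> f x = 0) (fun f f' => @Der_supp K i f f' oK) F0 jF.
have mono f a b : a <= b -> bddS (fun=> 1) f a /\ (forall x, ~ K x -> f x = 0) -> bddS \1_K f b.
  move=> ab [[cf a0 fa] f0]; have b0 := le_trans a0 ab; split=> // x.
  have [Kx|Kx] := pselect (K x).
    by rewrite indicE mem_set//= (le_trans (fa x))// ler_wpM2r.
  by rewrite f0// normr0 mulr_ge0// indicE.
exact: (jet_mono h0 mono).
Qed.

Lemma nderiv_sjet S i p h A F C : 0 < h -> (forall x, S x <= C * Pk 1 x) ->
  sjet S i p h A F ->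
  exists G, [/\ nderiv i p F G, continuous G & forall x, `|G x| <= A / h ^+ p * S x].
Proof.
move=> h0 SC; have nS A' f : bddS S f A' -> nice f.
  move=> [cf A0 fA]; split=> //; exists (A' * C) => x.
  by rewrite (le_trans (fA x))// -mulrA ler_wpM2l.
elim: p A F => [|p IH] A F /=.
  move=> [bF _]; exists F; split=> //; last by move=> x; rewrite expr0 divr1; case: bF.
    by split=> //; exact: nS bF.
  by case: bF.
move=> [bF [F' [dF jF']]]; have [G [nG cG GA]] := IH _ _ jF'.
exists G; split=> //.
  by split; [exact: nS bF|exists F'].
by move=> x; rewrite exprS invfM mulrA; exact: GA.
Qed.

Lemma indic_box_Pk c L : exists C, forall x : V, \1_(box c L) x <= C * Pk 1 x :> R.
Proof.
exists (\prod_(i < n) (1 + (`|c ord0 i| + `|L|) ^+ 2)) => x.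
have C0 : 0 <= \prod_(i < n) (1 + (`|c ord0 i| + `|L|) ^+ 2) :> R.
  by apply: prodr_ge0 => i _; rewrite addr_ge0// sqr_ge0.
rewrite indicE; have [bx|bx] := boolP (x \in box c L); last by rewrite mulr_ge0// Pk_ge0.
rewrite /Pk prodfV ler_pdivlMr ?mul1r; last by apply: prodr_gt0 => i _; rewrite ltr_pwDl// sqr_ge0.
apply: ler_prod => i _; rewrite addr_ge0 ?sqr_ge0//= lerD2l mul1r.
rewrite -(real_normK (num_real (x ord0 i))) lerXn2r ?nnegrE ?addr_ge0//.
have -> : x ord0 i = c ord0 i + (x ord0 i - c ord0 i) by ring.
rewrite (le_trans (ler_normD _ _))// lerD2l.
by move: bx; rewrite inE => /(_ i) bi; rewrite (le_trans bi)// ler_norm.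
Qed.

End vector_jets.
Local Notation xjet := (sjet (fun=> 1)).

(** * The T T* argument *)

Section young.
Variable R : realType.

(** Young's inequality with the conjugate exponents [1 / t] and [1 / (1 - t)], the case [t = 0]
    being separate. *)
Lemma amgm2 (t x y : R) : 0 <= t < 1 -> 0 <= x -> 0 <= y ->
  x `^ t * y `^ (1 - t) <= t * x + (1 - t) * y.
Proof.
move=> /andP[t0 t1] x0 y0; move: t0; rewrite le_eqVlt => /orP[/eqP <-|t0].
  by rewrite powRr0 subr0 powRr1// mul0r add0r.
have t1' : 0 < 1 - t by rewrite subr_gt0.
have := @conjugate_powR R (x `^ t) (y `^ (1 - t)) t^-1 (1 - t)^-1 (powR_ge0 _ _) (powR_ge0 _ _).
rewrite !invr_gt0 !invrK => /(_ t0 t1'); rewrite addrC subrK => /(_ erefl).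
by rewrite -!powRrM !mulfV ?gt_eqF// !powRr1// [t * _]mulrC [(1 - t) * _]mulrC.
Qed.

(** A pointwise form of interpolation between L^1 to L^infinity and L^2 to L^2. With
    [t = 2 / r - 1], [u = a ^ r / D] and [v = b ^ r / D], one has [1 / r = t + (1 - t) / 2], so
    [(u v) ^ (1 / r)] is [N ^ t (u v / N) ^ t (u v) ^ ((1 - t) / 2)]; weighted and plain AM-GM do
    the rest. The term in [a ^ r b ^ r] will be integrated against the supremum of a kernel, the
    term in [a ^ r + b ^ r] against its mass. *)
Lemma young3 (r D N a b : R) : 1 < r <= 2 -> 0 < D -> 0 < N -> 0 <= a -> 0 <= b ->
  a * b <= D `^ (2 / r) * N `^ (2 / r - 1) *
    ((2 / r - 1) / (D ^+ 2 * N) * (a `^ r * b `^ r) + (1 - r^-1) / D * (a `^ r + b `^ r)).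
Proof.
move=> /andP[r1 r2] D0 N0 a0 b0.
have r0 : 0 < r by lra.
have ri1 : r^-1 < 1 by rewrite invf_lt1.
have ri2 : 2^-1 <= r^-1 by rewrite lef_pV2 ?posrE//; lra.
set t := 2 / r - 1.
have t01 : 0 <= t < 1 by rewrite /t; apply/andP; split; lra.
pose u := a `^ r / D; pose v := b `^ r / D.
have u0 : 0 <= u by rewrite divr_ge0 ?powR_ge0// ltW.
have v0 : 0 <= v by rewrite divr_ge0 ?powR_ge0// ltW.
have root x : 0 <= x -> x = D `^ r^-1 * (x `^ r / D) `^ r^-1.
  move=> x0; rewrite -powRM ?divr_ge0 ?powR_ge0 ?ltW//.
  by rewrite mulrCA divff ?gt_eqF// mulr1 -powRrM mulfV ?gt_eqF// powRr1.
have -> : (t / (D ^+ 2 * N) * (a `^ r * b `^ r) + (1 - r^-1) / D * (a `^ r + b `^ r)) =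
    t * (u * v / N) + (1 - t) * ((u + v) / 2).
  by rewrite /u /v /t; field; rewrite !gt_eqF.
rewrite [leLHS](_ : _ = D `^ (2 / r) * (u * v) `^ r^-1); last first.
  rewrite {1}(root a a0) {1}(root b b0) -/u -/v mulrACA -powRD; last first.
    by apply/implyP => _; rewrite gt_eqF.
  by rewrite powRM// (_ : r^-1 + r^-1 = 2 / r)//; lra.
rewrite -mulrA ler_wpM2l ?powR_ge0//.
have [uv0|uv0] := eqVneq (u * v) 0.
  rewrite uv0 powR0 ?gt_eqF ?invr_gt0// mul0r mulr0 add0r mulr_ge0 ?powR_ge0// mulr_ge0//.
    by lra.
  by rewrite divr_ge0// addr_ge0.
have uvp : 0 <= u * v by rewrite mulr_ge0.
rewrite (_ : r^-1 = t + 2^-1 * (1 - t)); last by rewrite /t; lra.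
rewrite powRD; last by rewrite uv0 implybT.
have uvE : u * v = N * (u * v / N) by field; rewrite gt_eqF.
rewrite powRrM {1}uvE powRM ?divr_ge0// ?(ltW N0)// -mulrA ler_wpM2l ?powR_ge0//.
have S0 : 0 <= (u * v) `^ 2^-1 := powR_ge0 _ _.
apply: (le_trans (amgm2 t01 _ S0)); first by rewrite divr_ge0// ltW.
rewrite lerD2l ler_wpM2l//; first by lra.
have h2 : 0 <= (2^-1 : R) < 1 by apply/andP; split; lra.
have := amgm2 h2 u0 v0; rewrite (_ : 1 - 2^-1 = 2^-1 :> R); last by lra.
by rewrite -powRM// => /le_trans; apply; lra.
Qed.

End young.

Section ttstar.
Variables (R : realType) (n : nat).
Local Notation V := 'rV[R]_n.

(* Integrated form of [young3]: the quadratic form of [Kr] at [|G|] is bounded by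
   the [L^r] norm of [G], interpolating between [Kr <= N] and [Int Kr <= S]. *)
Lemma trilinear_majorant (r N S D : R) (G : V -> R) (Kr : V -> V -> R) :
  1 < r <= 2 -> 0 < N -> 0 < S -> 0 < D ->
  L1 G -> L1 (fun z => `|G z| `^ r) -> Int (fun z => `|G z| `^ r) <= D ->
  mfn2 Kr -> (forall z w, 0 <= Kr z w) -> (forall z w, Kr z w = Kr w z) ->
  (forall z w, Kr z w <= N) -> (forall z, L1 (Kr z)) -> (forall z, Int (Kr z) <= S) ->
  exists H, [/\ L1 H, forall z, `|G z| * Int (fun w => `|G w| * Kr z w) <= H z &
    Int H <= D `^ (2 / r) * (N / S) `^ (2 / r - 1) * S].
Proof.
move=> r12 N0 S_0 D0 lG lGr GD mKr K0 Ksym KN lKr KS.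
(* With the parameter [N / S] in [young3] the two terms contribute at most [t * S] and
   [(1 - t) * S], which add up to [S]. *)
set t := 2 / r - 1; pose N' := N / S.
have N'0 : 0 < N' by rewrite divr_gt0.
have r0 : 0 < r by case/andP: r12 => *; lra.
have t0 : 0 <= t.
  have /andP[r1 r2] := r12; have : 2^-1 <= r^-1 by rewrite lef_pV2 ?posrE//.
  rewrite /t; lra.
have p0 : 0 <= 1 - r^-1 by have /andP[r1 r2] := r12; rewrite subr_ge0 invf_le1// ltW.
pose c0 := D `^ (2 / r) * N' `^ t.
have c00 : 0 <= c0 by rewrite mulr_ge0// powR_ge0.
pose c1 := t / (D ^+ 2 * N'); pose c2 := (1 - r^-1) / D.
have c10 : 0 <= c1 by rewrite divr_ge0// mulr_ge0 ?sqr_ge0// ltW.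
have c20 : 0 <= c2 by rewrite divr_ge0// ltW.
pose q z := `|G z| `^ r.
have q0 z : 0 <= q z := powR_ge0 _ _.
have lqK z : L1 (fun w => q w * Kr z w).
  apply: (L1_dom _ (L1Z N lGr)).
    by apply: measurable_funM; [exact: L1_mfn|exact: mfn2_r].
  by move=> w; rewrite ger0_norm ?mulr_ge0// mulrC ler_wpM2r.
have mqK : mfn2 (fun z w => q w * Kr z w) by apply: mfn2M => //; exact: (mfn2_snd (L1_mfn lGr)).
have lKr' w : L1 (Kr^~ w) by rewrite (_ : Kr^~ w = Kr w)//; apply/funext => z; exact: Ksym.
have IKr' w : Int (Kr^~ w) <= S by rewrite (_ : Kr^~ w = Kr w)//; apply/funext => z; exact: Ksym.
have [lW WD] : L1 (fun z => Int (fun w => q w * Kr z w)) /\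
    Int (fun z => Int (fun w => q w * Kr z w)) <= S * D.
  have lS : L1 (fun w => S * q w) by exact: L1Z.
  have bS w : Int (fun z => q w * Kr z w) <= S * q w.
    by rewrite (IntZ _ (lKr' w)) mulrC (ler_wpM2r (q0 w)).
  have [l1 l2 ->] := tonelli2 mqK (fun z w => mulr_ge0 (q0 w) (K0 z w)) lqK
    (fun w => L1Z (q w) (lKr' w)) lS bS.
  split; first exact: l1.
  apply: (le_trans (Int_le l2 lS bS)).
  by rewrite (IntZ _ lGr) (ler_wpM2l (ltW S_0)).
pose H z := c0 * ((c1 * (N * D) + c2 * S) * q z + c2 * Int (fun w => q w * Kr z w)).
have lH : L1 H by apply: L1Z; apply: L1D; exact: L1Z.
have lGK z : L1 (fun w => `|G w| * Kr z w).
  apply: (L1_dom _ (L1Z N (L1_abs lG))).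
    by apply: measurable_funM; [exact: (L1_mfn (L1_abs lG))|exact: mfn2_r].
  by move=> w; rewrite ger0_norm ?mulr_ge0// mulrC ler_wpM2r.
have bH z : `|G z| * Int (fun w => `|G w| * Kr z w) <= H z.
  rewrite -(IntZ _ (lGK z)).
  apply: (@le_trans _ _ (Int (fun w => c0 * (c1 * q z * (q w * Kr z w) + (c2 * q z * Kr z w + c2 * (q w * Kr z w)))))).
    apply: Int_le; first exact: L1Z.
      by apply: L1Z; apply: L1D; [exact: L1Z|apply: L1D; exact: L1Z].
    move=> w; rewrite mulrA.
    have := young3 r12 D0 N'0 (normr_ge0 (G z)) (normr_ge0 (G w)).
    rewrite -/t -/c0 -/c1 -/c2 -/(q z) -/(q w) => /(ler_wpM2r (K0 z w)) => /le_trans; apply.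
    by rewrite le_eqVlt; apply/orP; left; apply/eqP; ring.
  rewrite IntZ; last by apply: L1D; [exact: L1Z|apply: L1D; exact: L1Z].
  rewrite /H ler_wpM2l//.
  rewrite IntD; [|exact: L1Z|by apply: L1D; exact: L1Z].
  rewrite IntD; [|exact: L1Z|exact: L1Z].
  rewrite !IntZ// addrA lerD2r mulrDl.
  apply: lerD; last by rewrite mulrAC ler_wpM2r// ler_wpM2l.
  rewrite mulrAC ler_wpM2r// ler_wpM2l//.
  apply: (@le_trans _ _ (Int (fun w => N * q w))).
    by apply: Int_le => //; [exact: L1Z|move=> w; rewrite mulrC ler_wpM2r].
  by rewrite IntZ// ler_wpM2l// ltW.
exists H; split; [exact: lH|exact: bH|].
rewrite IntZ; last by apply: L1D; exact: L1Z.
apply: (ler_wpM2l c00).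
rewrite IntD; [|exact: L1Z|exact: L1Z].
rewrite !IntZ//.
apply: (@le_trans _ _ ((c1 * (N * D) + c2 * S) * D + c2 * (S * D))).
  apply: lerD; last by rewrite ler_wpM2l.
  by rewrite ler_wpM2l// addr_ge0// mulr_ge0// ?mulr_ge0// ltW.
rewrite le_eqVlt; apply/orP; left; apply/eqP; rewrite /c1 /c2 /N' /t; field.
by rewrite !gt_eqF.
Qed.

(** Expanding the square and exchanging integrals twice turns the L^2 norm into the quadratic form
    of [B] at [G], where [B] is the kernel of the operator preceded by its adjoint;
    [trilinear_majorant] bounds this form. The crude bound [A * S0 x] licenses the exchanges, while
    the final constant is that of [Kr]. *)
Lemma ttstar (r A N S D : R) (k B : V -> V -> R) (S0 G : V -> R) (Kr : V -> V -> R) :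
  1 < r <= 2 -> 0 < N -> 0 < S -> 0 < D -> 0 <= A ->
  mfn2 k -> L1 S0 -> (forall x, 0 <= S0 x <= 1) -> (forall x z, `|k x z| <= A * S0 x) ->
  L1 G -> L1 (fun z => `|G z| `^ r) -> Int (fun z => `|G z| `^ r) <= D ->
  (forall z w, Int (fun x => k x z * k x w) = B z w) ->
  mfn2 Kr -> (forall z w, `|B z w| <= Kr z w) -> (forall z w, Kr z w = Kr w z) ->
  (forall z w, Kr z w <= N) -> (forall z, L1 (Kr z)) -> (forall z, Int (Kr z) <= S) ->
  L1 (fun x => Int (fun z => k x z * G z)) /\
  Int (fun x => Int (fun z => k x z * G z) ^+ 2) <= D `^ (2 / r) * (N / S) `^ (2 / r - 1) * S.
Proof.
move=> r12 N0 S_0 D0 A0 mk lS S01 kA lG lGr GD BE mKr BKr Ksym KN lKr KS.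
have mG := L1_mfn lG.
have lAS : L1 (fun x => A * S0 x) by exact: L1Z.
pose U x := Int (fun z => k x z * G z).
have kG x z : `|k x z * G z| <= A * S0 x * `|G z| by rewrite normrM ler_wpM2r.
have [lU _ _] := fubini2 (mfn2M mk (mfn2_snd mG)) lAS (L1_abs lG) kG.
split; first exact: lU.
have mkx x : mfn (fun z => k x z * G z) by exact: (@mfn2_r _ _ (fun x z => k x z * G z) x (mfn2M mk (mfn2_snd mG))).
have lkx x : L1 (fun z => k x z * G z).
  by apply: (L1_dom (mkx x) (L1Z (A * S0 x) (L1_abs lG))) => z; exact: kG.
set g := Int (fun z => `|G z|).
have g0 : 0 <= g by apply: Int_ge0.
have Ub x : `|U x| <= A * S0 x * g.
  by rewrite /g -IntZ ?L1_abs//; apply: (Int_abs_le (mkx x)); [apply: L1Z; exact: L1_abs|move=> z; exact: kG].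
have SS x : S0 x * S0 x <= S0 x by have /andP[a b] := S01 x; rewrite ler_piMr.
have [E1 lE1] : Int (fun x => U x ^+ 2) = Int (fun z => G z * Int (fun x => U x * k x z)) /\
    L1 (fun z => G z * Int (fun x => U x * k x z)).
  have -> : Int (fun x => U x ^+ 2) = Int (fun x => Int (fun z => U x * (k x z * G z))).
    by congr Int; apply/funext => x; rewrite IntZ// expr2.
  have mU2 : mfn2 (fun x z => U x * (k x z * G z)).
    by apply: mfn2M; [exact: (mfn2_fst (L1_mfn lU))|exact: (mfn2M mk (mfn2_snd mG))].
  have [|_ + ->] := fubini2 mU2 (L1Z (A * A * g) lS) (L1_abs lG).
    move=> x z; rewrite normrM; apply: (le_trans (ler_pM _ _ (Ub x) (kG x z))) => //.
    rewrite [leLHS](_ : _ = (A * A * g * `|G z|) * (S0 x * S0 x)); last by ring.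
    by rewrite [leRHS](_ : _ = (A * A * g * `|G z|) * S0 x); [rewrite ler_wpM2l// !mulr_ge0|ring].
  rewrite (_ : (fun z => Int (fun x => U x * (k x z * G z))) = (fun z => G z * Int (fun x => U x * k x z)))//.
  apply/funext => z; rewrite -IntZ; first by congr Int; apply/funext => x; ring.
  apply: (L1_dom _ (L1Z (A * A * g) lS)).
    by apply: measurable_funM; [exact: L1_mfn|exact: mfn2_l].
  move=> x; rewrite normrM; apply: (le_trans (ler_pM _ _ (Ub x) (kA x z))) => //.
  rewrite [leLHS](_ : _ = (A * A * g) * (S0 x * S0 x)); last by ring.
  by rewrite ler_wpM2l// !mulr_ge0.
have /all_and2[E2 lE2] z : Int (fun x => U x * k x z) = Int (fun w => G w * B z w) /\
    L1 (fun w => G w * B z w).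
  have -> : Int (fun x => U x * k x z) = Int (fun x => Int (fun w => k x z * (k x w * G w))).
    by congr Int; apply/funext => x; rewrite IntZ// mulrC.
  have mz : mfn2 (fun x w => k x z * (k x w * G w)).
    by apply: mfn2M; [apply: (mfn2_fst (h := k^~ z)); exact: mfn2_l|exact: (mfn2M mk (mfn2_snd mG))].
  have [|_ + ->] := fubini2 mz (L1Z (A * A) lS) (L1_abs lG).
    move=> x w; rewrite normrM; apply: (le_trans (ler_pM _ _ (kA x z) (kG x w))) => //.
    rewrite [leLHS](_ : _ = (A * A * `|G w|) * (S0 x * S0 x)); last by ring.
    by rewrite [leRHS](_ : _ = (A * A * `|G w|) * S0 x); [rewrite ler_wpM2l// !mulr_ge0|ring].
  rewrite (_ : (fun w => Int (fun x => k x z * (k x w * G w))) = (fun w => G w * B z w))//.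
  apply/funext => w; rewrite -BE -IntZ; first by congr Int; apply/funext => x; ring.
  apply: (L1_dom _ (L1Z (A * A) lS)).
    by apply: measurable_funM; exact: mfn2_l.
  move=> x; rewrite normrM; apply: (le_trans (ler_pM _ _ (kA x z) (kA x w))) => //.
  rewrite [leLHS](_ : _ = (A * A) * (S0 x * S0 x)); last by ring.
  by rewrite ler_wpM2l// !mulr_ge0.
have K0 z w : 0 <= Kr z w := le_trans (normr_ge0 _) (BKr z w).
have [H [lH bH IH]] := trilinear_majorant r12 N0 S_0 D0 lG lGr GD mKr K0 Ksym KN lKr KS.
rewrite E1; apply: (le_trans (Int_le lE1 lH _) IH) => z; rewrite E2.
apply: (le_trans (ler_norm _)); apply: le_trans (bH z).
rewrite normrM (ler_wpM2l (normr_ge0 _)).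
  by [].
apply: Int_abs_le; first exact: (L1_mfn (lE2 z)).
  apply: (L1_dom _ (L1Z N (L1_abs lG))).
    by apply: measurable_funM; [exact: (L1_mfn (L1_abs lG))|exact: mfn2_r].
  by move=> w; rewrite (ger0_norm (mulr_ge0 (normr_ge0 _) (K0 z w))) mulrC (ler_wpM2r (normr_ge0 _)).
by move=> w; rewrite normrM (ler_wpM2l (normr_ge0 _)).
Qed.
End ttstar.

(** * Operators with an oscillating kernel and a slowly varying amplitude *)

Section oscillatory_operator.
Variables (R : realType) (n : nat).
Local Notation V := 'rV[R]_n.

Lemma dotpDr (x z w : V) : dotp x (z + w) = dotp x z + dotp x w.
Proof. by rewrite /dotp -big_split; apply: eq_bigr => i _; rewrite mxE mulrDr. Qed.

Lemma dotpBr (x z w : V) : dotp x (z - w) = dotp x z - dotp x w.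
Proof. by rewrite /dotp -sumrB; apply: eq_bigr => i _; rewrite !mxE mulrBr. Qed.

Lemma dotpC (x z : V) : dotp x z = dotp z x.
Proof. by apply: eq_bigr => i _; rewrite mulrC. Qed.

Lemma waveC k (x z : V) : wave k x z = wave k z x.
Proof. by rewrite /wave dotpC. Qed.

(** With cosines in place of exponentials the kernel of the squared operator sees [z + w] besides
    [z - w]; both are treated alike. *)
Lemma waveM k (x z w : V) :
  wave k x z * wave k x w = 2^-1 * (wave (2 * k) x (z + w) + wave 0 x (z - w)).
Proof.
rewrite /wave dotpDr dotpBr; set a := 2 * pi * dotp x z + k; set b := 2 * pi * dotp x w + k.
rewrite (_ : 2 * pi * (dotp x z + dotp x w) + 2 * k = a + b); last by rewrite /a /b; ring.
rewrite (_ : 2 * pi * (dotp x z - dotp x w) + 0 = a - b); last by rewrite /a /b; ring.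
by rewrite (cosD a b) (cosB a b); lra.
Qed.

Lemma coord_cont2 i : continuous (fun p : V * V => p.2 ord0 i).
Proof.
have cs : continuous (@snd V V) by move=> p; exact: cvg_snd.
exact: (cts_comp cs (@coord_cont R n i)).
Qed.

Lemma coord_cont1 i : continuous (fun p : V * V => p.1 ord0 i).
Proof.
have cs : continuous (@fst V V) by move=> p; exact: cvg_fst.
exact: (cts_comp cs (@coord_cont R n i)).
Qed.

Lemma cauchy_cts (X : topologicalType) (f : X -> R) : continuous f ->
  continuous (fun x => (1 + f x ^+ 2)^-1).
Proof.
move=> cf; have cg : continuous (fun t : R => (1 + t ^+ 2)^-1).
  by have := @cauchy_continuous R 1 0; under eq_fun do rewrite mul1r subr0.
exact: (cts_comp cf cg).
Qed.

Lemma PkB_mfn2 h : mfn2 (fun z w : V => Pk h (z - w)).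
Proof.
apply: mfn2_cont; apply: continuous_prod => i.
apply: (@cauchy_cts _ (fun p : V * V => h * (p.1 - p.2) ord0 i)).
apply: ctsM; first exact: cts_cst.
by under eq_fun do rewrite !mxE; apply: ctsB; [exact: coord_cont1|exact: coord_cont2].
Qed.

Lemma PkD_mfn2 h : mfn2 (fun z w : V => Pk h (z + w)).
Proof.
apply: mfn2_cont; apply: continuous_prod => i.
apply: (@cauchy_cts _ (fun p : V * V => h * (p.1 + p.2) ord0 i)).
apply: ctsM; first exact: cts_cst.
by under eq_fun do rewrite !mxE; apply: ctsD; [exact: coord_cont1|exact: coord_cont2].
Qed.

Lemma slice_cts (X Y : topologicalType) (f : X * Y -> R) y : continuous f -> continuous (fun x => f (x, y)).
Proof.
move=> cf; apply: (cts_comp (f := fun x => (x, y)) _ cf).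
by apply: cts_pair; [move=> x; exact: cvg_id|exact: cts_cst].
Qed.

(** The amplitude varies at scale [h] on a box of side [4 h]: integration by parts yields the decay
    [Pk h z], and the volume yields [h ^ n]. *)
Lemma box_kernel_bound : (0 < n)%N -> exists2 C, 0 < C & forall h A c (f g : V -> R) k z,
  0 < h -> (forall i, xjet i (2 * n) h A f) -> (forall i, xjet i (2 * n) h A g) -> 0 <= A ->
  let F x := boxbump (2 * n) c h x ^+ 2 * (f x * g x) in
  L1 F /\ `|Int (fun x => F x * wave k x z)| <= C * A ^+ 2 * h ^+ n * Pk h z.
Proof.
move=> n0; have [B B0 jB] := boxbump_jet R n (2 * n).
pose i0 : 'I_n := Ordinal n0.
set P := (2 * n)%N in jB *.
(* The first factor is that of [oscillation], the last the volume of the box of side [4 h] in units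
   of [h], the middle one the Leibniz constants; adding [1] makes it positive. *)
exists (2 ^+ n * (2 ^+ P * (2 ^+ P * (B * B) * (2 ^+ P)) + 1) * 4 ^+ n).
  by rewrite !mulr_gt0 ?exprn_gt0// ltr_wpDl// !mulr_ge0 ?exprn_ge0.
move=> h A c f g k z h0 jf jg A0 F.
set C1 := _ + 1.
pose S : V -> R := \1_(box c (2 * h)).
have S0 x : 0 <= S x by rewrite /S indicE.
have h20 : 0 <= 2 * h by rewrite mulr_ge0// ltW.
have [lS IS] := L1_box c h20.
have jF i : sjet S i P h (C1 * A ^+ 2) F.
  have j1 : xjet i P h (2 ^+ P * (2 ^+ P * (B * B) * (2 ^+ P * (A * A)))) F.
    by apply: sjetM => //; apply: sjetM => //; exact: jB.
  have j2 := sjet_supp (@near_notbox R n c (2 * h)) h0 j1.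
  apply: (sjet_mono S0 h0) (j2 _).
    by rewrite /C1 mulrDl mul1r -[leLHS]addr0; apply: lerD; [rewrite le_eqVlt; apply/orP; left; apply/eqP; ring|exact: sqr_ge0].
  by move=> x bx; rewrite /F boxbump0// expr0n mul0r.
have FA x : `|F x| <= C1 * A ^+ 2 * S x := sjet_le (jF i0) x.
have lF : L1 F := L1_dom (mfn_cont (sjet_cts (jF i0))) (L1Z _ lS) FA.
split=> //.
have h4 : (2 * (2 * h)) ^+ n = 4 ^+ n * h ^+ n by rewrite -exprMn; congr (_ ^+ n); ring.
have := @oscillation R n F h (C1 * A ^+ 2 * (4 ^+ n * h ^+ n)) k z h0 lF.
rewrite (_ : 2 ^+ n * C1 * 4 ^+ n * A ^+ 2 * h ^+ n = 2 ^+ n * (C1 * A ^+ 2 * (4 ^+ n * h ^+ n))); last by ring.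
apply.
  rewrite -h4 -IS -IntZ//; apply: Int_le => //; [exact: L1_abs|exact: L1Z].
move=> i; have [C SC] := indic_box_Pk c (2 * h).
have [G [nG cG GA]] := nderiv_sjet h0 SC (jF i).
exists G => //.
rewrite [leRHS](_ : _ = C1 * A ^+ 2 / h ^+ P * (2 * (2 * h)) ^+ n); last by rewrite h4; ring.
rewrite -IS -IntZ//; apply: Int_le => //; last exact: L1Z.
by apply: L1_abs; apply: (L1_dom (mfn_cont cG) (L1Z _ lS)).
Qed.

(** The estimate serves twice: with [b = 1] and the frequency as the variable [x], it bounds a
    localized Fourier transform from L^r to L^2; with [b] the symbol and exponent [2], it bounds the
    operator from L^2 to L^2, where the power of [h] disappears. *)
Lemma oscillatory_operator : (0 < n)%N -> exists2 C, 0 < C &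
  forall r D h A c k (b : V * V -> R) (G : V -> R),
  1 < r <= 2 -> 0 < D -> 0 < h -> 0 < A -> continuous b ->
  (forall z i, xjet i (2 * n) h A (fun x => b (x, z))) ->
  L1 G -> L1 (fun z => `|G z| `^ r) -> Int (fun z => `|G z| `^ r) <= D ->
  let U x := boxbump (2 * n) c h x * Int (fun z => b (x, z) * wave k x z * G z) in
  [/\ L1 U, L1 (fun x => U x ^+ 2) &
  Int (fun x => U x ^+ 2) <= C * A ^+ 2 * (h ^+ n) `^ (2 / r - 1) * D `^ (2 / r)].
Proof.
move=> n0; have [C C0 HC] := box_kernel_bound n0.
exists (C * pi ^+ n); first by rewrite mulr_gt0// exprn_gt0// pi_gt0.
move=> r D h A c k b G r12 D0 h0 A0 cb jb lG lGr GD U.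
pose w x := boxbump (2 * n) c h x.
pose K x z := w x * (b (x, z) * wave k x z).
have h20 : 0 <= 2 * h by rewrite mulr_ge0// ltW.
have [lS IS] := L1_box c h20.
set S : V -> R := \1_(box c (2 * h)) in lS IS.
have bA x z : `|b (x, z)| <= A by have := sjet_le (jb z (Ordinal n0)) x; rewrite mulr1.
have wS x : `|w x| <= S x.
  have /andP[w0 w1] := boxbump_itv (2 * n) c h x; rewrite ger0_norm//.
  have [bx|bx] := pselect (box c (2 * h) x); first by rewrite /S indicE mem_set.
  by rewrite /w boxbump0// /S indicE.
have KA x z : `|K x z| <= A * S x.
  rewrite normrM mulrC; apply: ler_pM => //.
  by rewrite normrM (le_trans _ (bA x z))// ler_piMr// wave_le1.
have cw : continuous w.
  have [B _ jB] := boxbump_jet R n (2 * n).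
  exact: (sjet_cts (jB (Ordinal n0) c h h0)).
have mK : mfn2 K.
  apply: mfn2M; first exact: (mfn2_fst (mfn_cont cw)).
  apply: mfn2M; apply: mfn2_cont; last exact: wave_continuous.
  by under eq_fun do rewrite -surjective_pairing.
pose N0 := C * A ^+ 2 * h ^+ n.
have N00 : 0 < N0 by rewrite !mulr_gt0// exprn_gt0.
pose Kr (z v : V) : R := N0 / 2 * (Pk h (z + v) + Pk h (z - v)).
have lPk (z : V) : L1 (fun v => Pk h (z + v) : R) /\ Int (fun v => Pk h (z + v)) = (pi / h) ^+ n.
  rewrite (_ : (fun v => Pk h (z + v)) = (fun v => Pk h (v - - z))); first exact: L1_Pk.
  by apply/funext => v; rewrite opprK addrC.
have lPk' (z : V) : L1 (fun v => Pk h (z - v) : R) /\ Int (fun v => Pk h (z - v)) = (pi / h) ^+ n.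
  rewrite (_ : (fun v => Pk h (z - v)) = (fun v => Pk h (v - z))); first exact: L1_Pk.
  by apply/funext => v; rewrite -PkN opprB.
have UE x : U x = Int (fun z => K x z * G z).
  rewrite /U -IntZ.
    by congr Int; apply/funext => z; rewrite /K mulrA.
  apply: (L1_dom _ (L1Z A (L1_abs lG))).
    apply: (@mfn2_r _ _ (fun x z => b (x, z) * wave k x z * G z)).
    apply: mfn2M; last exact: (mfn2_snd (L1_mfn lG)).
    apply: mfn2M; apply: mfn2_cont; last exact: wave_continuous.
    by under eq_fun do rewrite -surjective_pairing.
  by move=> z; rewrite normrM ler_wpM2r// normrM (le_trans _ (bA x z))// ler_piMr// wave_le1.
have S01 x : 0 <= S x <= 1 by rewrite /S indicE; case: (x \in _); rewrite ?lexx ?ler01.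
have := @ttstar R n r A N0 (N0 * (pi / h) ^+ n) D K (fun z v => Int (fun x => K x z * K x v)) S G Kr r12 N00.
have pi0 : 0 < pi / h by rewrite divr_gt0// pi_gt0.
move=> /(_ _ D0 (ltW A0) mK lS S01 KA lG lGr GD (fun z v => erefl)).
(* The ratio of the supremum of the kernel to its mass; the power [2 / r - 1] will fall on it. *)
have -> : N0 / (N0 * (pi / h) ^+ n) = (h / pi) ^+ n.
  by rewrite invfM mulrA divff ?gt_eqF// mul1r -exprVn invf_div.
have -> : (fun x => Int (fun z => K x z * G z)) = U by apply/funext => x; rewrite UE.
have -> : (fun x => Int (fun z => K x z * G z) ^+ 2) = (fun x => U x ^+ 2).
  by apply/funext => x; rewrite UE.
move=> [|||||||lU IU].
- by rewrite mulr_gt0// exprn_gt0.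
- apply: mfn2M; first by apply: mfn2_fst; apply: mfn_cont; exact: cts_cst.
  by apply: measurable_funD; [exact: PkD_mfn2|exact: PkB_mfn2].
- move=> z v.
  pose F x := w x ^+ 2 * (b (x, z) * b (x, v)).
  have HF k' y := HC h A c (fun x => b (x, z)) (fun x => b (x, v)) k' y h0 (jb z) (jb v) (ltW A0).
  have lF : L1 F by have [] := HF 0 0.
  have -> : Int (fun x => K x z * K x v) =
    2^-1 * (Int (fun x => F x * wave (2 * k) x (z + v)) + Int (fun x => F x * wave 0 x (z - v))).
    rewrite -IntD; [|exact: L1_wave|exact: L1_wave].
    rewrite -IntZ; last by apply: L1D; exact: L1_wave.
    congr Int; apply/funext => x; rewrite /K /F.
    rewrite (_ : _ * _ = w x ^+ 2 * (b (x, z) * b (x, v)) * (wave k x z * wave k x v)); last by ring.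
    by rewrite waveM; ring.
  rewrite normrM ger0_norm ?invr_ge0// /Kr mulrAC mulrC ler_wpM2r ?invr_ge0//.
  rewrite (le_trans (ler_normD _ _))// mulrDr; apply: lerD.
    by have [_] := HF (2 * k) (z + v).
  by have [_] := HF 0 (z - v).
- by move=> z v; rewrite /Kr addrC [z + v]addrC -[Pk h (z - v)]PkN opprB addrC.
- move=> z v; rewrite /Kr; have := Pk_le1 h (z + v); have := Pk_le1 h (z - v); nra.
- by move=> z; apply: L1Z; apply: L1D; [case: (lPk z)|case: (lPk' z)].
- move=> z; have [l1 i1] := lPk z; have [l2 i2] := lPk' z.
  rewrite IntZ; last exact: L1D.
  by rewrite IntD// i1 i2; set X := (_ ^+ n); rewrite le_eqVlt (_ : N0 / 2 * (X + X) = N0 * X) ?eqxx//; field.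
split=> //.
  apply: (L1_dom _ (L1Z ((A * Int (fun z => `|G z|)) ^+ 2) lS)).
    by apply: measurable_funX; exact: (L1_mfn lU).
  move=> x; have Ub : `|U x| <= A * Int (fun z => `|G z|) * S x.
    rewrite UE mulrAC -IntZ ?L1_abs//; apply: Int_abs_le.
    - exact: (@mfn2_r _ _ (fun x z => K x z * G z) x (mfn2M mK (mfn2_snd (L1_mfn lG)))).
    - by apply: L1Z; exact: L1_abs.
    - by move=> z; rewrite normrM ler_wpM2r.
  have /andP[s0 s1] := S01 x.
  rewrite normrX -[leLHS]mulr1; apply: (@le_trans _ _ ((A * Int (fun z => `|G z|) * S x) ^+ 2)).
    by rewrite mulr1 lerXn2r ?nnegrE// (le_trans _ Ub).
  rewrite exprMn ler_wpM2l ?sqr_ge0// expr2 ler_piMr//.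
rewrite (le_trans IU)// /N0.
have -> : C * A ^+ 2 * h ^+ n * (pi / h) ^+ n = C * pi ^+ n * A ^+ 2.
  by rewrite exprMn exprVn; field; rewrite expf_neq0// gt_eqF.
rewrite [leLHS]mulrC -[leRHS]mulrA; apply: ler_wpM2l.
  by rewrite !mulr_ge0 ?sqr_ge0 ?exprn_ge0 ?pi_ge0// ltW.
rewrite mulrC ler_wpM2r ?powR_ge0//.
apply: ge0_ler_powR; rewrite ?nnegrE ?exprn_ge0//.
- have /andP[r1 r2] := r12; have : 2^-1 <= r^-1 by rewrite lef_pV2 ?posrE//; lra.
  lra.
- by rewrite divr_ge0 ?pi_ge0// ltW.
- exact: ltW.
- rewrite lerXn2r ?nnegrE ?divr_ge0 ?pi_ge0 ?(ltW h0)//.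
  rewrite ler_pdivrMr ?pi_gt0// ler_peMr ?(ltW h0)//.
  have := pi_ge2 R; lra.
Qed.
End oscillatory_operator.

(** * Frequency-localized operators *)

Section frequency_piece.
Variables (R : realType) (n : nat).
Local Notation V := 'rV[R]_n.

(** Positive and negative parts are integrated separately, each measurably by Tonelli, so that
    measurability of the integral asks for no integrability. *)
Lemma mfn_Int (h : V -> V -> R) : mfn2 h -> mfn (fun x => Int (h x)).
Proof.
move=> mh; pose M := model R n; pose pt := @mv R n M.
pose H := fun p : mT M * mT M => (h (pt p.1) (pt p.2))%:E.
have mH : measurable_fun setT H by exact/measurable_EFinP.
rewrite /mfn /Int /Rintegral.
apply: (measurableT_comp (f := fine)) => //.
under eq_fun do rewrite integralE.
apply: emeasurable_funB.
  rewrite (_ : (fun x => _) = fubini_F (mmu M) (H^\+)%E); last first.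
    by apply/funext => x; apply: eq_integral => y _; rewrite !funeposE.
  by apply: measurable_fun_fubini_tonelli_F => //; exact: measurable_funepos.
rewrite (_ : (fun x => _) = fubini_F (mmu M) (H^\-)%E); last first.
    by apply/funext => x; apply: eq_integral => y _; rewrite !funenegE.
by apply: measurable_fun_fubini_tonelli_F => //; exact: measurable_funeneg.
Qed.

Definition Top (a : V * V -> R) (k : R) (f : V -> R) (x : V) : R :=
  Int (fun z => a (x, z) * Int (fun y => f y * wave k (x - y) z)).

(** Meant as the bound inside a jet in the frequency at scale [h^-1]: there each frequency
    derivative gains a factor [h], while each derivative in [x] loses one, the balance of the class
    with equal indices [rho, rho]. *)
Definition symB (h l : R) (a : V * V -> R) (A : R) :=
  [/\ continuous a, forall z i, xjet i (2 * n) h A (fun x => a (x, z)) &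
      forall x z, ~ box 0 (2 * l) z -> a (x, z) = 0].

Definition Derz (i : 'I_n) (F F' : V * V -> R) :=
  forall x, Der i (fun z => F (x, z)) (fun z => F' (x, z)).

Definition hat (k : R) (f : V -> R) (z : V) : R := Int (fun y => f y * wave k y z).

Lemma dotpBl (x y z : V) : dotp (x - y) z = dotp x z - dotp y z.
Proof. by rewrite dotpC dotpBr dotpC [dotp z y]dotpC. Qed.

(** Separates [x] from [y] at the price of two terms; it replaces the factorization of the
    exponential. *)
Lemma waveB k (x y z : V) :
  wave k (x - y) z = wave k x z * wave 0 y z + wave (k - pi / 2) x z * wave (- (pi / 2)) y z.
Proof.
rewrite /wave dotpBl; set a := 2 * pi * dotp x z; set b := 2 * pi * dotp y z.
have cN (t : R) : cos (t - pi / 2) = sin t.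
  by rewrite -cosN opprB addrC cosDpihalf sinN opprK.
rewrite addrA !cN addr0 -cosB; congr cos; rewrite /a /b; ring.
Qed.

Lemma hat_split f k x z : L1 f ->
  Int (fun y => f y * wave k (x - y) z) =
  wave k x z * hat 0 f z + wave (k - pi / 2) x z * hat (- (pi / 2)) f z.
Proof.
move=> lf; rewrite /hat -!IntZ; try exact: L1_wave.
rewrite -IntD; try by apply: L1Z; exact: L1_wave.
by congr Int; apply/funext => y; rewrite waveB; ring.
Qed.

(** The cutoff equals [1] on the frequency support of every symbol in [symB h l], so it can be
    inserted freely, and it confines the transform to a box of side comparable to [l]. *)
Definition hatcut l k f z := boxbump (2 * n) 0 (2 * l) z * hat k f z.

Lemma hatcutE a h l A k f x z : 0 < l -> symB h l a A ->
  a (x, z) * hat k f z = a (x, z) * hatcut l k f z.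
Proof.
move=> l0 [_ _ sa]; have [bz|bz] := pselect (box 0 (2 * l) z).
  by rewrite /hatcut boxbump1 ?mul1r// mulr_gt0.
by rewrite sa// !mul0r.
Qed.

Lemma hat_bounded k f z : L1 f -> `|hat k f z| <= Int (fun y => `|f y|).
Proof.
move=> lf; apply: Int_abs_le; [exact: (L1_mfn (L1_wave _ _ lf))|exact: L1_abs|].
by move=> y; rewrite normrM ler_piMr// wave_le1.
Qed.

Lemma sym_le h l a A x z : (0 < n)%N -> symB h l a A -> `|a (x, z)| <= A * \1_(box 0 (2 * l)) z.
Proof.
move=> n0 [_ ja sa]; have [bz|bz] := pselect (box 0 (2 * l) z).
  by rewrite indicE mem_set// (sjet_le (ja z (Ordinal n0)) x).
by rewrite sa// normr0 indicE memNset// mulr0.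
Qed.

Lemma sym_mfn2 h l a A : symB h l a A -> mfn2 (fun x z => a (x, z)).
Proof. by move=> [ca _ _]; apply: mfn2_cont; under eq_fun do rewrite -surjective_pairing. Qed.

Lemma wave_mfn2 k : mfn2 (fun x z : V => wave k x z).
Proof. apply: mfn2_cont; exact: wave_continuous. Qed.

Lemma hat_mfn k f : mfn f -> mfn (hat k f).
Proof.
move=> mf; apply: mfn_Int; apply: mfn2M; first exact: mfn2_snd.
exact: mfn2_swap (wave_mfn2 k).
Qed.

Lemma Tsplit a h l A k f x : (0 < n)%N -> 0 < l -> symB h l a A -> L1 f ->
  Top a k f x = Int (fun z => a (x, z) * wave k x z * hatcut l 0 f z) +
    Int (fun z => a (x, z) * wave (k - pi / 2) x z * hatcut l (- (pi / 2)) f z).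
Proof.
move=> n0 l0 sa lf; have l20 : 0 <= 2 * l by rewrite mulr_ge0// ltW.
have [lB _] := L1_box (0 : V) l20.
have L k1 k2 : L1 (fun z => a (x, z) * wave k1 x z * hatcut l k2 f z).
  rewrite (_ : (fun z => _) = (fun z => a (x, z) * wave k1 x z * hat k2 f z)); last first.
    by apply/funext => z; rewrite mulrAC -(hatcutE _ _ _ _ l0 sa) mulrAC.
  apply: (L1_dom _ (L1Z (A * Int (fun y => `|f y|)) lB)).
    apply: measurable_funM; last exact: (hat_mfn k2 (L1_mfn lf)).
    by apply: measurable_funM; [exact: (mfn2_r x (sym_mfn2 sa))|exact: (mfn2_r x (wave_mfn2 k1))].
  move=> z; rewrite !normrM [leRHS]mulrAC; apply: ler_pM => //; last exact: hat_bounded.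
  by apply: (le_trans _ (sym_le x z n0 sa)); rewrite ler_piMr// wave_le1.
rewrite -IntD//; congr Int; apply/funext => z.
rewrite hat_split// mulrDr ![a _ * (_ * _)]mulrCA (hatcutE _ _ _ _ l0 sa) [in X in _ + X](hatcutE _ _ _ _ l0 sa).
ring.
Qed.

Lemma sqr_powR2 (t : R) : `|t| `^ 2 = t ^+ 2.
Proof. by rewrite -[2]/(2%:R) powR_mulrn// real_normK ?num_real. Qed.

(** Substitute for Hausdorff-Young followed by Hölder on a frequency box: [oscillatory_operator]
    with amplitude [1] and with position and frequency exchanged, at scale [2 * l]. *)
Lemma hatcut_bound : (0 < n)%N -> exists2 C, 0 < C & forall r D l k (f : V -> R),
  1 < r <= 2 -> 0 < D -> 0 < l -> L1 f -> L1 (fun y => `|f y| `^ r) -> Int (fun y => `|f y| `^ r) <= D ->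
  [/\ L1 (hatcut l k f), L1 (fun z => hatcut l k f z ^+ 2) &
    Int (fun z => hatcut l k f z ^+ 2) <= C * (l ^+ n) `^ (2 / r - 1) * D `^ (2 / r)].
Proof.
move=> n0; have [C C0 HC] := oscillatory_operator R n0.
exists (C * 2 ^+ n); first by rewrite mulr_gt0// exprn_gt0.
move=> r D l k f r12 D0 l0 lf lfr fD.
have l20 : 0 < 2 * l by rewrite mulr_gt0.
have [] := HC r D (2 * l) 1 0 k (fun=> 1) f r12 D0 l20 ltr01 (@cts_cst (V * V)%type R 1) _ lf lfr fD.
  by move=> z i; have := @xjet_cst R n i (2 * n) (2 * l) 1 l20; rewrite normr1.
move=> l1 l2; rewrite expr1n mulr1 => I2.
have eU : (fun x : V => boxbump (2 * n) 0 (2 * l) x * Int (fun z => 1 * wave k x z * f z)) = hatcut l k f.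
  apply/funext => z; rewrite /hatcut /hat; congr (_ * Int _); apply/funext => y.
  by rewrite mul1r waveC mulrC.
split; [by rewrite -eU|by rewrite -eU|].
rewrite -{1}eU; apply: (le_trans I2); rewrite ler_wpM2r ?powR_ge0// -[leRHS]mulrA ler_wpM2l ?(ltW C0)//.
rewrite exprMn powRM ?exprn_ge0 ?(ltW l0)// ler_wpM2r ?powR_ge0//.
have /andP[r1 r2] := r12; rewrite -[leRHS]powRr1 ?exprn_ge0//.
apply: ler_powR; first by rewrite exprn_ege1// ler1n.
have : r^-1 < 1 by rewrite invf_lt1//; lra.
lra.
Qed.

End frequency_piece.

(** * Unweighted bounds for one frequency piece *)

Section piece_base.
Variables (R : realType) (n : nat).
Local Notation V := 'rV[R]_n.

Lemma sqrD_le (u v : R) : (u + v) ^+ 2 <= 2 * u ^+ 2 + 2 * v ^+ 2.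
Proof. by have := sqr_ge0 (u - v); nra. Qed.

Lemma Int_sqrD (u v w : V -> R) a b E1 E2 : mfn u ->
  (forall x, u x ^+ 2 <= 2 * (a * v x) ^+ 2 + 2 * (b * w x) ^+ 2) ->
  L1 (fun x => v x ^+ 2) -> Int (fun x => v x ^+ 2) <= E1 ->
  L1 (fun x => w x ^+ 2) -> Int (fun x => w x ^+ 2) <= E2 ->
  L1 (fun x => u x ^+ 2) /\ Int (fun x => u x ^+ 2) <= 2 * a ^+ 2 * E1 + 2 * b ^+ 2 * E2.
Proof.
move=> mu uvw lv vE lw wE.
have lv' : L1 (fun x => 2 * a ^+ 2 * v x ^+ 2) by exact: L1Z.
have lw' : L1 (fun x => 2 * b ^+ 2 * w x ^+ 2) by exact: L1Z.
have lR : L1 (fun x => 2 * a ^+ 2 * v x ^+ 2 + 2 * b ^+ 2 * w x ^+ 2) by exact: L1D.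
have Ub x : u x ^+ 2 <= 2 * a ^+ 2 * v x ^+ 2 + 2 * b ^+ 2 * w x ^+ 2.
  by apply: (le_trans (uvw x)); rewrite le_eqVlt; apply/orP; left; apply/eqP; ring.
have lU : L1 (fun x => u x ^+ 2).
  apply: (L1_dom _ lR); first exact: measurable_funX.
  by move=> x; rewrite ger0_norm ?sqr_ge0.
split=> //; apply: (le_trans (Int_le lU lR Ub)).
rewrite (IntD lv' lw') (IntZ _ lv) (IntZ _ lw).
by apply: lerD; rewrite ler_wpM2l// mulr_ge0// sqr_ge0.
Qed.

Lemma line_lipschitz i (F F' : V -> R) B x s :
  Der i F F' -> (forall x, `|F' x| <= B) -> `|F (s *: evec R i + x) - F x| <= B * `|s|.
Proof.
move=> dF FB.
have H y t : 0 <= t -> `|F (t *: evec R i + y) - F y| <= B * t.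
  move=> t0; pose g u := F (u *: evec R i + y).
  have dg (u : R) : is_derive u (1 : R) g (F' (u *: evec R i + y)).
    apply: (@is_derive_pull _ _ _ _ (fun u : R => u *: evec R i + y) F _ _ _ _ _ (dF _)) => v.
    by rewrite scalerDl [v *: 1]mulr1 addrA.
  have cg : {within `[0, t], continuous g}.
    apply: derivable_within_continuous => u _; exact: ex_derive.
  have [u _ gE] := MVT_segment t0 (fun u _ => dg u) cg.
  have -> : F (t *: evec R i + y) - F y = g t - g 0 by rewrite /g scale0r add0r.
  by rewrite gE subr0 normrM (ger0_norm t0) ler_wpM2r.
have [s0|s0] := leP 0 s; first by rewrite (ger0_norm s0); exact: H.
rewrite (ltr0_norm s0) distrC.
have := H (s *: evec R i + x) (- s); rewrite oppr_ge0 => /(_ (ltW s0)).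
by rewrite addrA -scalerDl addNr scale0r add0r.
Qed.

(** Only partial derivatives are at hand, so the coordinates of [x] are replaced one at a time by
    those of [x']; this is the factor [n]. *)
Lemma lipschitz (F : V -> R) (B e : R) (x x' : V) : 0 <= B ->
  (forall i, exists2 F', Der i F F' & forall x, `|F' x| <= B) ->
  (forall i, `|x ord0 i - x' ord0 i| <= e) -> `|F x - F x'| <= B * e * n%:R.
Proof.
move=> B0 HF xe.
pose mix p : V := \row_i (if (i < p)%N then x' ord0 i else x ord0 i).
have m0 : mix 0 = x by apply/rowP => i; rewrite mxE.
have mn : mix n = x' by apply/rowP => i; rewrite mxE ltn_ord.
have H p : (p <= n)%N -> `|F (mix p) - F x| <= B * e * p%:R.
  elim: p => [|p IH] pn; first by rewrite m0 subrr normr0 mulr0.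
  have := IH (ltnW pn) => {}IH.
  pose i := Ordinal pn; have [F' dF FB] := HF i.
  have mS : mix p.+1 = (x' ord0 i - x ord0 i) *: evec R i + mix p.
    apply/rowP => j; rewrite evec_lineE !mxE ltnS leq_eqVlt.
    have [->|ji] := eqVneq j i; first by rewrite eqxx ltnn /= mulr1 subrK.
    have -> : (j == p :> nat) = false by apply/negbTE; move: ji; rewrite -val_eqE.
    by rewrite mulr0 add0r.
  rewrite -(subrK (F (mix p)) (F (mix p.+1))) -addrA (le_trans (ler_normD _ _))//.
  rewrite -[in leRHS]addn1 natrD mulrDr mulr1 [leRHS]addrC lerD//.
  rewrite mS (le_trans (line_lipschitz _ _ dF FB))// ler_wpM2l// distrC; exact: xe.
by rewrite distrC -mn; exact: H.
Qed.

Lemma cauchy_schwarz_box (G : V -> R) L E : 0 < L -> 0 < E -> mfn G -> L1 (fun z => G z ^+ 2) ->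
  Int (fun z => G z ^+ 2) <= E ->
  L1 (fun z => \1_(box 0 L) z * `|G z|) /\
  Int (fun z => \1_(box 0 L) z * `|G z|) <= Num.sqrt ((2 * L) ^+ n * E).
Proof.
move=> L0 E0 mG lG GE; have [lB IB] := L1_box (0 : V) (ltW L0).
set v := (2 * L) ^+ n in IB *.
have v0 : 0 < v by rewrite exprn_gt0// mulr_gt0.
set s := Num.sqrt (v * E); have s0 : 0 < s by rewrite sqrtr_gt0 mulr_gt0.
have sE : s ^+ 2 = v * E by rewrite sqr_sqrtr// mulr_ge0// ltW.
(* The value of [t] that minimizes [t / 2 * E + v / (2 t)], whose minimum is the square root in the
   conclusion. *)
pose t := s / E; have t0 : 0 < t by rewrite divr_gt0.
have bd z : \1_(box 0 L) z * `|G z| <= t / 2 * G z ^+ 2 + (2 * t)^-1 * \1_(box 0 L) z.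
  rewrite indicE; case: (z \in box 0 L); last by rewrite mul0r mulr0 addr0 mulr_ge0 ?sqr_ge0// divr_ge0// ltW.
  rewrite mul1r mulr1 -(real_normK (num_real (G z))); set g := `|G z|.
  rewrite -subr_ge0 (_ : _ - _ = (2 * t)^-1 * (t * g - 1) ^+ 2); last by field; rewrite gt_eqF.
  by rewrite mulr_ge0 ?sqr_ge0// invr_ge0 mulr_ge0// ltW.
have lR : L1 (fun z => t / 2 * G z ^+ 2 + (2 * t)^-1 * \1_(box 0 L) z) by apply: L1D; exact: L1Z.
have l1 : L1 (fun z => \1_(box 0 L) z * `|G z|).
  apply: (L1_dom _ lR).
    apply: measurable_funM; first exact: (L1_mfn lB).
    by apply: measurableT_comp => //; exact: mG.
  by move=> z; rewrite ger0_norm// mulr_ge0// indicE.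
split=> //; apply: (le_trans (Int_le l1 lR bd)).
rewrite IntD ?L1Z// ?IntZ// IB.
apply: (@le_trans _ _ (t / 2 * E + (2 * t)^-1 * v)).
  by rewrite lerD2r ler_wpM2l// divr_ge0// ltW.
have -> : v = s ^+ 2 / E by rewrite sE mulfK// gt_eqF.
by rewrite le_eqVlt /t; apply/orP; left; apply/eqP; field; rewrite !gt_eqF.
Qed.

Lemma Top_mfn (a : V * V -> R) h l A k f : (0 < n)%N -> 0 < l -> symB h l a A -> L1 f -> mfn (Top a k f).
Proof.
move=> n0 l0 sa lf; rewrite (_ : Top a k f = (fun x => Int (fun z => a (x, z) * wave k x z * hatcut l 0 f z) +
    Int (fun z => a (x, z) * wave (k - pi / 2) x z * hatcut l (- (pi / 2)) f z))); last first.
  by apply/funext => x; exact: (Tsplit k x n0 l0 sa lf).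
have mh k' : mfn (hatcut l k' f).
  have [B _ jB] := boxbump_jet R n (2 * n).
  apply: measurable_funM; last exact: (hat_mfn k' (L1_mfn lf)).
  by apply: mfn_cont; apply: (sjet_cts (jB (Ordinal n0) 0 (2 * l) _)); rewrite mulr_gt0.
have mm k1 k2 : mfn2 (fun x z => a (x, z) * wave k1 x z * hatcut l k2 f z).
  apply: mfn2M; last exact: mfn2_snd.
  by apply: mfn2M; [exact: sym_mfn2 sa|exact: wave_mfn2].
by apply: measurable_funD; [exact: (mfn_Int (mm _ _))|exact: (mfn_Int (mm _ _))].
Qed.

(** Two stages: [hatcut_bound] takes [f] into L^2 of the frequencies, then [oscillatory_operator] at
    exponent [2] applies the symbol, so that the only loss is the power of [l] from the first
    stage. *)
Lemma piece_L2_base : (0 < n)%N -> exists2 C, 0 < C &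
  forall r D h l A c k (a : V * V -> R) (f : V -> R),
  1 < r <= 2 -> 0 < D -> 0 < h -> 0 < l -> 0 < A -> symB h l a A ->
  L1 f -> L1 (fun y => `|f y| `^ r) -> Int (fun y => `|f y| `^ r) <= D ->
  let U x := boxbump (2 * n) c h x * Top a k f x in
  L1 (fun x => U x ^+ 2) /\ Int (fun x => U x ^+ 2) <= C * A ^+ 2 * (l ^+ n) `^ (2 / r - 1) * D `^ (2 / r).
Proof.
move=> n0; have [C1 C10 H1] := hatcut_bound R n0; have [C2 C20 H2] := oscillatory_operator R n0.
exists (4 * C2 * C1); first by rewrite !mulr_gt0.
move=> r D h l A c k a f r12 D0 h0 l0 A0 sa lf lfr fD U.
set E := C1 * (l ^+ n) `^ (2 / r - 1) * D `^ (2 / r).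
have E0 : 0 < E by rewrite !mulr_gt0// powR_gt0// exprn_gt0.
have HE k1 k2 : let U x := boxbump (2 * n) c h x * Int (fun z => a (x, z) * wave k1 x z * hatcut l k2 f z) in
    L1 (fun x => U x ^+ 2) /\ Int (fun x => U x ^+ 2) <= C2 * A ^+ 2 * E.
  have [g1 g2 gE] := H1 r D l k2 f r12 D0 l0 lf lfr fD.
  have [ca ja _] := sa.
  have G2 : (fun z => `|hatcut l k2 f z| `^ 2) = (fun z => hatcut l k2 f z ^+ 2).
    by apply/funext => z; exact: sqr_powR2.
  have r2 : 1 < (2 : R) <= 2 by rewrite lexx andbT; lra.
  have := H2 2 E h A c k1 a (hatcut l k2 f) r2 E0 h0 A0 ca ja g1.
  rewrite G2 => /(_ g2 gE) [_ ? IU]; split=> //; apply: (le_trans IU).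
  by rewrite divff// subrr powRr0 mulr1 powRr1// ltW.
have [l0' I0] := HE k 0; have [l1' I1] := HE (k - pi / 2) (- (pi / 2)).
set U0 := (fun x => boxbump (2 * n) c h x * Int (fun z => a (x, z) * wave k x z * hatcut l 0 f z)) in l0' I0.
set U1 := (fun x => boxbump (2 * n) c h x * Int (fun z => a (x, z) * wave (k - pi / 2) x z * hatcut l (- (pi / 2)) f z)) in l1' I1.
have UE x : U x = U0 x + U1 x by rewrite /U (Tsplit k x n0 l0 sa lf) mulrDr.
have mU : mfn U.
  have [B _ jB] := boxbump_jet R n (2 * n).
  apply: measurable_funM; last exact: (Top_mfn k n0 l0 sa lf).
  by apply: mfn_cont; apply: (sjet_cts (jB (Ordinal n0) c h h0)).
have [|lU IU] := Int_sqrD (a := 1) (b := 1) mU _ l0' I0 l1' I1.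
  move=> x; rewrite [1 * _]mul1r [1 * U1 x]mul1r UE; exact: sqrD_le.
split=> //; apply: (le_trans IU).
by rewrite le_eqVlt /E; apply/orP; left; apply/eqP; ring.
Qed.

(** A Bernstein estimate: Cauchy-Schwarz over the frequency box turns the L^2 bound of the transform
    into [(l ^ n D) ^ (1 / r)]. A derivative in [x] costs [4 pi l] on the wave and [1 / h <= l] on
    the symbol. *)
Lemma piece_osc_base : (0 < n)%N -> exists2 C, 0 < C &
  forall r D h l A k (a : V * V -> R) (f : V -> R),
  1 < r <= 2 -> 0 < D -> 0 < h -> 0 < l -> h^-1 <= l -> 0 < A -> symB h l a A ->
  L1 f -> L1 (fun y => `|f y| `^ r) -> Int (fun y => `|f y| `^ r) <= D ->
  let S := (l ^+ n * D) `^ r^-1 in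
  (forall x, `|Top a k f x| <= C * A * S) /\
  (forall (x x' : V) e, (forall i, `|x ord0 i - x' ord0 i| <= e) ->
    `|Top a k f x - Top a k f x'| <= C * A * S * (e * l)).
Proof.
move=> n0; have [C1 C10 H1] := hatcut_bound R n0.
pose C2 := Num.sqrt (4 ^+ n * C1).
have C20 : 0 < C2 by rewrite sqrtr_gt0 mulr_gt0// exprn_gt0.
(* The derivative costs of symbol and wave, summed over the [n] coordinates. *)
pose C3 := (1 + 4 * pi) * n%:R + 1 : R.
have C30 : 0 < C3 by rewrite ltr_wpDl// mulr_ge0// addr_ge0// mulr_ge0// pi_ge0.
exists (2 * C2 * C3); first by rewrite !mulr_gt0.
move=> r D h l A k a f r12 D0 h0 l0 hl A0 sa lf lfr fD S.
have S0 : 0 <= S := powR_ge0 _ _.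
pose B : V -> R := \1_(box 0 (2 * l)).
have l20 : 0 < 2 * l by rewrite mulr_gt0.
have GI k2 : L1 (fun z => B z * `|hatcut l k2 f z|) /\ Int (fun z => B z * `|hatcut l k2 f z|) <= C2 * S.
  have [g1 g2 gE] := H1 r D l k2 f r12 D0 l0 lf lfr fD.
  set E := C1 * _ * _ in gE.
  have E0 : 0 < E by rewrite !mulr_gt0// powR_gt0// exprn_gt0.
  have [? I] := cauchy_schwarz_box l20 E0 (L1_mfn g1) g2 gE.
  split=> //; apply: (le_trans I).
  have ln0 : 0 < l ^+ n by rewrite exprn_gt0.
  rewrite /C2 (_ : S = Num.sqrt (S ^+ 2)); last by rewrite sqrtr_sqr ger0_norm.
  rewrite -sqrtrM ?mulr_ge0 ?exprn_ge0// ?(ltW C10)// ler_sqrt; last first.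
    by rewrite !mulr_ge0 ?exprn_ge0 ?sqr_ge0// ltW.
  rewrite -powR_mulrn// -powRrM powRM ?(ltW ln0) ?(ltW D0)//.
  rewrite (_ : r^-1 * 2%:R = 2 / r); last by rewrite mulrC.
  rewrite /E (_ : 2 * (2 * l) = 4 * l); last by ring.
  rewrite exprMn.
  have -> : (l ^+ n) `^ (2 / r) = l ^+ n * (l ^+ n) `^ (2 / r - 1).
    rewrite -{2}[l ^+ n]powRr1 ?(ltW ln0)// -powRD; first by congr (_ `^ _); ring.
    by rewrite (gt_eqF ln0) implybT.
  by rewrite le_eqVlt; apply/orP; left; apply/eqP; ring.
have key (x x' : V) e : 0 <= e -> (forall i, `|x ord0 i - x' ord0 i| <= e) -> forall k1 z,
    `|a (x, z) * wave k1 x z - a (x', z) * wave k1 x' z| <= A * (l * C3 * e) * B z.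
  move=> e0 xe k1 z; have [ca ja sz] := sa.
  have [bz|bz] := pselect (box 0 (2 * l) z); last first.
    by rewrite !sz// !mul0r subrr normr0 mulr_ge0// ?mulr_ge0 ?(ltW A0) ?(ltW l0) ?(ltW C30)// /B indicE.
  have -> : B z = 1 by rewrite /B indicE mem_set.
  have := @lipschitz (fun x => a (x, z) * wave k1 x z) (A * (l * (1 + 4 * pi))) e x x'.
  have p0 := pi_ge0 R.
  move=> /(_ _ _ xe)/le_trans; apply.
  - by rewrite !mulr_ge0 ?(ltW A0) ?(ltW l0)// addr_ge0// mulr_ge0.
  - move=> i; have := ja z i; have [m ->] : exists m, (2 * n)%N = m.+1.
      by exists (2 * n).-1; rewrite prednK// muln_gt0.
    move=> [[_ _ aA] [F' [dF /sjet_le F'A]]].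
    eexists; first exact: (DerM dF (Der_wave i k1 z)).
    move=> y; rewrite (le_trans (ler_normD _ _))//.
    rewrite [leRHS](_ : _ = A * l + A * (l * (4 * pi))); last by ring.
    apply: lerD.
      rewrite normrM; apply: (@le_trans _ _ (A / h * 1)).
        by apply: ler_pM => //; [have := F'A y; rewrite mulr1|exact: wave_le1].
      by rewrite mulr1 ler_wpM2l// ltW.
    rewrite normrM; apply: ler_pM => //; first by have := aA y; rewrite mulr1.
    rewrite normrM; apply: (@le_trans _ _ (l * (4 * pi) * 1)); last by rewrite mulr1.
    apply: ler_pM => //; last exact: wave_le1.
    rewrite !normrM (ger0_norm p0) ger0_norm//.
    have := bz i; rewrite mxE subr0; nra.
  - rewrite mulr1 /C3; have : 0 <= A * l * e by rewrite !mulr_ge0// ltW.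
    have := ler0n R n; nra.
have ab x z := sym_le x z n0 sa.
have mG k2 : mfn (hatcut l k2 f) by have [g1 _ _] := H1 r D l k2 f r12 D0 l0 lf lfr fD; exact: L1_mfn.
have mp x k1 k2 : mfn (fun z => a (x, z) * wave k1 x z * hatcut l k2 f z).
  apply: measurable_funM; last exact: mG.
  by apply: measurable_funM; [exact: (mfn2_r x (sym_mfn2 sa))|exact: (mfn2_r x (wave_mfn2 k1))].
have bp x k1 k2 z : `|a (x, z) * wave k1 x z * hatcut l k2 f z| <= A * (B z * `|hatcut l k2 f z|).
  by rewrite normrM mulrA ler_wpM2r// normrM (le_trans _ (ab x z))// ler_piMr// wave_le1.
have lp x k1 k2 : L1 (fun z => a (x, z) * wave k1 x z * hatcut l k2 f z).
  by apply: (L1_dom (mp x k1 k2) (L1Z A (GI k2).1)) => z; exact: bp.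
split.
  have sup x k1 k2 : `|Int (fun z => a (x, z) * wave k1 x z * hatcut l k2 f z)| <= C2 * A * S.
    apply: (le_trans (Int_abs_le (mp x k1 k2) (L1Z A (GI k2).1) (bp x k1 k2))).
    by rewrite IntZ ?(GI k2).1// mulrAC [leRHS]mulrC ler_wpM2l ?(ltW A0)// (GI k2).2.
  move=> x; rewrite (Tsplit k x n0 l0 sa lf) (le_trans (ler_normD _ _))//.
  apply: (le_trans (lerD (sup _ _ _) (sup _ _ _))).
  have c3 : 1 <= C3 by rewrite /C3 lerDr mulr_ge0// addr_ge0// mulr_ge0// pi_ge0.
  have : 0 <= C2 * A * S by rewrite !mulr_ge0// ltW.
  nra.
move=> x x' e xe.
have e0 : 0 <= e by exact: le_trans (xe (Ordinal n0)).
have df k1 k2 : `|Int (fun z => a (x, z) * wave k1 x z * hatcut l k2 f z) -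
     Int (fun z => a (x', z) * wave k1 x' z * hatcut l k2 f z)| <= C2 * C3 * A * S * (e * l).
  rewrite -IntB//; apply: (@le_trans _ _ (Int (fun z => A * (l * C3 * e) * (B z * `|hatcut l k2 f z|)))).
    apply: Int_abs_le.
    - exact: (measurable_funB (mp _ _ _) (mp _ _ _)).
    - by apply: L1Z; exact: (GI k2).1.
    - by move=> z; rewrite -mulrBl normrM [leRHS]mulrA ler_wpM2r//; exact: key.
  rewrite IntZ; last exact: (GI k2).1.
  apply: (@le_trans _ _ (A * (l * C3 * e) * (C2 * S))).
    by rewrite ler_wpM2l ?(GI k2).2// !mulr_ge0// ltW.
  by rewrite le_eqVlt; apply/orP; left; apply/eqP; ring.
rewrite !(Tsplit k _ n0 l0 sa lf) opprD addrACA (le_trans (ler_normD _ _))//.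
apply: (le_trans (lerD (df _ _) (df _ _))).
by rewrite le_eqVlt; apply/orP; left; apply/eqP; ring.
Qed.

End piece_base.

(** * Weighted estimates *)

Opaque Int cos sin pi wave model mmu mv Pk.

Section weights.
Variables (R : realType) (n : nat).
Local Notation V := 'rV[R]_n.
Hypothesis n0 : (0 < n)%N.

Lemma waveB_mfn2 k (x : V) : mfn2 (fun z y : V => wave k (x - y) z).
Proof.
rewrite (_ : (fun z y : V => _) = (fun z y => wave k x z * wave 0 y z +
    wave (k - pi / 2) x z * wave (- (pi / 2)) y z)); last first.
  by apply/funext => z; apply/funext => y; exact: waveB.
have w1 k1 : mfn2 (fun z _ : V => wave k1 x z).
  exact: (mfn2_fst (mfn2_r x (@wave_mfn2 R n k1))).
have w2 k1 : mfn2 (fun z y : V => wave k1 y z) by exact: (mfn2_swap (@wave_mfn2 R n k1)).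
exact: (measurable_funD (mfn2M (w1 _) (w2 _)) (mfn2M (w1 _) (w2 _))).
Qed.

(** Puts the frequency integral innermost, where it can be integrated by parts for fixed [x - y]. *)
Lemma wave_swap k (b g : V -> R) x : L1 b -> L1 g ->
  L1 (fun z => b z * Int (fun y => g y * wave k (x - y) z)) /\
  Int (fun z => b z * Int (fun y => g y * wave k (x - y) z)) =
  Int (fun y => g y * Int (fun z => b z * wave k z (x - y))).
Proof.
move=> lb lg.
have mh : mfn2 (fun z y => b z * (g y * wave k (x - y) z)).
  exact: (mfn2M (mfn2_fst (L1_mfn lb)) (mfn2M (mfn2_snd (L1_mfn lg)) (waveB_mfn2 k x))).
have bh z y : `|b z * (g y * wave k (x - y) z)| <= `|b z| * `|g y|.
  by rewrite normrM ler_wpM2l// normrM ler_piMr// wave_le1.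
have lgz z : L1 (fun y => g y * wave k (x - y) z).
  apply: (L1_dom _ (L1_abs lg)).
    by apply: measurable_funM; [exact: L1_mfn|exact: (mfn2_r z (waveB_mfn2 k x))].
  by move=> y; rewrite normrM ler_piMr// wave_le1.
have e1 : (fun z => b z * Int (fun y => g y * wave k (x - y) z)) = (fun z => Int (fun y => b z * (g y * wave k (x - y) z))).
  by apply/funext => z; rewrite IntZ.
have [l1 _ E] := fubini2 mh (L1_abs lb) (L1_abs lg) bh.
rewrite e1; split; first exact: l1.
rewrite E; congr Int; apply/funext => y.
rewrite -IntZ; last exact: L1_wave.
by congr Int; apply/funext => z; rewrite waveC mulrCA.
Qed.

Lemma sym_nice h l (a : V * V -> R) A x : symB h l a A -> nice (fun z => a (x, z)).
Proof.
move=> sa; have [ca ja _] := sa; split.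
  apply: (cts_comp (f := fun z => (x, z)) _ ca).
  by apply: cts_pair; [exact: cts_cst|move=> z; exact: cvg_id].
have [C HC] := indic_box_Pk (0 : V) (2 * l).
have A0 : 0 <= A := sjet_ge0 (ja 0 (Ordinal n0)).
by exists (A * C) => z; rewrite (le_trans (sym_le x z n0 sa))// -mulrA ler_wpM2l.
Qed.

Lemma TopD (a : V * V -> R) h l A k f g x : symB h l a A -> L1 f -> L1 g ->
  Top a k (fun y => f y + g y) x = Top a k f x + Top a k g x.
Proof.
move=> sa lf lg; have la := nice_L1 (sym_nice x sa).
have [l1 _] := wave_swap k x la lf; have [l2 _] := wave_swap k x la lg.
rewrite /Top -IntD//; congr Int; apply/funext => z; rewrite -mulrDr; congr (_ * _).
have lw u : L1 u -> L1 (fun y => u y * wave k (x - y) z).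
  move=> lu; apply: (L1_dom _ (L1_abs lu)).
    by apply: measurable_funM; [exact: L1_mfn|exact: (mfn2_r z (waveB_mfn2 k x))].
  by move=> y; rewrite normrM ler_piMr// wave_le1.
rewrite -IntD; [|exact: lw|exact: lw].
by congr Int; apply/funext => y; rewrite mulrDl.
Qed.

Lemma Top_sum (a : V * V -> R) h l A k (I : Type) (s : seq I) (f : I -> V -> R) x : symB h l a A ->
  (forall i, L1 (f i)) -> Top a k (fun y => \sum_(i <- s) f i y) x = \sum_(i <- s) Top a k (f i) x.
Proof.
move=> sa lf; elim: s => [|i s IH].
  rewrite big_nil /Top (_ : (fun z => _) = (fun=> 0)) ?Int0//.
  apply/funext => z; rewrite (_ : (fun y => _) = (fun=> 0)) ?Int0 ?mulr0//.
  by apply/funext => y; rewrite big_nil mul0r.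
rewrite big_cons -IH -(TopD _ _ sa (lf i) (L1_sum s lf)).
rewrite (_ : (fun y => _) = (fun y => f i y + \sum_(j <- s) f j y)); first by [].
by apply/funext => y; rewrite big_cons.
Qed.

(* Integration by parts in the frequency variable: [y_i - x_i] acts on the
   oscillating kernel as a derivative, which falls on the symbol. *)
Lemma Top_step (a a' : V * V -> R) h l A A' k i c f x : 0 < h ->
  symB h l a A -> symB h l a' A' -> Derz i a a' ->
  L1 f -> L1 (fun y => (y ord0 i - c) / h * f y) ->
  Top a k (fun y => (y ord0 i - c) / h * f y) x =
  (x ord0 i - c) / h * Top a k f x + (2 * pi * h)^-1 * Top a' (k - pi / 2) f x.
Proof.
move=> h0 sa sa' da lf ltf.
have na := sym_nice x sa; have na' := sym_nice x sa'.
have la := nice_L1 na; have la' := nice_L1 na'.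
rewrite /Top (wave_swap k x la ltf).2 (wave_swap k x la lf).2 (wave_swap _ x la' lf).2.
have lsw k' b g : L1 b -> L1 g -> L1 (fun y => g y * Int (fun z => b z * wave k' z (x - y))).
  move=> lb lg; apply: (L1_dom _ (L1Z (Int (fun z => `|b z|)) (L1_abs lg))).
    apply: measurable_funM; first exact: L1_mfn.
    apply: (mfn_Int (h := fun y z => b z * wave k' z (x - y))).
    apply: mfn2M; first exact: (mfn2_snd (L1_mfn lb)).
    have := mfn2_swap (waveB_mfn2 k' x); rewrite (_ : (fun y z => wave k' (x - y) z) = (fun y z => wave k' z (x - y)))//.
    by apply/funext => y; apply/funext => z; rewrite waveC.
  move=> y; rewrite normrM mulrC ler_wpM2r//; apply: Int_abs_le.
  - exact: (L1_mfn (L1_wave _ _ lb)).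
  - exact: L1_abs.
  - by move=> z; rewrite normrM ler_piMr// wave_le1.
rewrite -IntZ; last exact: lsw.
rewrite -IntZ; last exact: lsw.
rewrite -IntD; [|by apply: L1Z; exact: lsw|by apply: L1Z; exact: lsw].
congr Int; apply/funext => y.
have := Int_by_parts (k - pi / 2) (x - y) na na' (da x); rewrite subrK => ->.
rewrite (_ : (x - y) ord0 i = x ord0 i - y ord0 i); last by rewrite !mxE.
have p0 : pi != 0 :> R by rewrite gt_eqF// pi_gt0.
by move: p0; generalize (pi : R) => p p0; field; rewrite p0 gt_eqF.
Qed.

End weights.

Lemma inv2pi (R : realType) : 0 <= (2 * pi : R)^-1 <= 1.
Proof.
have p2 := pi_ge2 R; have p0 := pi_gt0 R.
by rewrite invr_ge0 mulr_ge0 ?(ltW p0)//= invf_le1 ?mulr_gt0//; lra.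
Qed.

Lemma inv2pi_le1 (R : realType) (h : R) : 0 < h -> (2 * pi * h)^-1 * h <= 1.
Proof.
move=> h0; rewrite invfM -mulrA mulVf ?mulr1 ?gt_eqF//.
by have /andP[] := inv2pi R.
Qed.

(** * Powers of the rescaled distance to a center *)

Section weighted_pieces.
Variables (R : realType) (n : nat).
Local Notation V := 'rV[R]_n.
Hypothesis n0 : (0 < n)%N.

Definition rel (c : V) (h : R) (i : 'I_n) (y : V) : R := (y ord0 i - c ord0 i) / h.

Lemma rel_le c h L i x : 0 < h -> box c (L * h) x -> `|rel c h i x| <= L.
Proof. by move=> h0 bx; rewrite /rel normrM normfV (gtr0_norm h0) ler_pdivrMr//; exact: bx. Qed.

Lemma boxbump_mfn (c : V) h : 0 < h -> mfn (boxbump (2 * n) c h).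
Proof.
move=> h0; have [B _ jB] := boxbump_jet R n (2 * n).
by apply: mfn_cont; exact: (sjet_cts (jB (Ordinal n0) c h h0)).
Qed.

Lemma rel_step (a a' : V * V -> R) h l A A' k i c N g x : 0 < h ->
  symB h l a A -> symB h l a' A' -> Derz i a a' ->
  (forall M, (M <= N.+1)%N -> L1 (fun y => rel c h i y ^+ M * g y)) ->
  Top a k (fun y => rel c h i y ^+ N.+1 * g y) x =
  rel c h i x * Top a k (fun y => rel c h i y ^+ N * g y) x +
  (2 * pi * h)^-1 * Top a' (k - pi / 2) (fun y => rel c h i y ^+ N * g y) x.
Proof.
move=> h0 sa sa' da lg.
have e : (fun y => rel c h i y ^+ N.+1 * g y) =
    (fun y => (y ord0 i - c ord0 i) / h * (rel c h i y ^+ N * g y)).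
  by apply/funext => y; rewrite exprS -mulrA.
rewrite e; apply: (Top_step n0 _ _ h0 sa sa' da (lg N (leqnSn N))).
by rewrite -e; exact: (lg _ (leqnn _)).
Qed.

(** Each power of [rel] is moved across the operator by [rel_step]. Where the cutoff in [x] is
    nonzero [rel] is at most [2], and the differentiated symbol has amplitude [A * h], which
    [(2 pi h)^-1] compensates; squaring a sum of two terms gives [2 * 4 + 2 = 10] per step. *)
Lemma iter_L2 : exists2 C, 0 < C &
  forall r D h l c i (g : V -> R) N, 1 < r <= 2 -> 0 < D -> 0 < h -> 0 < l ->
  (forall M, (M <= N)%N -> L1 (fun y => rel c h i y ^+ M * g y)) ->
  L1 (fun y => `|g y| `^ r) -> Int (fun y => `|g y| `^ r) <= D ->
  forall k a A, 0 < A -> jet (Derz i) (symB h l) N h^-1 A a ->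
  L1 (fun x => (boxbump (2 * n) c h x * Top a k (fun y => rel c h i y ^+ N * g y) x) ^+ 2) /\
  Int (fun x => (boxbump (2 * n) c h x * Top a k (fun y => rel c h i y ^+ N * g y) x) ^+ 2) <=
    C * 10 ^+ N * (A ^+ 2 * ((l ^+ n) `^ (2 / r - 1) * D `^ (2 / r))).
Proof.
have [C C0 HC] := piece_L2_base R n0; exists C => //.
move=> r D h l c i g N r12 D0 h0 l0; elim: N => [|N IH] lg lgr gD k a A A0 ja.
  have e : (fun y => rel c h i y ^+ 0 * g y) = g by apply/funext => y; rewrite expr0 mul1r.
  have lg' : L1 g by rewrite -e; exact: lg.
  have [lU IU] := HC r D h l A c k a g r12 D0 h0 l0 A0 (jet_bd ja) lg' lgr gD.
  rewrite e; split; first exact: lU.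
  by apply: (le_trans IU); rewrite le_eqVlt expr0; apply/orP; left; apply/eqP; ring.
have sa := jet_bd ja; have [_ [a' [da ja']]] := ja.
have sa' := jet_bd ja'.
have A'0 : 0 < A / h^-1 by rewrite invrK mulr_gt0.
have lgN M : (M <= N)%N -> L1 (fun y => rel c h i y ^+ M * g y) by move=> MN; apply: lg; exact: leqW.
have [lv Iv] := IH lgN lgr gD k a A A0 (jet_trunc ja).
have [lw Iw] := IH lgN lgr gD (k - pi / 2) a' _ A'0 ja'.
have mU : mfn (fun x => boxbump (2 * n) c h x * Top a k (fun y => rel c h i y ^+ N.+1 * g y) x).
  exact: (measurable_funM (boxbump_mfn c h0) (Top_mfn k n0 l0 sa (lg _ (leqnn _)))).
have [|lU IU] := Int_sqrD (a := 2) (b := (2 * pi * h)^-1) mU _ lv Iv lw Iw.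
  move=> x; rewrite (rel_step k x h0 sa sa' da lg).
  move: (Top a k _ x) (Top a' _ _ x) (_^-1) => u v b; set w := boxbump _ _ _ _.
  have r2 : w = 0 \/ `|rel c h i x| <= 2.
    have [bx|bx] := pselect (box c (2 * h) x); first by right; exact: rel_le.
    by left; rewrite /w boxbump0.
  move: (rel c h i x) w r2 => t w r2.
  have -> : w * (t * u + b * v) = t * (w * u) + b * (w * v) by ring.
  apply: (le_trans (sqrD_le _ _)); rewrite lerD2r ler_wpM2l//.
  rewrite exprMn [leRHS]exprMn; case: r2 => [->|t2]; first by rewrite mul0r expr0n !mulr0.
  apply: ler_wpM2r; first exact: sqr_ge0.
  by rewrite -(real_normK (num_real t)) lerXn2r ?nnegrE.
split; first exact: lU.
apply: (le_trans IU); rewrite invrK.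
move: (_ `^ _ * _ `^ _) (mulr_ge0 (powR_ge0 (l ^+ n) (2 / r - 1)) (powR_ge0 D (2 / r))) => X X0.
have b0 : 0 <= (2 * pi * h)^-1 by rewrite invr_ge0 !mulr_ge0 ?pi_ge0// ltW.
have b1 := inv2pi_le1 h0.
have Y0 : 0 <= C * 10 ^+ N * (A ^+ 2 * X) by rewrite !mulr_ge0 ?sqr_ge0 ?exprn_ge0// ltW.
move: b0 b1; move: ((2 * pi * h)^-1) => b b0 b1.
rewrite (_ : _ + _ = (8 + 2 * (b * h) ^+ 2) * (C * 10 ^+ N * (A ^+ 2 * X))); last by ring.
rewrite (_ : C * 10 ^+ N.+1 * (A ^+ 2 * X) = 10 * (C * 10 ^+ N * (A ^+ 2 * X))); last by rewrite exprS; ring.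
apply: ler_wpM2r; first exact: Y0.
have bh : (b * h) ^+ 2 <= 1 by rewrite exprn_ile1// mulr_ge0// ltW.
by move: ((b * h) ^+ 2) bh => q q1; clear -q1; lra.
Qed.

(** The induction of [iter_L2] for differences. Three terms per step, from varying [rel], the
    operator, and the operator of the differentiated symbol; the variation of [rel] is at most
    [e / h <= e * l]. *)
Lemma iter_osc : exists2 C, 0 < C &
  forall r D h l c i (g : V -> R) N, 1 < r <= 2 -> 0 < D -> 0 < h -> 0 < l -> h^-1 <= l ->
  (forall M, (M <= N)%N -> L1 (fun y => rel c h i y ^+ M * g y)) ->
  L1 (fun y => `|g y| `^ r) -> Int (fun y => `|g y| `^ r) <= D ->
  forall k a A, 0 < A -> jet (Derz i) (symB h l) N h^-1 A a ->
  let T x := Top a k (fun y => rel c h i y ^+ N * g y) x in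
  let B := C * 3 ^+ N * (A * (l ^+ n * D) `^ r^-1) in
  (forall x, box c h x -> `|T x| <= B) /\
  (forall (x x' : V) e, box c h x -> box c h x' -> (forall j, `|x ord0 j - x' ord0 j| <= e) ->
    `|T x - T x'| <= B * (e * l)).
Proof.
have [C C0 HC] := piece_osc_base R n0; exists C => //.
move=> r D h l c i g N r12 D0 h0 l0 hl; elim: N => [|N IH] lg lgr gD k a A A0 ja.
  have e : (fun y => rel c h i y ^+ 0 * g y) = g by apply/funext => y; rewrite expr0 mul1r.
  have lg' : L1 g by rewrite -e; exact: lg.
  have [H1 H2] := HC r D h l A k a g r12 D0 h0 l0 hl A0 (jet_bd ja) lg' lgr gD.
  rewrite /= e expr0 mulr1 mulrA; split; first by move=> x _; exact: H1.
  by move=> x x' d _ _; exact: H2.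
have sa := jet_bd ja; have [_ [a' [da ja']]] := ja.
have sa' := jet_bd ja'.
have A'0 : 0 < A / h^-1 by rewrite invrK mulr_gt0.
have lgN M : (M <= N)%N -> L1 (fun y => rel c h i y ^+ M * g y) by move=> MN; apply: lg; exact: leqW.
have [v1 v2] := IH lgN lgr gD k a A A0 (jet_trunc ja).
have [w1 w2] := IH lgN lgr gD (k - pi / 2) a' _ A'0 ja'.
have E x := rel_step k x h0 sa sa' da lg.
rewrite /=; move: v1 v2 w1 w2 E; rewrite invrK.
move: (Top a k (fun y => rel c h i y ^+ N * g y)) (Top a' (k - pi / 2) (fun y => rel c h i y ^+ N * g y)).
move: (Top a k (fun y => rel c h i y ^+ N.+1 * g y)) => T' u v v1 v2 w1 w2 E.
set S := (_ `^ _) in v1 v2 w1 w2 *; have S0 : 0 <= S := powR_ge0 _ _.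
set b := (2 * pi * h)^-1 in E; have b0 : 0 <= b by rewrite invr_ge0 !mulr_ge0 ?pi_ge0// ltW.
have bh : b * h <= 1 by exact: inv2pi_le1.
clearbody S b.
pose Y := C * 3 ^+ N * (A * S).
have Y0 : 0 <= Y by rewrite !mulr_ge0 ?exprn_ge0// ltW.
have YE : C * 3 ^+ N * (A * h * S) = h * Y by rewrite /Y; ring.
have YE' : C * 3 ^+ N.+1 * (A * S) = 3 * Y by rewrite /Y exprS; ring.
rewrite YE in w1 w2; rewrite YE' -/Y in v1 v2 *; rewrite -/Y in v1 v2.
clearbody Y.
have rel1 x : box c h x -> `|rel c h i x| <= 1.
  by move=> bx; apply: rel_le => //; rewrite mul1r.
have bw x : box c h x -> `|b * v x| <= Y.
  move=> bx; rewrite normrM (ger0_norm b0); apply: (@le_trans _ _ (b * (h * Y))).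
    by rewrite ler_wpM2l// w1.
  by rewrite mulrA ler_piMl.
split.
  move=> x bx; rewrite E (le_trans (ler_normD _ _))//.
  have t1 : `|rel c h i x * u x| <= Y.
    by rewrite normrM (le_trans _ (v1 x bx))// ler_piMl// rel1.
  apply: (le_trans (lerD t1 (bw x bx))).
  by clear -Y0; lra.
move=> x x' e bx bx' xe; rewrite !E.
have e0 : 0 <= e := le_trans (normr_ge0 _) (xe (Ordinal n0)).
have el0 : 0 <= e * l by rewrite mulr_ge0// ltW.
rewrite (_ : _ - _ = rel c h i x * (u x - u x') + (rel c h i x - rel c h i x') * u x' + b * (v x - v x')); last by ring.
have t1 : `|rel c h i x * (u x - u x')| <= Y * (e * l).
  by rewrite normrM (le_trans _ (v2 _ _ _ bx bx' xe))// ler_piMl// rel1.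
have t2 : `|(rel c h i x - rel c h i x') * u x'| <= Y * (e * l).
  rewrite normrM mulrC; apply: ler_pM => //; first exact: v1.
  rewrite /rel -mulrBl normrM normfV (gtr0_norm h0) opprB addrA subrK.
  by apply: ler_pM => //; rewrite invr_ge0 ltW.
have t3 : `|b * (v x - v x')| <= Y * (e * l).
  rewrite normrM (ger0_norm b0); apply: (@le_trans _ _ (b * (h * Y * (e * l)))).
    by rewrite ler_wpM2l// w2.
  by rewrite !mulrA -[leRHS]mulrA -[leLHS]mulrA ler_wpM2r// ler_piMl.
apply: (le_trans (ler_normD _ _)); apply: (le_trans (lerD (ler_normD _ _) (lexx _))).
apply: (le_trans (lerD (lerD t1 t2) t3)).
by rewrite le_eqVlt; apply/orP; left; apply/eqP; ring.
Qed.

End weighted_pieces.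

(** * Weighted bounds for one frequency piece *)

Section pieces.
Variables (R : realType) (n : nat).
Local Notation V := 'rV[R]_n.
Hypothesis n0 : (0 < n)%N.

(** A polynomial weight, so that multiplying by it is a finite sum of coordinate powers, each of
    which [rel_step] can move across the operator; the even exponent keeps it positive. *)
Definition wt (c : V) (h : R) (y : V) : R := 1 + \sum_(i < n) rel c h i y ^+ (4 * n).

Lemma even4 (t : R) : 0 <= t ^+ (4 * n).
Proof. by rewrite exprn_even_ge0// oddM. Qed.

Lemma wt_ge1 c h y : 1 <= wt c h y.
Proof. by rewrite lerDl sumr_ge0// => i _; exact: even4. Qed.

Lemma wt_gt0 c h y : 0 < wt c h y.
Proof. exact: lt_le_trans ltr01 (wt_ge1 c h y). Qed.

Lemma wt_ge c h y i M : (M <= 4 * n)%N -> `|rel c h i y| ^+ M <= wt c h y.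
Proof.
move=> MK; apply: (@le_trans _ _ (1 + rel c h i y ^+ (4 * n))); last first.
  by rewrite lerD2l (bigD1 i)//= lerDl sumr_ge0// => j _; exact: even4.
have [t1|t1] := leP `|rel c h i y| 1.
  by rewrite (le_trans (exprn_ile1 _ _ _))// lerDl even4.
rewrite -[rel c h i y ^+ (4 * n)]ger0_norm ?even4// normrX.
by rewrite (le_trans (ler_weXn2l (ltW t1) MK))// lerDr.
Qed.

Lemma rel_cts c h i : continuous (rel c h i : V -> R).
Proof.
by apply: ctsM; [apply: ctsB; [exact: coord_cont|exact: cts_cst]|exact: cts_cst].
Qed.

Lemma ctsX (X : topologicalType) (f : X -> R) p : continuous f -> continuous (fun x => f x ^+ p).
Proof. by move=> cf; exact: (cts_comp cf (@exprn_continuous R p)). Qed.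

Lemma ctsV (X : topologicalType) (f : X -> R) : continuous f -> (forall x, f x != 0) ->
  continuous (fun x => (f x)^-1).
Proof. by move=> cf f0 x; apply: cvgV; [exact: f0|exact: cf]. Qed.

Lemma wt_cts c h : continuous (wt c h : V -> R).
Proof.
apply: ctsD; first exact: cts_cst.
by apply: continuous_sum => i; apply: ctsX; exact: rel_cts.
Qed.

Lemma wtV_cts c h : continuous (fun y : V => (wt c h y)^-1).
Proof. by apply: ctsV; [exact: wt_cts|move=> y; rewrite gt_eqF// wt_gt0]. Qed.

Lemma weighted_L1 c h f : L1 f -> forall i M, (M <= 4 * n)%N ->
  L1 (fun y : V => rel c h i y ^+ M * (f y / wt c h y)).
Proof.
move=> lf i M MK; apply: (L1_dom _ (L1_abs lf)).
  have m1 : mfn (fun y : V => rel c h i y ^+ M) by apply: mfn_cont; apply: ctsX; exact: rel_cts.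
  exact: (measurable_funM m1 (measurable_funM (L1_mfn lf) (mfn_cont (@wtV_cts c h)))).
move=> y; rewrite mulrCA normrM ler_piMr// normrM normrX normfV (gtr0_norm (wt_gt0 c h y)).
by rewrite ler_pdivrMr ?wt_gt0// mul1r wt_ge.
Qed.

Lemma weighted_pow r c h f D : 1 < r -> L1 (fun y : V => `|f y| `^ r) -> mfn f ->
  Int (fun y => `|f y| `^ r / wt c h y) <= D ->
  L1 (fun y => `|f y / wt c h y| `^ r) /\ Int (fun y => `|f y / wt c h y| `^ r) <= D.
Proof.
move=> r1 lfr mf fD.
have r0 : 0 < r by exact: lt_trans ltr01 r1.
have b y : `|f y / wt c h y| `^ r <= `|f y| `^ r / wt c h y.
  rewrite normrM normfV (gtr0_norm (wt_gt0 c h y)) powRM ?invr_ge0 ?(ltW (wt_gt0 c h y))//.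
  rewrite ler_wpM2l ?powR_ge0// -[leRHS]powRr1 ?invr_ge0 ?(ltW (wt_gt0 c h y))//.
  by rewrite ger_powR ?(ltW r1)// invr_gt0 wt_gt0/= invf_le1 ?wt_gt0// wt_ge1.
have l1 : L1 (fun y => `|f y| `^ r / wt c h y).
  apply: (L1_dom _ lfr).
    exact: (measurable_funM (L1_mfn lfr) (mfn_cont (@wtV_cts c h))).
  move=> y; rewrite normrM (ger0_norm (powR_ge0 _ _)) ler_piMr ?powR_ge0//.
  by rewrite normfV (gtr0_norm (wt_gt0 c h y)) invf_le1 ?wt_gt0// wt_ge1.
have l2 : L1 (fun y => `|f y / wt c h y| `^ r).
  apply: (L1_dom _ l1); last by move=> y; rewrite ger0_norm ?powR_ge0.
  apply: (measurableT_comp (f := fun t : R => t `^ r)); first exact: measurable_powR.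
  apply: measurableT_comp => //.
  exact: (measurable_funM mf (mfn_cont (@wtV_cts c h))).
by split=> //; exact: (le_trans (Int_le l2 l1 b)).
Qed.

Lemma weight_split c h f (y : V) :
  f y = f y / wt c h y + \sum_(i < n) rel c h i y ^+ (4 * n) * (f y / wt c h y).
Proof.
rewrite -mulr_suml -[X in _ = X + _]mul1r -mulrDl -/(wt c h y).
by rewrite mulrC divfK// gt_eqF// wt_gt0.
Qed.

Lemma Int_sqr_sum (I : Type) (s : seq I) (u : I -> V -> R) E : 0 <= E ->
  (forall i, mfn (u i)) -> (forall i, L1 (fun x => u i x ^+ 2)) ->
  (forall i, Int (fun x => u i x ^+ 2) <= E) ->
  L1 (fun x => (\sum_(i <- s) u i x) ^+ 2) /\
  Int (fun x => (\sum_(i <- s) u i x) ^+ 2) <= 4 ^+ size s * E.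
Proof.
move=> E0 mu lu uE.
have ms (r : seq I) : mfn (fun x => \sum_(i <- r) u i x) by apply: measurable_sum.
elim: s => [|i s [l1 I1]].
  have e : (fun x : V => (\sum_(i <- [::]) u i x) ^+ 2) = (fun=> 0).
    by apply/funext => x; rewrite big_nil expr0n.
  by rewrite e Int0; split; [exact: L1_cst0|rewrite mul1r].
have e : (fun x : V => (\sum_(j <- i :: s) u j x) ^+ 2) = (fun x => (u i x + \sum_(j <- s) u j x) ^+ 2).
  by apply/funext => x; rewrite big_cons.
rewrite e.
have mm : mfn (fun x => u i x + \sum_(j <- s) u j x) by exact: (measurable_funD (mu i) (ms s)).
have [|l2 I2] := Int_sqrD (a := 1) (b := 1) mm _ (lu i) (uE i) l1 I1.
  by move=> x; rewrite [1 * u i x]mul1r [1 * \sum_(_ <- _) _]mul1r; exact: sqrD_le.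
split; first exact: l2.
apply: (le_trans I2); rewrite expr1n mulr1 exprS.
have X1 : 1 <= 4 ^+ size s :> R by rewrite exprn_ege1// ler1n.
by clear -E0 X1; move: (4 ^+ size s) X1 => X X1; nra.
Qed.

(** With [g = f / wt], the function [f] is [g] plus the terms [rel ^ (4 n) * g]. By [iter_L2] the
    operator applied to each of them is controlled by the L^r norm of [g] alone, and
    [|g| ^ r <= |f| ^ r / wt] because [wt >= 1] and [r > 1]. *)
Lemma piece_L2 : exists2 C, 0 < C &
  forall r D h l A c k (a : V * V -> R) f, 1 < r <= 2 -> 0 < D -> 0 < h -> 0 < l -> 0 < A ->
  (forall i, jet (Derz i) (symB h l) (4 * n) h^-1 A a) ->
  L1 f -> L1 (fun y => `|f y| `^ r) -> Int (fun y => `|f y| `^ r / wt c h y) <= D ->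
  L1 (fun x => (boxbump (2 * n) c h x * Top a k f x) ^+ 2) /\
  Int (fun x => (boxbump (2 * n) c h x * Top a k f x) ^+ 2) <=
    C * (A ^+ 2 * ((l ^+ n) `^ (2 / r - 1) * D `^ (2 / r))).
Proof.
have [C C0 HC] := iter_L2 R n0.
have C'0 : 0 < C * 10 ^+ (4 * n) by rewrite mulr_gt0// exprn_gt0.
exists (2 * (C * 10 ^+ (4 * n)) + 2 * (4 ^+ n * (C * 10 ^+ (4 * n)))).
  by rewrite addr_gt0// !mulr_gt0// exprn_gt0.
move=> r D h l A c k a f r12 D0 h0 l0 A0 ja lf lfr fD.
have /andP[r1 _] := r12.
pose g y := f y / wt c h y.
have lg i M : (M <= 4 * n)%N -> L1 (fun y => rel c h i y ^+ M * g y) by exact: weighted_L1.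
have [lgr gD] := weighted_pow r1 lfr (L1_mfn lf) fD.
pose i0 := Ordinal n0.
have sa := jet_bd (ja i0).
have lg0 : L1 g.
  have := lg i0 0 (leq0n _); rewrite (_ : (fun y => rel c h i0 y ^+ 0 * g y) = g)//.
  by apply/funext => y; rewrite expr0 mul1r.
pose X := A ^+ 2 * ((l ^+ n) `^ (2 / r - 1) * D `^ (2 / r)).
have X0 : 0 <= X by apply: mulr_ge0; [exact: sqr_ge0|exact: (mulr_ge0 (powR_ge0 _ _) (powR_ge0 _ _))].
have H i := HC r D h l c i g (4 * n)%N r12 D0 h0 l0 (lg i) lgr gD k a A A0 (ja i).
have [l0' I0'] : L1 (fun x => (boxbump (2 * n) c h x * Top a k g x) ^+ 2) /\
    Int (fun x => (boxbump (2 * n) c h x * Top a k g x) ^+ 2) <= C * 10 ^+ (4 * n) * X.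
  have j0 : jet (Derz i0) (symB h l) 0 h^-1 A a by split.
  have lg00 M : (M <= 0)%N -> L1 (fun y => rel c h i0 y ^+ M * g y).
    by rewrite leqn0 => /eqP ->; exact: lg.
  have := HC r D h l c i0 g 0 r12 D0 h0 l0 lg00 lgr gD k a A A0 j0.
  rewrite (_ : (fun y => rel c h i0 y ^+ 0 * g y) = g); last by apply/funext => y; rewrite expr0 mul1r.
  move=> [? I']; split; first by [].
  apply: (le_trans I'); rewrite ler_wpM2r// expr0 mulr1 ler_peMr ?(ltW C0)//.
  by rewrite exprn_ege1// ler1n.
pose u i x := boxbump (2 * n) c h x * Top a k (fun y => rel c h i y ^+ (4 * n) * g y) x.
have mu i : mfn (u i).
  exact: (measurable_funM (boxbump_mfn n0 c h0) (Top_mfn k n0 l0 sa (lg i _ (leqnn _)))).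
have E0 : 0 <= C * 10 ^+ (4 * n) * X by rewrite mulr_ge0// ltW.
have [l1' I1'] := Int_sqr_sum (index_enum 'I_n) E0 mu (fun i => (H i).1) (fun i => (H i).2).
have mU : mfn (fun x => boxbump (2 * n) c h x * Top a k f x).
  exact: (measurable_funM (boxbump_mfn n0 c h0) (Top_mfn k n0 l0 sa lf)).
have TE x : boxbump (2 * n) c h x * Top a k f x =
    boxbump (2 * n) c h x * Top a k g x + \sum_(i < n) u i x.
  rewrite /u -mulr_sumr -mulrDr; congr (_ * _).
  have lgi i : L1 (fun y => rel c h i y ^+ (4 * n) * g y) by exact: lg.
  rewrite -(Top_sum n0 k _ x sa lgi) -(TopD n0 k x sa lg0 (L1_sum _ lgi)).
  have fE : f = (fun y => g y + \sum_(i < n) rel c h i y ^+ (4 * n) * g y).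
    by apply/funext => y; exact: weight_split.
  by rewrite -fE.
have [|lU IU] := Int_sqrD (a := 1) (b := 1) mU _ l0' I0' l1' I1'.
  by move=> x; rewrite TE [1 * (_ * _)]mul1r [1 * \sum_(_ < _) _]mul1r; exact: sqrD_le.
split; first exact: lU.
apply: (le_trans IU).
rewrite -/X expr1n mulr1 (_ : size _ = n); last by rewrite -[index_enum _]enumT size_enum_ord.
by rewrite le_eqVlt; apply/orP; left; apply/eqP; clear; move: X (10 ^+ _) (4 ^+ _) => *; ring.
Qed.

Lemma piece_osc : exists2 C, 0 < C &
  forall r D h l A c k (a : V * V -> R) f, 1 < r <= 2 -> 0 < D -> 0 < h -> 0 < l -> h^-1 <= l -> 0 < A ->
  (forall i, jet (Derz i) (symB h l) (4 * n) h^-1 A a) ->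
  L1 f -> L1 (fun y => `|f y| `^ r) -> Int (fun y => `|f y| `^ r / wt c h y) <= D ->
  forall (x x' : V) e, box c h x -> box c h x' -> (forall j, `|x ord0 j - x' ord0 j| <= e) ->
    `|Top a k f x - Top a k f x'| <= C * (A * (l ^+ n * D) `^ r^-1) * (e * l).
Proof.
have [C C0 HC] := iter_osc R n0.
have C'0 : 0 < C * 3 ^+ (4 * n) by rewrite mulr_gt0// exprn_gt0.
exists (C * 3 ^+ (4 * n) + n%:R * (C * 3 ^+ (4 * n))).
  by rewrite ltr_wpDr// mulr_ge0// ltW.
move=> r D h l A c k a f r12 D0 h0 l0 hl A0 ja lf lfr fD x x' e bx bx' xe.
have /andP[r1 _] := r12.
pose g y := f y / wt c h y.
have lg i M : (M <= 4 * n)%N -> L1 (fun y => rel c h i y ^+ M * g y) by exact: weighted_L1.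
have [lgr gD] := weighted_pow r1 lfr (L1_mfn lf) fD.
pose i0 := Ordinal n0.
have sa := jet_bd (ja i0).
have lg0 : L1 g.
  have := lg i0 0 (leq0n _); rewrite (_ : (fun y => rel c h i0 y ^+ 0 * g y) = g)//.
  by apply/funext => y; rewrite expr0 mul1r.
have e0 : 0 <= e := le_trans (normr_ge0 _) (xe i0).
pose X := A * (l ^+ n * D) `^ r^-1 * (e * l).
have X0 : 0 <= X by rewrite !mulr_ge0 ?powR_ge0// ltW.
have H i : `|Top a k (fun y => rel c h i y ^+ (4 * n) * g y) x -
    Top a k (fun y => rel c h i y ^+ (4 * n) * g y) x'| <= C * 3 ^+ (4 * n) * X.
  have [_ H] := HC r D h l c i g (4 * n)%N r12 D0 h0 l0 hl (lg i) lgr gD k a A A0 (ja i).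
  by rewrite /X mulrA; exact: H.
have H0 : `|Top a k g x - Top a k g x'| <= C * 3 ^+ (4 * n) * X.
  have j0 : jet (Derz i0) (symB h l) 0 h^-1 A a by split.
  have lg00 M : (M <= 0)%N -> L1 (fun y => rel c h i0 y ^+ M * g y).
    by rewrite leqn0 => /eqP ->; exact: lg.
  have := HC r D h l c i0 g 0 r12 D0 h0 l0 hl lg00 lgr gD k a A A0 j0.
  rewrite (_ : (fun y => rel c h i0 y ^+ 0 * g y) = g); last by apply/funext => y; rewrite expr0 mul1r.
  move=> [_ H']; apply: (le_trans (H' _ _ _ bx bx' xe)).
  rewrite -mulrA -/X ler_wpM2r// expr0 mulr1 ler_peMr ?(ltW C0)//.
  by rewrite exprn_ege1// ler1n.
have TE z : Top a k f z = Top a k g z + \sum_(i < n) Top a k (fun y => rel c h i y ^+ (4 * n) * g y) z.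
  have lgi i : L1 (fun y => rel c h i y ^+ (4 * n) * g y) by exact: lg.
  rewrite -(Top_sum n0 k _ z sa lgi) -(TopD n0 k z sa lg0 (L1_sum _ lgi)).
  have fE : f = (fun y => g y + \sum_(i < n) rel c h i y ^+ (4 * n) * g y).
    by apply/funext => y; exact: weight_split.
  by rewrite -fE.
rewrite !TE opprD addrACA -sumrB (le_trans (ler_normD _ _))//.
rewrite [leRHS](_ : _ = C * 3 ^+ (4 * n) * X + n%:R * (C * 3 ^+ (4 * n) * X)); last first.
  by rewrite /X; clear; move: (_ `^ _) (3 ^+ _) => *; ring.
apply: lerD; first exact: H0.
rewrite (le_trans (ler_norm_sum _ _ _))// (le_trans (ler_sum _ (fun i _ => H i)))//.
by rewrite sumr_const card_ord -[X in X <= _]mulr_natl.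
Qed.

End pieces.

(** * Control by the maximal function *)

Transparent Pk.

Lemma geom_half (R : realType) (K : nat) : \sum_(k < K.+1) 2^-1 ^+ k = 2 - 2^-1 ^+ K :> R.
Proof.
elim: K => [|K IH]; first by rewrite big_ord_recr big_ord0 /= expr0; lra.
by rewrite big_ord_recr /= IH exprS; lra.
Qed.

Section maximal.
Variables (R : realType) (n : nat).
Local Notation V := 'rV[R]_n.
Hypothesis n0 : (0 < n)%N.

(** Half the exponent of [wt], still integrable after inversion, so that [wt] can dominate a product
    of two such weights. *)
Definition wt2 (c : V) (h : R) (y : V) : R := 1 + \sum_(i < n) rel c h i y ^+ (2 * n).

Lemma even2 (t : R) : 0 <= t ^+ (2 * n).
Proof. by rewrite exprn_even_ge0// oddM. Qed.

Lemma wt2_ge1 c h y : 1 <= wt2 c h y.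
Proof. by rewrite lerDl sumr_ge0// => i _; exact: even2. Qed.

Lemma wt2_gt0 c h y : 0 < wt2 c h y.
Proof. exact: lt_le_trans ltr01 (wt2_ge1 c h y). Qed.

Lemma wt2_ge c h y i : `|rel c h i y| ^+ (2 * n) <= wt2 c h y.
Proof.
rewrite -normrX ger0_norm ?even2// /wt2 (bigD1 i)//= addrCA lerDl addr_ge0// sumr_ge0// => j _.
exact: even2.
Qed.

Lemma wt2V_mfn c h : mfn (fun y : V => (wt2 c h y)^-1).
Proof.
apply: mfn_cont; apply: ctsV; last by move=> y; rewrite gt_eqF// wt2_gt0.
apply: ctsD; first exact: cts_cst.
by apply: continuous_sum => i; apply: ctsX; exact: rel_cts.
Qed.

Definition supn (c : V) (h : R) (y : V) : R := \big[Num.max/1]_(i < n) `|rel c h i y|.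

Lemma supn_ge1 c h y : 1 <= supn c h y.
Proof. by rewrite /supn; elim/big_rec: _ => // i x _ x1; rewrite le_max x1 orbT. Qed.

Lemma supn_ge c h y i : `|rel c h i y| <= supn c h y.
Proof. by rewrite /supn (bigD1 i)//= le_max lexx. Qed.

Lemma supn_attained c h y : supn c h y = 1 \/ exists i, supn c h y = `|rel c h i y|.
Proof.
rewrite /supn; elim/big_rec: _ => [|i x _ H]; first by left.
by case: (leP `|rel c h i y| x) => _; [exact: H|right; exists i].
Qed.

Lemma supn_le_wt2 c h y : supn c h y ^+ (2 * n) <= wt2 c h y.
Proof.
by have [->|[i ->]] := supn_attained c h y; [rewrite expr1n wt2_ge1|exact: wt2_ge].
Qed.

Lemma supn_le_wt c h y : supn c h y ^+ (4 * n) <= wt c h y.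
Proof.
by have [->|[i ->]] := supn_attained c h y; [rewrite expr1n wt_ge1|exact: wt_ge].
Qed.

Lemma wt2_le_supn c h y : wt2 c h y <= (1 + n%:R) * supn c h y ^+ (2 * n).
Proof.
have s1 := supn_ge1 c h y.
rewrite mulrDl mul1r; apply: lerD; first by rewrite exprn_ege1.
apply: (@le_trans _ _ (\sum_(i < n) supn c h y ^+ (2 * n))); last first.
  by rewrite sumr_const card_ord mulr_natl.
apply: ler_sum => i _; rewrite -[leLHS]ger0_norm ?even2// normrX.
by rewrite lerXn2r ?nnegrE ?supn_ge// (le_trans ler01).
Qed.

(** Each factor [1 + t_i ^ 2] of the inverse kernel is at most twice the square of [supn], and [wt2]
    dominates [supn ^ (2 n)]. *)
Lemma wt2V_Pk c h y : 0 < h -> (wt2 c h y)^-1 <= 2 ^+ n * Pk h^-1 (y - c).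
Proof.
move=> h0; rewrite -[leLHS]mul1r ler_pdivrMr ?wt2_gt0//.
have P0 : 0 < \prod_(i < n) (1 + (h^-1 * (y - c) ord0 i) ^+ 2).
  by apply: prodr_gt0 => i _; rewrite ltr_pwDl// sqr_ge0.
rewrite /Pk prodfV mulrAC ler_pdivlMr// mul1r.
apply: (@le_trans _ _ (2 ^+ n * supn c h y ^+ (2 * n))); last by rewrite ler_wpM2l ?supn_le_wt2// exprn_ge0.
rewrite exprM -exprMn -[X in _ <= _ ^+ X](card_ord n) -prodr_const.
apply: ler_prod => i _; rewrite addr_ge0 ?sqr_ge0//=.
have s1 := supn_ge1 c h y; have si := supn_ge c h y i.
have -> : (h^-1 * (y - c) ord0 i) ^+ 2 = `|rel c h i y| ^+ 2.
  by rewrite real_normK ?num_real// /rel mulrC !mxE.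
have := normr_ge0 (rel c h i y); move: (supn c h y) (`|rel c h i y|) s1 si => s t; clear.
nra.
Qed.

(* For an average over centers [c] the weight has to keep, besides the integrable
   factor centered at [c], one centered at the fixed point [c']. *)
Lemma wtV_split c h c' l y : 0 < h -> h <= l -> box c' (2 * l) c ->
  (wt c h y)^-1 <= (1 + n%:R) ^+ 2 * 9 ^+ n * ((wt2 c h y)^-1 * (wt2 c' l y)^-1).
Proof.
move=> h0 hl bc; have l0 : 0 < l := lt_le_trans h0 hl.
rewrite -invfM ler_pdivlMr ?mulr_gt0 ?wt2_gt0// mulrC ler_pdivrMr ?wt_gt0//.
have s1 := supn_ge1 c h y.
(* Passing from scale [h] to [l >= h] only shrinks the rescaled distance, and moving the center adds
   at most [2], which is at most [2 * supn]. Raised to the power [2 n] this [3] gives [9 ^ n]. *)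
have s3 : supn c' l y <= 3 * supn c h y.
  have [->|[i ->]] := supn_attained c' l y; first by lra.
  have si := supn_ge c h y i.
  have -> : rel c' l i y = rel c h i y * (h / l) + (c ord0 i - c' ord0 i) / l.
    by rewrite /rel; field; rewrite !gt_eqF.
  have t1 : `|rel c h i y * (h / l)| <= supn c h y.
    rewrite normrM (le_trans _ si)// ler_piMr// ger0_norm ?divr_ge0 ?(ltW h0) ?(ltW l0)//.
    by rewrite ler_pdivrMr// mul1r.
  have t2 : `|(c ord0 i - c' ord0 i) / l| <= 2.
    by rewrite normrM normfV (gtr0_norm l0) ler_pdivrMr//; exact: bc.
  apply: (le_trans (ler_normD _ _)); apply: (le_trans (lerD t1 t2)); lra.
apply: (@le_trans _ _ ((1 + n%:R) * supn c h y ^+ (2 * n) * ((1 + n%:R) * (3 * supn c h y) ^+ (2 * n)))).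
  apply: ler_pM; rewrite ?(ltW (wt2_gt0 _ _ _))// ?wt2_le_supn//.
  apply: (le_trans (wt2_le_supn _ _ _)); rewrite ler_wpM2l ?addr_ge0//.
  by rewrite lerXn2r ?nnegrE ?mulr_ge0// (le_trans ler01)// supn_ge1.
rewrite [leLHS](_ : _ = (1 + n%:R) ^+ 2 * 9 ^+ n * supn c h y ^+ (4 * n)); last first.
  rewrite exprMn [3 ^+ _]exprM (_ : 3 ^+ 2 = 9 :> R); last by ring.
  rewrite (_ : (4 * n = 2 * n + 2 * n)%N); last by rewrite -mulnDl.
  by rewrite exprD; ring.
by rewrite ler_wpM2l ?supn_le_wt// mulr_ge0 ?exprn_ge0// addr_ge0.
Qed.

(** With [F = |f| ^ r], this says that the [r]-th power of the maximal function at [x0] is at most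
    [Q], in real numbers and without a supremum. *)
Definition maxbound (F : V -> R) (x0 : V) (Q : R) := forall (a : V) l, 0 < l -> cube a l x0 ->
  Int (fun y => \1_(cube a l) y * F y) <= l ^+ n * Q.

Lemma indic_mfn (a : V) l : mfn (\1_(cube a l) : V -> R).
Proof.
have [l0|l0] := leP 0 l; first exact: (L1_mfn (L1_cube a l0).1).
rewrite (_ : \1_(cube a l) = (fun=> 0)); first by apply: mfn_cont; exact: cts_cst.
apply/funext => y; rewrite indicE memNset// => /(_ (Ordinal n0)) /andP[y1 y2].
have := le_trans y1 y2; rewrite lerDl leNgt => /negP; exact.
Qed.

(** The inverse weight is at most a finite sum over the concentric boxes of half side [2 ^ k h] plus
    a constant tail. Outside the [k]-th box it is at most [4 ^ (- n k)], which beats the volume. In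
    the constant, [4 ^ n] comes from passing to the next smaller box, [2 ^ n] from half sides, and
    [2] from the geometric series. *)
Lemma max_wt2 (F : V -> R) x0 Q c h : 0 <= Q -> 0 < h -> L1 F -> (forall y, 0 <= F y) ->
  maxbound F x0 Q -> box c h x0 ->
  Int (fun y => F y / wt2 c h y) <= 4 ^+ n * 2 ^+ n * 2 * (h ^+ n * Q).
Proof.
move=> Q0 h0 lF F0 HM bx.
pose B k := box c (2 ^+ k * h).
have p2 k : 0 < 2 ^+ k :> R by rewrite exprn_gt0.
have pw K y : (wt2 c h y)^-1 <= \sum_(k < K.+1) 4 ^+ n * (4 ^+ n) ^- k * \1_(B k) y + (4 ^+ n) ^- K.
  have T0 : 0 <= \sum_(k < K.+1) 4 ^+ n * (4 ^+ n) ^- k * \1_(B k) y :> R.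
    by apply: sumr_ge0 => k _; rewrite !mulr_ge0 ?invr_ge0 ?exprn_ge0// indicE.
  have out k : ~ B k y -> (wt2 c h y)^-1 <= (4 ^+ n) ^- k.
    move=> /existsNP[i /negP]; rewrite -ltNge => yi.
    rewrite lef_pV2 ?posrE ?wt2_gt0 ?exprn_gt0//; apply: le_trans (wt2_ge c h y i).
    rewrite -exprM mulnC (_ : 4 = 2 ^+ 2 :> R); last by rewrite expr2; ring.
    rewrite -exprM mulnCA exprM lerXn2r ?nnegrE ?(ltW (p2 k))//.
    by rewrite /rel normrM normfV (gtr0_norm h0) ler_pdivlMr// ltW.
  have [yK|yK] := pselect (B K y); last by rewrite (le_trans (out K yK))// lerDr.
  have ex : exists k, `[< B k y >] by exists K; apply/asboolP.
  have [j /asboolP yj jmin] := ex_minnP ex.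
  have jK : (j < K.+1)%N by rewrite ltnS; apply: jmin; apply/asboolP.
  apply: (@le_trans _ _ (4 ^+ n * (4 ^+ n) ^- j)).
    case: j yj jmin jK => [|j] yj jmin jK.
      rewrite expr0 invr1 mulr1 (@le_trans _ _ 1)//; last by rewrite exprn_ege1// ler1n.
      by rewrite invf_le1 ?wt2_gt0// wt2_ge1.
    rewrite exprS invfM mulrA divff ?mul1r ?gt_eqF ?exprn_gt0//.
    by apply: out => Bj; have /asboolP/(jmin j) := Bj; rewrite ltnn.
  rewrite (bigD1 (Ordinal jK))//= -addrA indicE mem_set// mulr1 lerDl addr_ge0 ?invr_ge0 ?exprn_ge0//.
  by apply: sumr_ge0 => k _; rewrite !mulr_ge0 ?invr_ge0 ?exprn_ge0// indicE.
have lB k : L1 (fun y => \1_(B k) y * F y).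
  apply: (L1_dom _ lF).
    by rewrite /B box_cube; apply: measurable_funM; [exact: indic_mfn|exact: L1_mfn].
  by move=> y; rewrite normrM (ger0_norm (F0 y)) ler_piMl// indicE; case: (y \in _); rewrite ?normr0 ?normr1.
have IB k : Int (fun y => \1_(B k) y * F y) <= (2 ^+ n) ^+ k * (2 ^+ n * (h ^+ n * Q)).
  have L0 : 0 < 2 * (2 ^+ k * h) by rewrite !mulr_gt0.
  have Bx : cube (\row_i (c ord0 i - 2 ^+ k * h)) (2 * (2 ^+ k * h)) x0.
    rewrite -box_cube => i; apply: (le_trans (bx i)); rewrite ler_peMl ?(ltW h0)//.
    by rewrite exprn_ege1// ler1n.
  have := HM _ _ L0 Bx; rewrite -box_cube => /le_trans; apply.
  by rewrite !exprMn exprAC !mulrA [2 ^+ n * _]mulrC.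
have lw : L1 (fun y => F y / wt2 c h y).
  apply: (L1_dom _ lF); first exact: (measurable_funM (L1_mfn lF) (wt2V_mfn c h)).
  move=> y; rewrite normrM (ger0_norm (F0 y)) ler_piMr// normfV (gtr0_norm (wt2_gt0 c h y)).
  by rewrite invf_le1 ?wt2_gt0// wt2_ge1.
have HK K : Int (fun y => F y / wt2 c h y) <= 4 ^+ n * 2 ^+ n * 2 * (h ^+ n * Q) + (4 ^+ n) ^- K * Int F.
  have lT k : L1 (fun y => 4 ^+ n * (4 ^+ n) ^- k * (\1_(B k) y * F y)) by apply: L1Z; exact: lB.
  have lS : L1 (fun y => \sum_(k < K.+1) 4 ^+ n * (4 ^+ n) ^- k * (\1_(B k) y * F y)).
    by apply: L1_sum => k; exact: lT.
  have lK : L1 (fun y => (4 ^+ n) ^- K * F y) by exact: L1Z.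
  apply: (@le_trans _ _ (Int (fun y => \sum_(k < K.+1) 4 ^+ n * (4 ^+ n) ^- k * (\1_(B k) y * F y) + (4 ^+ n) ^- K * F y))).
    apply: Int_le => //; first exact: L1D.
    move=> y; rewrite mulrC; apply: (le_trans (ler_wpM2r (F0 y) (pw K y))).
    rewrite mulrDl lerD2r mulr_suml ler_sum// => k _.
    by rewrite mulrA.
  rewrite (IntD lS lK) (IntZ _ lF) lerD2r (Int_sum _ (fun k : 'I_K.+1 => lT k)).
  pose X := 4 ^+ n * (2 ^+ n * (h ^+ n * Q)).
  have X0 : 0 <= X by rewrite !mulr_ge0 ?exprn_ge0// ltW.
  apply: (@le_trans _ _ (\sum_(k < K.+1) X * 2^-1 ^+ k)).
    apply: ler_sum => k _; rewrite (IntZ _ (lB k)).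
    apply: (@le_trans _ _ (4 ^+ n * (4 ^+ n) ^- k * ((2 ^+ n) ^+ k * (2 ^+ n * (h ^+ n * Q))))).
      by rewrite ler_wpM2l ?IB// mulr_ge0 ?invr_ge0 ?exprn_ge0.
    rewrite [leLHS](_ : _ = X * ((2 ^+ n) ^+ k / (4 ^+ n) ^+ k)); last by rewrite /X; ring.
    rewrite ler_wpM2l// -expr_div_n lerXn2r ?nnegrE ?divr_ge0 ?exprn_ge0//.
    rewrite -expr_div_n (_ : 2 / 4 = 2^-1 :> R); last by field.
    by rewrite -[leRHS]expr1 ler_wiXn2l // invf_le1 // ler1n.
  rewrite -mulr_sumr [leRHS](_ : _ = X * 2); last by rewrite /X; ring.
  rewrite ler_wpM2l // geom_half.
  by rewrite gerBl exprn_ge0.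
have I0 : 0 <= Int F by exact: Int_ge0.
(* The number of boxes was arbitrary: the tail times the finite total mass of [F] is below any
   [e]. *)
apply/ler_addgt0Pr => e e0.
have [K Ke] : exists K : nat, (4 ^+ n) ^- K * Int F <= e.
  have Kb := truncnS_gt (Int F / e); move: Kb; set K := _.+1 => Kb; exists K.
  rewrite mulrC ler_pdivrMr ?exprn_gt0// mulrC -ler_pdivrMr//.
  apply: (le_trans (ltW Kb)); apply: (@le_trans _ _ (2 ^+ K)).
    by rewrite -natrX ler_nat ltnW// ltn_expl.
  rewrite lerXn2r ?nnegrE ?exprn_ge0//.
  apply: (@le_trans _ _ 4); first by rewrite ler_nat.
  by rewrite -[leLHS]expr1 ler_weXn2l// ler1n.
by apply: (le_trans (HK K)); rewrite lerD2l.
Qed.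

Lemma max_wt (F : V -> R) x0 Q c h : 0 <= Q -> 0 < h -> L1 F -> (forall y, 0 <= F y) ->
  maxbound F x0 Q -> box c h x0 ->
  Int (fun y => F y / wt c h y) <= (1 + n%:R) ^+ 2 * 9 ^+ n * (4 ^+ n * 2 ^+ n * 2) * (h ^+ n * Q).
Proof.
move=> Q0 h0 lF F0 HM bx.
have w2 y : (wt2 c h y)^-1 <= 1 by rewrite invf_le1 ?wt2_gt0// wt2_ge1.
have w4 y : (wt c h y)^-1 <= 1 by rewrite invf_le1 ?wt_gt0// wt_ge1.
have l2 : L1 (fun y => F y / wt2 c h y).
  apply: (L1_dom _ lF); first exact: (measurable_funM (L1_mfn lF) (wt2V_mfn c h)).
  by move=> y; rewrite normrM (ger0_norm (F0 y)) ler_piMr// normfV (gtr0_norm (wt2_gt0 c h y)).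
have l4 : L1 (fun y => F y / wt c h y).
  apply: (L1_dom _ lF); first exact: (measurable_funM (L1_mfn lF) (mfn_cont (@wtV_cts R n c h))).
  by move=> y; rewrite normrM (ger0_norm (F0 y)) ler_piMr// normfV (gtr0_norm (wt_gt0 c h y)).
set K := (1 + n%:R) ^+ 2 * 9 ^+ n; have K0 : 0 <= K by rewrite /K; rewrite mulr_ge0 ?exprn_ge0// addr_ge0.
rewrite -mulrA; apply: (le_trans _ (ler_wpM2l K0 (max_wt2 Q0 h0 lF F0 HM bx))).
rewrite -(IntZ _ l2); apply: Int_le => //; first exact: L1Z.
move=> y; rewrite mulrCA ler_wpM2l//.
have bc : box c (2 * h) c by move=> i; rewrite subrr normr0 mulr_ge0// ltW.
apply: (le_trans (wtV_split y h0 (lexx h) bc)); rewrite ler_wpM2l//.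
by rewrite ler_piMr// invr_ge0 ltW// wt2_gt0.
Qed.
End maximal.

(** * Dyadic decomposition of the symbol *)

Section joint_symbol.
Variables (R : realType) (n : nat).
Local Notation V := 'rV[R]_n.

Lemma mlist_single (i : 'I_n) p : mlist (fun j => if j == i then p else 0%N) = nseq p i.
Proof.
have gen (s : seq 'I_n) : uniq s ->
    flatten [seq nseq (if j == i then p else 0%N) j | j <- s] = nseq (if i \in s then p else 0%N) i.
  elim: s => //= j s IH /andP[js us]; rewrite IH// in_cons eq_sym.
  have [->|ji] := eqVneq i j; first by rewrite (negbTE js) cats0.
  by rewrite ?(negbTE ji).
by rewrite /mlist gen ?enum_uniq// mem_enum.
Qed.

Lemma mlen_single (i : 'I_n) p : mlen (fun j => if j == i then p else 0%N) = p.
Proof. by rewrite /mlen -big_mkcond big_pred1_eq. Qed.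

Lemma row_mx_cts : continuous (fun p : V * V => row_mx p.1 p.2).
Proof.
apply: continuous_rowP => j; case: (splitP j) => k jk.
  rewrite (_ : (fun p => _) = (fun p : V * V => p.1 ord0 k)); first exact: coord_cont1.
  by apply/funext => p; rewrite (_ : j = lshift n k) ?row_mxEl//; apply/val_inj.
rewrite (_ : (fun p => _) = (fun p : V * V => p.2 ord0 k)); first exact: coord_cont2.
by apply/funext => p; rewrite (_ : j = rshift n k) ?row_mxEr//; apply/val_inj.
Qed.

Definition jder (g : 'rV[R]_(n + n) -> R) ds (p : V * V) : R := pdseq ds g (row_mx p.1 p.2).

Lemma jder_cts g ds : smooth g -> continuous (jder g ds).
Proof. by move=> sg; apply: (cts_comp row_mx_cts); exact: (sg ds).1. Qed.

Lemma Der_jder g ds i z : smooth g ->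
  Der i (fun x => jder g ds (x, z)) (fun x => jder g (lshift n i :: ds) (x, z)).
Proof.
move=> sg x; apply: (@is_derive_pull R V 'rV[R]_(n + n) R (fun x => row_mx x z) (pdseq ds g) x
  (evec R i) (evec R (lshift n i))); last exact/derivableP/((sg ds).2).
move=> t; apply/rowP => j; rewrite !mxE; case: (splitP j) => k jk; rewrite ?mxE ?eqxx/=.
  rewrite (_ : (j == lshift n i) = (k == i))//.
  by rewrite -!val_eqE /= jk.
rewrite (_ : (j == lshift n i) = false) ?mulr0 ?add0r//.
by apply/negbTE; rewrite -val_eqE /= jk; apply/eqP => h; have := ltn_ord i; rewrite -h ltnNge leq_addr.
Qed.

Lemma Derz_jder g ds k : smooth g -> Derz k (jder g ds) (jder g (rshift n k :: ds)).
Proof.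
move=> sg x z; apply: (@is_derive_pull R V 'rV[R]_(n + n) R (fun z => row_mx x z) (pdseq ds g) z
  (evec R k) (evec R (rshift n k))); last exact/derivableP/((sg ds).2).
move=> t; apply/rowP => j; rewrite !mxE; case: (splitP j) => i ji; rewrite ?mxE ?eqxx/=.
  rewrite (_ : (j == rshift n k) = false) ?mulr0 ?add0r//.
  by apply/negbTE; rewrite -val_eqE /= ji; apply/eqP => h; have := ltn_ord i; rewrite h ltnNge leq_addr.
rewrite (_ : (j == rshift n k) = (i == k))//.
by rewrite -!val_eqE /= ji eqn_add2l.
Qed.

Definition mixed (i k : 'I_n) u v := nseq u (lshift n i) ++ nseq v (rshift n k).

(** Only derivatives in one position direction and one frequency direction, up to the orders
    actually used, enter the estimates; one constant then serves for all. *)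
Definition real_symbol (m rho : R) (g : 'rV[R]_(n + n) -> R) := smooth g /\
  exists2 C, 0 < C & forall i k u v x z, (u <= 2 * n)%N -> (v <= 4 * n)%N ->
    `|jder g (mixed i k u v) (x, z)| <= C * (1 + enorm z) `^ (m + rho * u%:R - rho * v%:R).

Lemma cre_le (z : complex R) : `|cre z| <= cmod z.
Proof. by rewrite /cmod -sqrtr_sqr ler_wsqrtr// lerDl sqr_ge0. Qed.

Lemma cim_le (z : complex R) : `|cim z| <= cmod z.
Proof. by rewrite /cmod -sqrtr_sqr ler_wsqrtr// lerDr sqr_ge0. Qed.

Lemma symbol_parts m rho (s : V -> V -> complex R) : symbol_class m rho rho s ->
  real_symbol m rho (fun z => cre (joint s z)) /\ real_symbol m rho (fun z => cim (joint s z)).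
Proof.
move=> [[s1 s2] bd].
pose T := ('I_n * 'I_n * 'I_(2 * n).+1 * 'I_(4 * n).+1)%type.
have bdT (t : T) : exists C : R, forall x xi,
    cmod (dxdxi (fun j => if j == t.1.1.1 then nat_of_ord t.1.2 else 0%N)
      (fun j => if j == t.1.1.2 then nat_of_ord t.2 else 0%N) s x xi) <=
      C * (1 + enorm xi) `^ (m + rho * (t.1.2)%:R - rho * (t.2)%:R).
  have [C HC] := bd (fun j => if j == t.1.1.1 then nat_of_ord t.1.2 else 0%N)
    (fun j => if j == t.1.1.2 then nat_of_ord t.2 else 0%N).
  by exists C => x xi; have := HC x xi; rewrite !mlen_single.
have [f fP] := choice bdT.
(* There are finitely many choices of directions and orders, so the constants may be added. *)
pose C := 1 + \sum_(t : T) `|f t|.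
have C0 : 0 < C by rewrite ltr_pwDl// sumr_ge0.
have HC i k u v x z : (u <= 2 * n)%N -> (v <= 4 * n)%N ->
    cmod (cpdseq (mixed i k u v) (joint s) (row_mx x z)) <=
    C * (1 + enorm z) `^ (m + rho * u%:R - rho * v%:R).
  move=> u2 v4; have := fP (i, k, Ordinal (u2 : (u < (2 * n).+1)%N), Ordinal (v4 : (v < (4 * n).+1)%N)) x z.
  rewrite /dxdxi !mlist_single !map_nseq /= => /le_trans; apply.
  rewrite ler_wpM2r ?powR_ge0// (le_trans (ler_norm _))// /C.
  set t := (_, _); rewrite (bigD1 t)//= addrCA lerDl addr_ge0// sumr_ge0//.
split; split=> //; exists C => // i k u v x z u2 v4; apply: le_trans (HC i k u v x z u2 v4).
  exact: (le_trans _ (cre_le _)).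
exact: (le_trans _ (cim_le _)).
Qed.
End joint_symbol.

(** * Frequency shells and dyadic cutoffs *)

Section dyadic_symbol.
Variables (R : realType) (n : nat).
Local Notation V := 'rV[R]_n.
Hypothesis n0 : (0 < n)%N.

(** Smoothness at a coarse scale implies smoothness at a finer one. The tolerance [2] is needed
    since the dyadic cutoff also contains the bump of half its size. *)
Lemma jet_rescale S i p h h' A (F : V -> R) : (forall x, 0 <= S x) -> 0 < h -> 0 < h' -> h' <= 2 * h ->
  sjet S i p h A F -> sjet S i p h' (2 ^+ p * A) F.
Proof.
move=> S0 h0 h'0 hh; elim: p A F => [|p IH] A F jF.
  by rewrite expr0 mul1r; have [] := jF.
have A0 := sjet_ge0 jF; have [bF [F' [dF jF']]] := jF.
split.
  by apply: (bddS_mono S0 _ bF); rewrite ler_peMl// exprn_ege1// ler1n.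
exists F'; split=> //; apply: (sjet_mono S0 h'0 _ (IH _ _ jF')).
rewrite ler_pdivlMr//.
rewrite [leLHS](_ : _ = 2 ^+ p * A * (h' / h)); last by ring.
rewrite [leRHS](_ : _ = 2 ^+ p * A * 2); last by rewrite exprS; ring.
by rewrite ler_wpM2l ?mulr_ge0 ?exprn_ge0// ler_pdivrMr.
Qed.

(* [1 + dotp z z] makes the lower bound void for [l = 1], so that the lowest
   frequency piece is covered as well. *)
Definition shell (l : R) : set V := [set z | box 0 (2 * l) z /\ l ^+ 2 / 4 <= 1 + dotp z z].

Lemma near_notshell l z : ~ shell l z -> \forall y \near nbhs z, ~ shell l y.
Proof.
move=> nz; have [bz|bz] := pselect (box 0 (2 * l) z); last first.
  by apply: filterS (near_notbox bz) => y yb [] /yb.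
have dz : 1 + dotp z z < l ^+ 2 / 4 by rewrite ltNge; apply/negP => H; exact: nz.
have cd : continuous (fun y : V => 1 + dotp y y).
  apply: ctsD; first exact: cts_cst.
  by apply: (cts_comp (cts_pair (fun y => cvg_id) (fun y => cvg_id)) (@dotp_continuous R n)).
have := cd z; move/cvgr_lt => /(_ _ dz); apply: filterS => y yd [_].
by rewrite leNgt yd.
Qed.

(** The symbol has the expected size only on the shell, and its dyadic cutoff lives there; [shellB]
    and [shellC] are the bounds of these two factors, and [shell_mul] recovers [symB] for their
    product. *)
Definition shellB (l h : R) (F : V * V -> R) A :=
  [/\ continuous F, 0 <= A & forall z i, shell l z -> xjet i (2 * n) h A (fun x => F (x, z))].

Definition shellC (l : R) (F : V * V -> R) A := exists2 G : V -> R, F = (fun p => G p.2) &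
  bddS \1_(shell l) G A.

Definition dyad (j : nat) (z : V) : R :=
  if j is i.+1 then boxbump (4 * n) 0 (2 ^+ j) z - boxbump (4 * n) 0 (2 ^+ i) z
  else boxbump (4 * n) 0 1 z.

Lemma dyad_sum J z : \sum_(j < J.+1) dyad j z = boxbump (4 * n) 0 (2 ^+ J) z.
Proof.
elim: J => [|J IH]; first by rewrite big_ord_recr big_ord0 /= add0r expr0.
by rewrite big_ord_recr IH /= addrC subrK.
Qed.

Lemma coord_dotp (z : V) i : z ord0 i ^+ 2 <= dotp z z.
Proof.
rewrite /dotp (bigD1 i)//= expr2 lerDl sumr_ge0// => k _.
by rewrite -expr2 sqr_ge0.
Qed.

(** Inside the inner boundary of the shell both bumps of the difference equal [1], outside the outer
    one both vanish; for [j = 0] the inner condition cannot fail. *)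
Lemma dyad_supp j z : ~ shell (2 ^+ j) z -> dyad j z = 0.
Proof.
move=> nz; have p2 k : 0 < 2 ^+ k :> R by rewrite exprn_gt0.
have [bz|bz] := pselect (box 0 (2 * 2 ^+ j) z); last first.
  case: j nz bz => [|j] nz bz /=; first by apply: boxbump0 => //; rewrite expr0 in bz.
  rewrite !boxbump0 ?subr0// => H; apply: bz => i; apply: (le_trans (H i)).
  by rewrite exprS ler_peMl ?mulr_ge0// ?(ltW (p2 _))// ler1n.
have dz : 1 + dotp z z < (2 ^+ j) ^+ 2 / 4 by rewrite ltNge; apply/negP => H; exact: nz.
have d0 : 0 <= dotp z z by apply: (le_trans (sqr_ge0 (z ord0 (Ordinal n0)))); exact: coord_dotp.
case: j nz bz dz => [|j] nz bz dz /=.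
  exfalso; move: dz; rewrite expr0; move: d0; clear; move: (dotp z z) => t; lra.
have b2 : box 0 (2 ^+ j) z.
  move=> i; rewrite mxE subr0 leNgt; apply/negP => H.
  have := coord_dotp z i; rewrite -[_ ^+ 2]real_normK ?num_real// => Hd.
  have : (2 ^+ j) ^+ 2 < `|z ord0 i| ^+ 2 by rewrite ltrXn2r ?nnegrE ?(ltW (p2 j)).
  move: dz Hd; rewrite [2 ^+ j.+1]exprS exprMn; move: (`|z ord0 i| ^+ 2) ((2 ^+ j) ^+ 2) (dotp z z) => a b c; clear; lra.
rewrite !boxbump1 ?subrr// => i; apply: (le_trans (b2 i)).
by rewrite exprS ler_peMl ?(ltW (p2 _))// ler1n.
Qed.

Lemma dyad_jet : exists2 B, 0 < B & forall j k h, 0 < h -> h^-1 <= 2 ^+ j ->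
  sjet \1_(shell (2 ^+ j)) k (4 * n) h^-1 B (dyad j).
Proof.
have [A0 A00 HA] := @boxbump_jet R n (4 * n).
exists (2 ^+ (4 * n) * (A0 + A0) + 1).
  by rewrite ltr_pwDr// mulr_ge0 ?exprn_ge0// addr_ge0.
move=> j k h h0 hj; apply: sjet_supp; [exact: near_notshell|by rewrite invr_gt0| |exact: dyad_supp].
have p2 i : 0 < 2 ^+ i :> R by rewrite exprn_gt0.
have hi0 : 0 < h^-1 by rewrite invr_gt0.
have one0 (x : V) : 0 <= (1 : R) by [].
case: j hj => [|j] hj /=.
  have e1 : h^-1 <= 2 * 1 by rewrite (le_trans hj)// expr0 ler_peMl// ler1n.
  have := jet_rescale one0 ltr01 hi0 e1 (HA k 0 1 ltr01).
  move/(sjet_mono one0 hi0); apply.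
  rewrite (@le_trans _ _ (2 ^+ (4 * n) * (A0 + A0)))// ?lerDl//.
  by rewrite ler_wpM2l ?exprn_ge0// lerDl.
have e2 : h^-1 <= 2 * 2 ^+ j.+1 by rewrite (le_trans hj)// ler_peMl ?(ltW (p2 _))// ler1n.
have e1 : h^-1 <= 2 * 2 ^+ j by rewrite -exprS.
have j1 := jet_rescale one0 (p2 j) hi0 e1 (HA k 0 _ (p2 j)).
have j2 := jet_rescale one0 (p2 j.+1) hi0 e2 (HA k 0 _ (p2 j.+1)).
have j3 := sjetZ (-1) j1.
have := jetD (fun F G A B => @bddSD R n (fun=> 1) F G A B) (fun F F' G G' => @DerD R n k F F' G G') j2 j3.
rewrite normrN1 mulr1 -mulrDr => jD.
have E : (fun x : V => boxbump (4 * n) 0 (2 ^+ j.+1) x + boxbump (4 * n) 0 (2 ^+ j) x * -1) = dyad j.+1.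
  by apply/funext => x /=; rewrite mulrN1.
rewrite E in jD; apply: (sjet_mono one0 hi0 _ jD); by rewrite lerDl.
Qed.
End dyadic_symbol.

Section symbol_pieces.
Variables (R : realType) (n : nat).
Local Notation V := 'rV[R]_n.
Hypothesis n0 : (0 < n)%N.

Lemma powR_between (t B e : R) : 2 <= B -> 2^-1 <= t -> t <= B -> t `^ e <= B `^ `|e|.
Proof.
move=> B2 t2 tB; have h2 : 0 < 2^-1 :> R by rewrite invr_gt0.
have t0 : 0 < t := lt_le_trans h2 t2; have B0 : 0 < B by apply: lt_le_trans B2.
have [e0|e0] := leP 0 e; first by rewrite ger0_norm// ge0_ler_powR// nnegrE ltW.
rewrite ltr0_norm// -[in leLHS](opprK e) powRN -[leLHS]mul1r ler_pdivrMr ?powR_gt0//.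
rewrite -powRM ?(ltW t0) ?(ltW B0)// -[X in X <= _](congr1 (@^~ (- e)) (powR1 R)).
have e1 : 0 <= - e by rewrite oppr_ge0 ltW.
rewrite ge0_ler_powR// ?nnegrE ?mulr_ge0 ?(ltW t0) ?(ltW B0)//.
apply: (@le_trans _ _ (2 * 2^-1)); first by rewrite divff.
by apply: ler_pM => //; exact: ltW.
Qed.

Lemma shell_enorm l (z : V) : 1 <= l -> shell l z -> 2^-1 * l <= 1 + enorm z /\
  1 + enorm z <= (1 + 2 * n%:R) * l.
Proof.
move=> l1 [bz dz]; have l0 : 0 < l := lt_le_trans ltr01 l1.
have d0 : 0 <= dotp z z by rewrite /dotp sumr_ge0// => i _; rewrite -expr2 sqr_ge0.
have e0 : 0 <= enorm z by exact: sqrtr_ge0.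
have e2 : enorm z ^+ 2 = dotp z z by rewrite sqr_sqrtr.
split.
  rewrite -(@ler_pXn2r _ 2)// ?nnegrE ?addr_ge0 ?mulr_ge0 ?invr_ge0 ?(ltW l0)//.
  rewrite [leLHS](_ : _ = l ^+ 2 / 4); last by field.
  apply: (le_trans dz); rewrite -e2; move: (enorm z) e0 => t t0; clear -t0.
  rewrite -subr_ge0 (_ : _ - _ = 2 * t); first by rewrite mulr_ge0.
  by ring.
rewrite mulrDl mul1r lerD//.
have b0 : 0 <= 2 * n%:R * l by rewrite !mulr_ge0// ltW.
rewrite -(@ler_pXn2r _ 2)// ?nnegrE// e2 /dotp.
apply: (@le_trans _ _ (\sum_(i < n) (2 * l) ^+ 2)).
  apply: ler_sum => i _; rewrite -expr2 -real_normK ?num_real//.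
  rewrite lerXn2r ?nnegrE ?mulr_ge0 ?(ltW l0)//.
  by have := bz i; rewrite mxE subr0.
rewrite sumr_const card_ord -[leLHS]mulr_natr [leRHS](_ : _ = (2 * l) ^+ 2 * (n%:R * n%:R)); last by ring.
rewrite ler_wpM2l ?sqr_ge0// -natrM ler_nat; exact: leq_pmulr.
Qed.

Lemma symB_mono h l (F : V * V -> R) A B : 0 < h -> A <= B -> symB h l F A -> symB h l F B.
Proof.
move=> h0 AB [cF jF sF]; split=> // z i.
by apply: (sjet_mono _ h0 AB (jF z i)) => x.
Qed.

Lemma symBD h l (F G : V * V -> R) A B : symB h l F A -> symB h l G B ->
  symB h l (fun p => F p + G p) (A + B).
Proof.
move=> [cF jF sF] [cG jG sG]; split.
- exact: ctsD.
- move=> z i; exact: (jetD (fun F G A B => @bddSD R n (fun=> 1) F G A B)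
    (fun F F' G G' => @DerD R n i F F' G G') (jF z i) (jG z i)).
- by move=> x z bz; rewrite sF// sG// addr0.
Qed.

Lemma shell_mul h l (F G : V * V -> R) A B : 0 < h -> shellB l h F A -> shellC l G B ->
  0 <= A * B /\ symB h l (fun p => F p * G p) (A * B).
Proof.
move=> h0 [cF A0 jF] [G' -> [cG B0 GB]]; have AB0 := mulr_ge0 A0 B0.
have one0 (x : V) : 0 <= (1 : R) by [].
split=> //; split.
- by apply: ctsM => //; apply: (cts_comp _ cG) => p; exact: cvg_snd.
- move=> z i; have [Kz|Kz] := pselect (shell l z).
    have := sjetZ (G' z) (jF z i Kz); move/(sjet_mono one0 h0); apply.
    by rewrite ler_wpM2l//; have := GB z; rewrite indicE mem_set// mulr1.
  have E : (fun x : V => F (x, z) * G' z) = fun=> 0.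
    apply/funext => x; have := GB z; rewrite indicE memNset// mulr0 normr_le0 => /eqP ->.
    by rewrite mulr0.
  rewrite /= E; exact: (sjet0 i (2 * n) one0 h0 AB0).
- move=> x z bz; have Kz : ~ shell l z by move=> [].
  by have := GB z; rewrite indicE memNset// mulr0 normr_le0 => /eqP ->; rewrite mulr0.
Qed.

(** On the shell [1 + |xi|] is comparable to [l], so with [h = l ^ (- rho)] the symbol bounds become
    [l ^ m0 * h ^ v / h ^ u]; and [l ^ m0] is the stated amplitude because [l h = l ^ (1 - rho)].
    Jets in [x] are built first, at fixed frequency, then jets in [xi], and the cutoff enters
    through the Leibniz rule. *)
Lemma symbol_piece (m rho r : R) g : @real_symbol R n m rho g -> 0 < rho < 1 -> 1 < r ->
  m <= - ((n%:R / r) * (1 - rho)) ->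
  exists2 C, 0 < C & forall j k, let l := 2 ^+ j in let h := l `^ (- rho) in
  jet (Derz k) (symB h l) (4 * n) h^-1 (C * ((l * h) ^+ n) `^ (- r^-1))
    (fun p => jder g [::] p * dyad j p.2).
Proof.
move=> [sg [C1 C10 HC]] /andP[rho0 rho1] r1 mm.
have [B B0 HB] := @dyad_jet R n n0.
set m0 := - ((n%:R / r) * (1 - rho)) in mm.
(* [E] bounds the size of the exponent [m0 + rho (u - v)], as [u <= 2 n] and [v <= 4 n]; [b] bounds
   the ratio of [1 + |z|] to [l] on the shell. *)
pose E := `|m0| + 6 * n%:R; pose b : R := 1 + 2 * n%:R.
have n1 : 1 <= n%:R :> R by rewrite ler1n.
have b2 : 2 <= b by rewrite /b; move: n1; clear; move: (n%:R) => x; lra.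
have b0 : 0 < b by apply: lt_le_trans b2.
have E0 : 0 <= E by rewrite addr_ge0 ?mulr_ge0.
have bE0 : 0 < b `^ E by exact: powR_gt0.
exists (2 ^+ (4 * n) * (C1 * b `^ E * B)).
  by rewrite !mulr_gt0// exprn_gt0.
move=> j k l h.
have l1 : 1 <= l by rewrite exprn_ege1// ler1n.
have l0 : 0 < l := lt_le_trans ltr01 l1.
have h0 : 0 < h by exact: powR_gt0.
have hl : h^-1 <= l by rewrite /h powRN invrK ler1_powR// ltW.
have -> : ((l * h) ^+ n) `^ (- r^-1) = l `^ m0.
  rewrite -{1}[l]powRr1 ?(ltW l0)// /h -powRD; last by rewrite (gt_eqF l0) implybT.
  rewrite -powR_mulrn ?powR_ge0// -!powRrM; congr (_ `^ _).
  by rewrite /m0; field; rewrite gt_eqF// (lt_trans ltr01).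
set A0 := C1 * b `^ E * l `^ m0.
have A00 : 0 <= A0 by rewrite !mulr_ge0 ?powR_ge0 ?(ltW C10)// ltW.
have hX v : h ^+ v = l `^ (- (rho * v%:R)).
  by rewrite -powR_mulrn ?(ltW h0)// /h -powRrM mulNr.
have Hbd i u v x z : (u <= 2 * n)%N -> (v <= 4 * n)%N -> shell l z ->
    `|jder g (mixed i k u v) (x, z)| <= A0 * h ^+ v / h ^+ u.
  move=> u2 v4 Kz; apply: (le_trans (HC i k u v x z u2 v4)).
  rewrite !hX -powRN opprK -mulrA -powRD; last by rewrite (gt_eqF l0) implybT.
  rewrite /A0 -!mulrA -powRD; last by rewrite (gt_eqF l0) implybT.
  rewrite ler_wpM2l ?(ltW C10)//.
  have [z1 z2] := shell_enorm l1 Kz.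
  have z3 : 1 <= 1 + enorm z by rewrite lerDl sqrtr_ge0.
  set d := - (rho * v%:R) + rho * u%:R.
  rewrite (_ : m + _ - _ = m + d); last by rewrite /d; ring.
  (* Since [1 + |z| >= 1], the order [m] may be raised to the critical order [m0]. *)
  apply: (@le_trans _ _ ((1 + enorm z) `^ (m0 + d))); first by rewrite ler_powR// lerD2r.
  set t := (1 + enorm z) / l.
  have tE : 1 + enorm z = t * l by rewrite /t divfK// gt_eqF.
  have t1 : 2^-1 <= t by rewrite /t ler_pdivlMr.
  have t2 : t <= b by rewrite /t ler_pdivrMr.
  have t0 : 0 <= t by apply: le_trans t1; rewrite invr_ge0.
  rewrite tE powRM ?(ltW l0)// ler_wpM2r ?powR_ge0//.
  apply: (le_trans (powR_between _ b2 t1 t2)); rewrite ler_powR//; first by apply: le_trans b2; rewrite ler1n.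
  apply: (le_trans (ler_normD _ _)); rewrite /E lerD2l /d.
  apply: (le_trans (ler_normD _ _)).
  rewrite normrN !ger0_norm ?mulr_ge0 ?(ltW rho0)//.
  have Hn (w W : nat) : (w <= W)%N -> rho * w%:R <= W%:R.
    by move=> wW; apply: (@le_trans _ _ w%:R); rewrite ?ler_nat// ler_piMl// ltW.
  apply: (le_trans (lerD (Hn _ _ v4) (Hn _ _ u2))).
  by rewrite !natrM -mulrDl -natrD.
have HA u v : 0 <= A0 * h ^+ v / h ^+ u.
  exact: divr_ge0 (mulr_ge0 A00 (exprn_ge0 _ (ltW h0))) (exprn_ge0 _ (ltW h0)).
have Hx i z : shell l z -> forall p u v, (u + p = 2 * n)%N -> (v <= 4 * n)%N ->
    xjet i p h (A0 * h ^+ v / h ^+ u) (fun x => jder g (mixed i k u v) (x, z)).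
  move=> Kz; elim=> [|p IH] u v up v4.
    split=> //; split.
    - by apply: slice_cts; exact: jder_cts.
    - exact: HA.
    - by move=> x; rewrite mulr1; apply: Hbd => //; rewrite -up leq_addr.
  split.
    split.
    - by apply: slice_cts; exact: jder_cts.
    - exact: HA.
    - by move=> x; rewrite mulr1; apply: Hbd => //; rewrite -up leq_addr.
  exists (fun x => jder g (mixed i k u.+1 v) (x, z)); split; first exact: Der_jder.
  rewrite (_ : A0 * h ^+ v / h ^+ u / h = A0 * h ^+ v / h ^+ u.+1).
    exact: (IH _ _ (etrans (addSnnS u p) up) v4).
  by rewrite exprSr invfM [h ^- u * _]mulrC; ring.
have Hz p : forall v, (v + p = 4 * n)%N ->
    jet (Derz k) (shellB l h) p h^-1 (A0 * h ^+ v) (jder g (nseq v (rshift n k))).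
  have HB0 v : (v <= 4 * n)%N -> shellB l h (jder g (nseq v (rshift n k))) (A0 * h ^+ v).
    move=> v4; split; first exact: jder_cts.
      exact: mulr_ge0 A00 (exprn_ge0 _ (ltW h0)).
    move=> z i Kz; have := Hx i z Kz (2 * n)%N 0%N v (add0n _) v4.
    by rewrite expr0 divr1.
  elim: p => [|p IH] v vp; first by split=> //; apply: HB0; rewrite -vp leq_addr.
  split; first by apply: HB0; rewrite -vp leq_addr.
  exists (jder g (nseq v.+1 (rshift n k))); split; first exact: Derz_jder.
  rewrite invrK -mulrA -exprSr; exact: (IH _ (etrans (addSnnS v p) vp)).
have hi0 : 0 < h^-1 by rewrite invr_gt0.
have jg := Hz (4 * n)%N 0%N (add0n _); rewrite expr0 mulr1 in jg.
have jd : jet (Derz k) (shellC l) (4 * n) h^-1 B (fun p => dyad j p.2).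
  apply: (jet_map (phi := snd) _ _ (HB j k h h0 hl)).
  - by move=> F A bF; exists F.
  - by move=> F F' dF x.
have := jetM hi0 (fun F A B => @symB_mono h l F A B h0) (fun F G A B => @symBD h l F G A B)
  (fun F G A B => @shell_mul h l F G A B h0)
  (fun F F' G G' dF dG x => @DerD R n k _ _ _ _ (dF x) (dG x))
  (fun F F' G G' dF dG x => @DerM R n k _ _ _ _ (dF x) (dG x)) jg jd.
by rewrite (_ : 2 ^+ (4 * n) * (A0 * B) = 2 ^+ (4 * n) * (C1 * b `^ E * B) * l `^ m0)// /A0; ring.
Qed.
End symbol_pieces.

(** * Local estimates and their summation *)

Section local_norms.
Variables (R : realType) (n : nat).
Local Notation V := 'rV[R]_n.

(* A bound on the power of the norm: by convexity the constants [t] still add up. *)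
Definition lr_bound (S : set V) r D (u : V -> R) t :=
  [/\ mfn u, L1 (fun x => \1_S x * `|u x| `^ r) & Int (fun x => \1_S x * `|u x| `^ r) <= t `^ r * D].

Lemma indic01 (S : set V) x : 0 <= (\1_S x : R) <= 1.
Proof. by rewrite indicE; case: (x \in S); rewrite ?lexx ?ler01. Qed.

Lemma lr_mfn (S : set V) r (u : V -> R) : mfn (\1_S : V -> R) -> mfn u ->
  mfn (fun x => \1_S x * `|u x| `^ r).
Proof.
move=> mS mu; apply: measurable_funM => //.
apply: (measurableT_comp (f := fun t : R => t `^ r)); first exact: measurable_powR.
exact: measurableT_comp.
Qed.

(** Convexity of the power at the points [u / s] and [v / t] with weights [s / (s + t)] and
    [t / (s + t)]. Once integrated, it gives the triangle inequality for local norms. *)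
Lemma powR_convex (r u v s t : R) : 1 <= r -> 0 <= u -> 0 <= v -> 0 < s -> 0 < t ->
  (u + v) `^ r <= (s + t) `^ r * (s / (s + t) * (u `^ r / s `^ r) + t / (s + t) * (v `^ r / t `^ r)).
Proof.
move=> r1 u0 v0 s0 t0; have st0 : 0 < s + t by rewrite addr_gt0.
have st := gt_eqF st0; have sn := gt_eqF s0; have tn := gt_eqF t0.
have p0 : 0 <= s / (s + t) by rewrite divr_ge0 ?ltW.
have p1 : s / (s + t) <= 1 by rewrite ler_pdivrMr// mul1r lerDl ltW.
have us0 : 0 <= u / s by rewrite divr_ge0// ltW.
have vt0 : 0 <= v / t by rewrite divr_ge0// ltW.
have us : u / s \in (`[0, +oo[%classic : set R) by rewrite inE/= in_itv/= us0.
have vt : v / t \in (`[0, +oo[%classic : set R) by rewrite inE/= in_itv/= vt0.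
have H := convex_powR r1 (Itv01 p0 p1) us vt; rewrite convRE [X in X `^ _ <= _]convRE in H.
move: H; rewrite /= /unstable.onem (_ : 1 - s / (s + t) = t / (s + t)); last by field; rewrite st.
rewrite (_ : s / (s + t) * (u / s) + t / (s + t) * (v / t) = (u + v) / (s + t)); last first.
  by field; rewrite st sn tn.
have dv (x y : R) : 0 <= x -> 0 < y -> (x / y) `^ r = x `^ r / y `^ r.
  move=> x0 y0; rewrite powRM ?invr_ge0 ?(ltW y0)//; congr (_ * _).
  by rewrite -powR_inv1 ?(ltW y0)// -powRrM mulN1r powRN.
rewrite !dv ?addr_ge0//.
by rewrite ler_pdivrMr ?powR_gt0// mulrC.
Qed.

Lemma lr_boundD (S : set V) r D u v s t : mfn (\1_S : V -> R) -> 1 <= r -> 0 <= D -> 0 < s -> 0 < t ->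
  lr_bound S r D u s -> lr_bound S r D v t -> lr_bound S r D (fun x => u x + v x) (s + t).
Proof.
move=> mS r1 D0 s0 t0 [mu lu Iu] [mv' lv Iv].
have st0 : 0 < s + t by rewrite addr_gt0.
have muv : mfn (fun x => u x + v x) by exact: measurable_funD.
set a := (s + t) `^ r * (s / (s + t) / s `^ r); set b := (s + t) `^ r * (t / (s + t) / t `^ r).
have pw x : \1_S x * `|u x + v x| `^ r <= a * (\1_S x * `|u x| `^ r) + b * (\1_S x * `|v x| `^ r).
  have -> : a * (\1_S x * `|u x| `^ r) + b * (\1_S x * `|v x| `^ r) =
      \1_S x * ((s + t) `^ r * (s / (s + t) * (`|u x| `^ r / s `^ r) + t / (s + t) * (`|v x| `^ r / t `^ r))).
    by rewrite /a /b; ring.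
  have /andP[i0 _] := indic01 S x; rewrite ler_wpM2l//.
  apply: le_trans (powR_convex r1 (normr_ge0 _) (normr_ge0 _) s0 t0).
  apply: (ge0_ler_powR (le_trans ler01 r1)); rewrite ?nnegrE ?addr_ge0//; exact: ler_normD.
have lw : L1 (fun x => a * (\1_S x * `|u x| `^ r) + b * (\1_S x * `|v x| `^ r)).
  exact: L1D (L1Z _ lu) (L1Z _ lv).
have l : L1 (fun x => \1_S x * `|u x + v x| `^ r).
  apply: (L1_dom _ lw); first exact: lr_mfn.
  by move=> x; rewrite ger0_norm ?pw// mulr_ge0 ?powR_ge0.
split=> //; apply: (le_trans (Int_le l lw pw)).
rewrite (IntD (L1Z _ lu) (L1Z _ lv)) !IntZ//.
have a0 : 0 <= a by rewrite /a !mulr_ge0 ?invr_ge0 ?powR_ge0 ?(ltW s0)// ltW.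
have b0 : 0 <= b by rewrite /b !mulr_ge0 ?invr_ge0 ?powR_ge0 ?(ltW t0)// ltW.
apply: (le_trans (lerD (ler_wpM2l a0 Iu) (ler_wpM2l b0 Iv))).
rewrite le_eqVlt; apply/orP; left; apply/eqP; rewrite /a /b.
have sr := gt_eqF (powR_gt0 r s0); have tr := gt_eqF (powR_gt0 r t0).
by field; rewrite sr tr (gt_eqF st0).
Qed.

Lemma lr_bound_mono (S : set V) r D u s t : 0 <= r -> 0 <= D -> 0 <= s -> s <= t ->
  lr_bound S r D u s -> lr_bound S r D u t.
Proof.
move=> r0 D0 s0 st [mu lu Iu]; split=> //; apply: (le_trans Iu); rewrite ler_wpM2r//.
by rewrite ge0_ler_powR ?nnegrE// (le_trans s0).
Qed.

Lemma lr_bound_sum (S : set V) r D (u : nat -> V -> R) t J : mfn (\1_S : V -> R) -> 1 <= r -> 0 <= D ->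
  (forall j, 0 < t j) -> (forall j, lr_bound S r D (u j) (t j)) ->
  lr_bound S r D (fun x => \sum_(j < J.+1) u j x) (\sum_(j < J.+1) t j).
Proof.
move=> mS r1 D0 t0 H; elim: J => [|J IH].
  rewrite (_ : (fun x => _) = u 0) ?big_ord_recr ?big_ord0 /= ?add0r//.
  by apply/funext => x; rewrite big_ord_recr big_ord0 /= add0r.
have E : (fun x => \sum_(j < J.+2) u j x) = (fun x => \sum_(j < J.+1) u j x + u J.+1 x).
  by apply/funext => x; rewrite big_ord_recr.
rewrite E big_ord_recr; apply: lr_boundD => //=.
by rewrite big_ord_recr ltr_wpDl//= sumr_ge0// => j _; exact: ltW.
Qed.

(** Hölder's inequality from L^2 to L^r on a set of measure at most [w], proved pointwise by
    weighted AM-GM with the terms normalized by [E] and [w]; [r = 2] is the degenerate case of the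
    weights. *)
Lemma jensen (S : set V) r w E (T U : V -> R) : 1 < r <= 2 -> 0 < w -> 0 < E ->
  L1 (\1_S : V -> R) -> Int (\1_S : V -> R) <= w -> mfn T ->
  L1 (fun x => U x ^+ 2) -> Int (fun x => U x ^+ 2) <= E -> (forall x, S x -> `|T x| <= `|U x|) ->
  L1 (fun x => \1_S x * `|T x| `^ r) /\
  Int (fun x => \1_S x * `|T x| `^ r) <= w `^ (1 - r / 2) * E `^ (r / 2).
Proof.
move=> /andP[r1 r2] w0 E0 lS IS mT lU IU TU; have r0 : 0 < r by apply: lt_trans r1.
have t0 : 0 <= r / 2 by rewrite divr_ge0// ltW.
set K := w `^ (1 - r / 2) * E `^ (r / 2).
have K0 : 0 <= K by rewrite mulr_ge0 ?powR_ge0.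
have pw x : \1_S x * `|T x| `^ r <= K * (r / 2 / E * U x ^+ 2 + (1 - r / 2) / w * \1_S x).
  have [Sx|Sx] := pselect (S x); last first.
    rewrite indicE memNset// mul0r mulr0 addr0; apply: mulr_ge0 => //.
    by apply: mulr_ge0; [rewrite divr_ge0// ltW|exact: sqr_ge0].
  rewrite indicE mem_set// mul1r mulr1.
  apply: (@le_trans _ _ ((U x ^+ 2) `^ (r / 2))).
    rewrite -(sqr_powR2 (U x)) -powRrM (_ : 2 * (r / 2) = r); last by field.
    by rewrite ge0_ler_powR ?nnegrE ?TU// ltW.
  have : r = 2 \/ r < 2 by move: r2; rewrite le_eqVlt => /orP[/eqP|]; [left|right].
  case=> [r2'|r2'].
    rewrite /K r2' divff// subrr powRr0 mul0r addr0 !powRr1 ?sqr_ge0 ?(ltW E0)//.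
    by rewrite mul1r mul1r mulrA divff ?mul1r// gt_eqF.
  have t1 : 0 <= r / 2 < 1 by rewrite t0 ltr_pdivrMr// mul1r.
  have x0 : 0 <= U x ^+ 2 / E by rewrite divr_ge0 ?sqr_ge0// ltW.
  have y0 : 0 <= w^-1 by rewrite invr_ge0 ltW.
  have := ler_wpM2l K0 (amgm2 t1 x0 y0).
  rewrite (_ : r / 2 / E * U x ^+ 2 = r / 2 * (U x ^+ 2 / E)); last by ring.
  apply: le_trans; rewrite powRM ?sqr_ge0 ?invr_ge0 ?(ltW E0)//.
  have iv (y e : R) : 0 < y -> y^-1 `^ e = (y `^ e)^-1.
    by move=> yy; rewrite -powR_inv1 ?(ltW yy)// -powRrM mulN1r powRN.
  rewrite !iv// /K.
  rewrite [leRHS](_ : _ = (U x ^+ 2) `^ (r / 2))//.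
  by field; rewrite !gt_eqF ?powR_gt0.
have lB : L1 (fun x => r / 2 / E * U x ^+ 2 + (1 - r / 2) / w * \1_S x).
  exact: L1D (L1Z _ lU) (L1Z _ lS).
have l : L1 (fun x => \1_S x * `|T x| `^ r).
  apply: (L1_dom _ (L1Z K lB)); first exact: (lr_mfn _ (L1_mfn lS) mT).
  by move=> x; rewrite ger0_norm ?pw// mulr_ge0 ?powR_ge0.
split=> //; apply: (le_trans (Int_le l (L1Z K lB) pw)).
rewrite (IntZ _ lB) (IntD (L1Z _ lU) (L1Z _ lS)) !IntZ//.
rewrite -[leRHS]mulr1 ler_wpM2l//.
have c1 : 0 <= r / 2 / E by rewrite divr_ge0// ltW.
have c2 : 0 <= (1 - r / 2) / w.
  by rewrite divr_ge0 ?(ltW w0)// subr_ge0 ler_pdivrMr// mul1r.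
apply: (le_trans (lerD (ler_wpM2l c1 IU) (ler_wpM2l c2 IS))).
by rewrite !divfK ?gt_eqF// addrC subrK.
Qed.
End local_norms.

(** * Estimates of one piece on one box *)

Section local_estimates.
Variables (R : realType) (n : nat).
Local Notation V := 'rV[R]_n.
Hypothesis n0 : (0 < n)%N.

Definition amp (Cp r l h : R) := Cp * ((l * h) ^+ n) `^ (- r^-1).

Lemma jensen_value (C Cp r l h W D : R) : 1 < r <= 2 -> 0 < C -> 0 < Cp -> 0 < l -> 0 < h -> 0 < W -> 0 < D ->
  ((2 * W) ^+ n) `^ (1 - r / 2) *
    (C * (amp Cp r l h ^+ 2 * ((l ^+ n) `^ (2 / r - 1) * D `^ (2 / r)))) `^ (r / 2) <=
  C `^ (r / 2) * Cp `^ r * 2 ^+ n * (((W * l) ^+ n) `^ (1 - r / 2) / (l * h) ^+ n * D).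
Proof.
move=> /andP[r1 r2] C0 Cp0 l0 h0 W0 D0; have r0 : 0 < r by apply: lt_trans r1.
have rn := gt_eqF r0.
have lh0 : 0 < (l * h) ^+ n by rewrite exprn_gt0// mulr_gt0.
have A0 : 0 < amp Cp r l h by rewrite mulr_gt0// powR_gt0.
have ln0 : 0 < l ^+ n by rewrite exprn_gt0.
have Wn0 : 0 < W ^+ n by rewrite exprn_gt0.
have A2 : (amp Cp r l h ^+ 2) `^ (r / 2) = Cp `^ r / (l * h) ^+ n.
  rewrite -powR_mulrn ?(ltW A0)// -powRrM (_ : 2 * (r / 2) = r); last by field.
  rewrite powRM ?powR_ge0 ?(ltW Cp0)// -powRrM (_ : - r^-1 * r = -1); last by field; rewrite rn.
  by rewrite powR_inv1// ltW.
have L2 : ((l ^+ n) `^ (2 / r - 1)) `^ (r / 2) = (l ^+ n) `^ (1 - r / 2).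
  by rewrite -powRrM; congr (_ `^ _); field; rewrite rn.
have D2 : (D `^ (2 / r)) `^ (r / 2) = D.
  by rewrite -powRrM (_ : 2 / r * (r / 2) = 1) ?powRr1 ?(ltW D0)//; field; rewrite rn.
rewrite powRM ?(ltW C0)//; last by rewrite !mulr_ge0 ?powR_ge0 ?sqr_ge0// ltW.
rewrite powRM ?sqr_ge0 ?mulr_ge0 ?powR_ge0// powRM ?powR_ge0// A2 L2 D2.
rewrite [(2 * W) ^+ n]exprMn powRM ?exprn_ge0 ?(ltW W0)//.
rewrite [((W * l) ^+ n)]exprMn [in leRHS]powRM ?(ltW Wn0) ?(ltW ln0)//.
have two : (2 ^+ n) `^ (1 - r / 2) <= 2 ^+ n :> R.
  by rewrite ler1_powR ?exprn_ege1 ?ler1n// gerBl divr_ge0// ltW.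
set X := C `^ (r / 2) * Cp `^ r * ((W ^+ n) `^ (1 - r / 2) * (l ^+ n) `^ (1 - r / 2) / (l * h) ^+ n * D).
have X0 : 0 <= X.
  exact: (mulr_ge0 (mulr_ge0 (powR_ge0 _ _) (powR_ge0 _ _)) (mulr_ge0 (divr_ge0 (mulr_ge0 (powR_ge0 _ _)
    (powR_ge0 _ _)) (ltW lh0)) (ltW D0))).
rewrite [leLHS](_ : _ = (2 ^+ n) `^ (1 - r / 2) * X); last by rewrite /X; ring.
rewrite [leRHS](_ : _ = 2 ^+ n * X); last by rewrite /X; ring.
by rewrite ler_wpM2r.
Qed.

Lemma box_sub (c : V) W h : W <= h -> box c W `<=` box c h.
Proof. by move=> Wh x bx i; exact: le_trans (bx i) Wh. Qed.

Lemma Top_local_lr : exists2 C, 0 < C & forall r Cp l h W D c k (a : V * V -> R) f,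
  1 < r <= 2 -> 0 < Cp -> 0 < l -> 0 < h -> 0 < W -> W <= h -> 0 < D ->
  (forall i, jet (Derz i) (symB h l) (4 * n) h^-1 (amp Cp r l h) a) ->
  L1 f -> L1 (fun y => `|f y| `^ r) -> Int (fun y => `|f y| `^ r / wt c h y) <= D ->
  L1 (fun x => \1_(box c W) x * `|Top a k f x| `^ r) /\
  Int (fun x => \1_(box c W) x * `|Top a k f x| `^ r) <=
    C `^ (r / 2) * Cp `^ r * 2 ^+ n * (((W * l) ^+ n) `^ (1 - r / 2) / (l * h) ^+ n * D).
Proof.
have [C C0 HC] := @piece_L2 R n n0; exists C => // r Cp l h W D c k a f r12 Cp0 l0 h0 W0 Wh D0 ja lf lfr fD.
have lh0 : 0 < (l * h) ^+ n by rewrite exprn_gt0// mulr_gt0.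
have A0 : 0 < amp Cp r l h by rewrite mulr_gt0// powR_gt0.
have ln0 : 0 < l ^+ n by rewrite exprn_gt0.
have [lU IU] := HC r D h l _ c k a f r12 D0 h0 l0 A0 ja lf lfr fD.
set E := C * _ in IU.
have E0 : 0 < E.
  exact: (mulr_gt0 C0 (mulr_gt0 (exprn_gt0 _ A0) (mulr_gt0 (powR_gt0 _ ln0) (powR_gt0 _ D0)))).
have w0 : 0 < (2 * W) ^+ n by rewrite exprn_gt0// mulr_gt0.
have [lB IB] := L1_box c (ltW W0).
have mT : mfn (Top a k f).
  exact: (Top_mfn k n0 l0 (jet_bd (ja (Ordinal n0))) lf).
have TU x : box c W x -> `|Top a k f x| <= `|boxbump (2 * n) c h x * Top a k f x|.
  by move=> bx; rewrite boxbump1// ?mul1r//; exact: box_sub bx.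
have IB' : Int (\1_(box c W) : V -> R) <= (2 * W) ^+ n by rewrite IB.
have [lT IT] := jensen r12 w0 E0 lB IB' mT lU IU TU.
split=> //; apply: (le_trans IT); exact: jensen_value.
Qed.

(** The factor [2 ^ n] accounts for a box of side [2 l] while the bound is normalized by [l ^ n]. *)
Lemma lr_bound_sup r (x0 : V) l Q M (u : V -> R) : 1 < r -> 0 < l -> 0 < Q -> 0 <= M -> mfn u ->
  (forall x, box x0 l x -> `|u x| <= M * Q `^ r^-1) -> lr_bound (box x0 l) r (l ^+ n * Q) u (M * 2 ^+ n).
Proof.
move=> r1 l0 Q0 M0 mu uM; have r0 : 0 < r by apply: lt_trans r1.
have [lB IB] := L1_box x0 (ltW l0).
have pw x : \1_(box x0 l) x * `|u x| `^ r <= M `^ r * Q * \1_(box x0 l) x.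
  have [bx|bx] := pselect (box x0 l x); last by rewrite indicE memNset// mul0r mulr0.
  rewrite indicE mem_set// mul1r mulr1.
  rewrite (_ : M `^ r * Q = (M * Q `^ r^-1) `^ r).
    by rewrite ge0_ler_powR ?nnegrE ?uM ?mulr_ge0 ?powR_ge0// ltW.
  by rewrite powRM ?powR_ge0// -powRrM mulVf ?gt_eqF// powRr1// ltW.
have l' : L1 (fun x => \1_(box x0 l) x * `|u x| `^ r).
  apply: (L1_dom _ (L1Z (M `^ r * Q) lB)); first exact: (lr_mfn _ (L1_mfn lB) mu).
  by move=> x; rewrite ger0_norm ?pw// mulr_ge0 ?powR_ge0.
split=> //; apply: (le_trans (Int_le l' (L1Z (M `^ r * Q) lB) pw)).
rewrite IntZ// IB exprMn [leLHS](_ : _ = M `^ r * 2 ^+ n * (l ^+ n * Q)); last by ring.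
rewrite ler_wpM2r//; first by rewrite mulr_ge0 ?exprn_ge0// ltW.
rewrite powRM ?exprn_ge0// ler_wpM2l ?powR_ge0//.
by rewrite le1r_powR ?(ltW r1)// exprn_ege1// ler1n.
Qed.

(** The weighted mass is [D = K h ^ n Q], and [amp * (l ^ n D) ^ (1 / r)] equals
    [Cp * (K Q) ^ (1 / r)]: the amplitude cancels all powers of [l h], and only the Lipschitz gain
    [e * l] is left. *)
Lemma Top_low : exists2 C, 0 < C & forall r Cp l h e Q x0 k (a : V * V -> R) f,
  1 < r <= 2 -> 0 < Cp -> 0 < l -> 0 < h -> 0 < e -> e <= h -> h^-1 <= l -> 0 < Q ->
  (forall i, jet (Derz i) (symB h l) (4 * n) h^-1 (amp Cp r l h) a) ->
  L1 f -> L1 (fun y => `|f y| `^ r) -> maxbound (fun y => `|f y| `^ r) x0 Q ->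
  lr_bound (box x0 e) r (e ^+ n * Q) (fun x => Top a k f x - Top a k f x0) (C * Cp * (e * l)).
Proof.
have [C C0 HC] := @piece_osc R n n0.
set K := (1 + n%:R) ^+ 2 * 9 ^+ n * (4 ^+ n * 2 ^+ n * 2) : R.
have K1 : 1 <= K.
  have n1 : 1 <= 1 + n%:R :> R by rewrite lerDl.
  by rewrite /K !mulr_ege1 ?exprn_ege1 ?ler1n.
have K0 : 0 < K := lt_le_trans ltr01 K1.
exists (C * K * 2 ^+ n); first by rewrite !mulr_gt0// exprn_gt0.
move=> r Cp l h e Q x0 k a f r12 Cp0 l0 h0 e0 eh hl Q0 ja lf lfr HM.
have /andP[r1 r2] := r12; have r0 : 0 < r by apply: lt_trans r1.
have F0 y : 0 <= `|f y| `^ r by exact: powR_ge0.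
have bx0 (W : R) : 0 < W -> box x0 W x0 by move=> W0 i; rewrite subrr normr0 ltW.
have fD := max_wt n0 (ltW Q0) h0 lfr F0 HM (bx0 h h0).
set D := (_ * _) in fD; have D0 : 0 < D by rewrite /D mulr_gt0// mulr_gt0// exprn_gt0.
have A0 : 0 < amp Cp r l h by rewrite mulr_gt0// powR_gt0// exprn_gt0// mulr_gt0.
have mT : mfn (Top a k f) by exact: (Top_mfn k n0 l0 (jet_bd (ja (Ordinal n0))) lf).
rewrite (_ : C * K * 2 ^+ n * Cp * (e * l) = C * K * Cp * (e * l) * 2 ^+ n); last by ring.
apply: lr_bound_sup => //.
- by rewrite !mulr_ge0// ltW.
- exact: measurable_funB mT (mfn_cont (@cts_cst _ _ _)).
move=> x bx.
have H := HC r D h l _ x0 k a f r12 D0 h0 l0 hl A0 ja lf lfr fD x x0 e (box_sub eh bx) (bx0 h h0) bx.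
apply: (le_trans H).
have X0 : 0 < (l * h) ^+ n by rewrite exprn_gt0// mulr_gt0.
have -> : amp Cp r l h * (l ^+ n * D) `^ r^-1 = Cp * (K `^ r^-1 * Q `^ r^-1).
  rewrite (_ : l ^+ n * D = (l * h) ^+ n * (K * Q)); last by rewrite exprMn /D -/K; ring.
  rewrite powRM ?mulr_ge0 ?(ltW X0) ?(ltW K0) ?(ltW Q0)// powRM ?(ltW K0) ?(ltW Q0)//.
  by rewrite /amp powRN; field; rewrite gt_eqF// powR_gt0.
rewrite [leRHS](_ : _ = C * (Cp * (K * Q `^ r^-1)) * (e * l)); last by ring.
have el0 : 0 <= e * l by rewrite mulr_ge0 ?ltW.
rewrite (ler_wpM2r el0)// (ler_wpM2l (ltW C0))// (ler_wpM2l (ltW Cp0))// ler_wpM2r ?powR_ge0//.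
by rewrite ler1_powR// invf_le1 ?(ltW r1).
Qed.
End local_estimates.

Section local_pieces.
Variables (R : realType) (n : nat).
Local Notation V := 'rV[R]_n.
Hypothesis n0 : (0 < n)%N.

(** Of the decay [y ^ (- n / 2)] only [y ^ (- 1 / 2)] is kept, which is enough for summation and
    does not depend on the dimension. The [+ 1] allows a constant to be replaced by its [r]-th
    power. *)
Lemma theta_bound (y r B : R) : 1 <= y -> 1 < r -> 0 <= B ->
  B * (y ^+ n) `^ (- (r / 2)) <= ((B + 1) * y `^ (- 2^-1)) `^ r.
Proof.
move=> y1 r1 B0; have r0 : 0 < r by apply: lt_trans r1.
have y0 : 0 < y := lt_le_trans ltr01 y1.
have s0 : 0 <= r / 2 by rewrite divr_ge0// ltW.
rewrite powRM ?powR_ge0 ?addr_ge0// -powRrM mulNr [2^-1 * r]mulrC.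
apply: ler_pM; rewrite ?powR_ge0//.
  by apply: (@le_trans _ _ (B + 1)); [rewrite lerDl|rewrite le1r_powR ?lerDr// ltW].
rewrite !powRN lef_pV2 ?posrE ?powR_gt0 ?exprn_gt0//.
rewrite ge0_ler_powR ?nnegrE ?exprn_ge0 ?(ltW y0)//.
by rewrite -[leLHS]expr1 ler_weXn2l.
Qed.

Lemma powR_sub1 (X s : R) : 0 < X -> X `^ (1 - s) / X = X `^ (- s).
Proof.
move=> X0; rewrite -{2}[X]powRr1 ?(ltW X0)// -powRB; last by rewrite (gt_eqF X0) implybT.
by congr (_ `^ _); ring.
Qed.

(** Jensen's inequality is used on a box of half side [e], smaller than the scale [h] of the L^2
    bound. The powers of [h] cancel between the amplitude and the weighted mass, leaving
    [(e l) ^ (- n r / 2)] times [e ^ n Q]. *)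
Lemma Top_mid (r Cp : R) : 1 < r <= 2 -> 0 < Cp -> exists2 K, 0 < K & forall l h e Q x0 k (a : V * V -> R) f,
  0 < l -> 0 < h -> 0 < e -> e <= h -> 1 <= e * l -> 0 < Q ->
  (forall i, jet (Derz i) (symB h l) (4 * n) h^-1 (amp n Cp r l h) a) ->
  L1 f -> L1 (fun y => `|f y| `^ r) -> maxbound (fun y => `|f y| `^ r) x0 Q ->
  lr_bound (box x0 e) r (e ^+ n * Q) (Top a k f) (K * (e * l) `^ (- 2^-1)).
Proof.
move=> r12 Cp0; have /andP[r1 r2] := r12; have r0 : 0 < r by apply: lt_trans r1.
have [C C0 HC] := @Top_local_lr R n n0.
set Km := (1 + n%:R) ^+ 2 * 9 ^+ n * (4 ^+ n * 2 ^+ n * 2) : R.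
have Km0 : 0 < Km by rewrite /Km !mulr_gt0 ?exprn_gt0// ltr_pwDl.
set B := C `^ (r / 2) * Cp `^ r * 2 ^+ n.
have B0 : 0 <= B by rewrite /B mulr_ge0 ?exprn_ge0// mulr_ge0 ?powR_ge0.
exists (B * Km + 1); first by rewrite ltr_wpDl// mulr_ge0// ltW.
move=> l h e Q x0 k a f l0 h0 e0 eh el1 Q0 ja lf lfr HM.
have F0 y : 0 <= `|f y| `^ r by exact: powR_ge0.
have bx0 : box x0 h x0 by move=> i; rewrite subrr normr0 ltW.
have fD := max_wt n0 (ltW Q0) h0 lfr F0 HM bx0; rewrite -/Km in fD.
set D := (_ * _) in fD; have D0 : 0 < D by rewrite /D mulr_gt0// mulr_gt0// exprn_gt0.
have [lT IT] := HC r Cp l h e D x0 k a f r12 Cp0 l0 h0 e0 eh D0 ja lf lfr fD.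
have mT : mfn (Top a k f) by exact: (Top_mfn k n0 l0 (jet_bd (ja (Ordinal n0))) lf).
split=> //; apply: (le_trans IT); rewrite -/B.
have X0 : 0 < (e * l) ^+ n by rewrite exprn_gt0// mulr_gt0.
have E0 : 0 <= e ^+ n * Q by rewrite mulr_ge0 ?exprn_ge0// ltW.
rewrite [leLHS](_ : _ = B * Km * ((e * l) ^+ n) `^ (- (r / 2)) * (e ^+ n * Q)); last first.
  rewrite -(powR_sub1 _ X0) /D; move: (((e * l) ^+ n) `^ (1 - r / 2)) => P; rewrite !exprMn.
  have ln : l ^+ n != 0 by rewrite gt_eqF// exprn_gt0.
  have hn : h ^+ n != 0 by rewrite gt_eqF// exprn_gt0.
  have en : e ^+ n != 0 by rewrite gt_eqF// exprn_gt0.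
  by field; rewrite ln hn en.
rewrite (ler_wpM2r E0)//; apply: theta_bound => //.
by rewrite mulr_ge0// ltW.
Qed.

Lemma rel_joint i h : continuous (fun p : V * V => rel p.1 h i p.2).
Proof.
by apply: ctsM; [apply: ctsB; [exact: coord_cont2|exact: coord_cont1]|exact: cts_cst].
Qed.

Lemma wtV_joint h : continuous (fun p : V * V => (wt p.1 h p.2)^-1).
Proof.
apply: ctsV; last by move=> p; rewrite gt_eqF// wt_gt0.
apply: ctsD; first exact: cts_cst.
by apply: continuous_sum => i; apply: ctsX; exact: rel_joint.
Qed.

Lemma boxbump_joint p L : continuous (fun q : V * V => boxbump p q.2 L q.1).
Proof.
apply: continuous_prod => i; apply: (cts_comp (f := fun q : V * V => (q.1 ord0 i - q.2 ord0 i) / L)).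
  by apply: ctsM; [apply: ctsB; [exact: coord_cont1|exact: coord_cont2]|exact: cts_cst].
by have [A _ /jet_bd[]] := @bump_jet R p.
Qed.

(** After exchanging the integrals, [wtV_split] leaves one factor centered at [c], whose integral
    over the centers is a multiple of [h ^ n], and one factor centered at [x0] at scale [e], which
    the maximal bound absorbs. *)
Lemma wt_average x0 h e Q (F : V -> R) : 0 < h -> h <= e -> 0 < Q -> L1 F -> (forall y, 0 <= F y) ->
  maxbound F x0 Q ->
  L1 (fun c => \1_(box x0 (2 * e)) c * Int (fun y => F y / wt c h y)) /\
  Int (fun c => \1_(box x0 (2 * e)) c * Int (fun y => F y / wt c h y)) <=
    (1 + n%:R) ^+ 2 * 9 ^+ n * 2 ^+ n * pi ^+ n * (4 ^+ n * 2 ^+ n * 2) * (h ^+ n * (e ^+ n * Q)).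
Proof.
move=> h0 he Q0 lF F0 HM; have e0 : 0 < e := lt_le_trans h0 he.
have e20 : 0 <= 2 * e by rewrite mulr_ge0// ltW.
have [lB IB] := L1_box x0 e20; set G2 := \1_(box x0 (2 * e)) in lB IB *.
have G0 c : 0 <= G2 c by rewrite /G2 indicE.
have wV0 c y : 0 <= (wt c h y)^-1 by rewrite invr_ge0 ltW// wt_gt0.
have wV1 c y : (wt c h y)^-1 <= 1 by rewrite invf_le1 ?wt_gt0// wt_ge1.
have lw c : L1 (fun y => F y / wt c h y).
  apply: (L1_dom _ lF); first exact: (measurable_funM (L1_mfn lF) (mfn_cont (@wtV_cts R n c h))).
  by move=> y; rewrite ger0_norm ?mulr_ge0// ler_piMr.
have mG : mfn2 (fun c y => G2 c * (F y / wt c h y)).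
  apply: mfn2M; first exact: mfn2_fst (L1_mfn lB).
  apply: mfn2M; first exact: mfn2_snd (L1_mfn lF).
  by apply: mfn2_cont; exact: wtV_joint.
have dG c y : `|G2 c * (F y / wt c h y)| <= G2 c * F y.
  by rewrite ger0_norm ?mulr_ge0// ler_wpM2l// ler_piMr.
have [l1 l2 E12] := fubini2 mG lB lF dG.
have EG : (fun c => Int (fun y => G2 c * (F y / wt c h y))) = (fun c => G2 c * Int (fun y => F y / wt c h y)).
  by apply/funext => c; rewrite IntZ.
rewrite EG in l1 E12; split=> //; rewrite E12.
set Kw := (1 + n%:R) ^+ 2 * 9 ^+ n.
have Kw0 : 0 <= Kw by rewrite /Kw mulr_ge0 ?exprn_ge0// addr_ge0.
have hi0 : 0 < h^-1 by rewrite invr_gt0.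
have w2V0 c h' y : 0 <= (wt2 c h' y : R)^-1 by rewrite invr_ge0 ltW// wt2_gt0.
have lw2 : L1 (fun y => F y / wt2 x0 e y).
  apply: (L1_dom _ lF); first exact: (measurable_funM (L1_mfn lF) (wt2V_mfn x0 e)).
  by move=> y; rewrite ger0_norm ?mulr_ge0// ler_piMr// invf_le1 ?wt2_gt0// wt2_ge1.
have inner y : Int (fun c => G2 c * (F y / wt c h y)) <= Kw * 2 ^+ n * (pi / h^-1) ^+ n * (F y / wt2 x0 e y).
  have [lP IP] := L1_Pk y hi0.
  rewrite -IP [leRHS](_ : _ = Kw * 2 ^+ n * (F y / wt2 x0 e y) * Int (fun c => Pk h^-1 (c - y))); last by ring.
  rewrite -(IntZ _ lP); apply: Int_le; last 1 first.
  - move=> c; have K2 : 0 <= Kw * 2 ^+ n * (F y / wt2 x0 e y) * Pk h^-1 (c - y).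
      by rewrite mulr_ge0 ?Pk_ge0// mulr_ge0 ?mulr_ge0// exprn_ge0.
    have [bc|bc] := pselect (box x0 (2 * e) c); last by rewrite /G2 indicE memNset// mul0r.
    rewrite /G2 indicE mem_set// mul1r.
    rewrite [leRHS](_ : _ = F y * (Kw * (2 ^+ n * Pk h^-1 (c - y) * (wt2 x0 e y)^-1))); last by ring.
    rewrite ler_wpM2l//; apply: (le_trans (wtV_split y h0 he bc)).
    rewrite (ler_wpM2l Kw0)// ler_wpM2r// -PkN opprB; exact: wt2V_Pk.
  - apply: (L1_dom _ (L1Z (F y) lB)); first exact: (mfn2_l y mG).
    by move=> c; rewrite [leRHS]mulrC; exact: dG.
  - exact: L1Z.
have KK0 : 0 <= Kw * 2 ^+ n * (pi / h^-1) ^+ n by rewrite !mulr_ge0 ?exprn_ge0// divr_ge0 ?pi_ge0// ltW.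
apply: (le_trans (Int_le l2 (L1Z (Kw * 2 ^+ n * (pi / h^-1) ^+ n) lw2) inner)); rewrite (IntZ _ lw2).
have bx0 : box x0 e x0 by move=> i; rewrite subrr normr0 ltW.
apply: (le_trans (ler_wpM2l KK0 (max_wt2 n0 (ltW Q0) e0 lF F0 HM bx0))).
rewrite invrK exprMn le_eqVlt; apply/orP; left; apply/eqP; by ring.
Qed.
End local_pieces.

(** * Boxes larger than the scale of the piece *)

Section large_cubes.
Variables (R : realType) (n : nat).
Local Notation V := 'rV[R]_n.
Hypothesis n0 : (0 < n)%N.

Lemma box_sym (c x : V) L : box c L x -> box x L c.
Proof. by move=> b i; rewrite distrC. Qed.

(* The average runs over the center [c] of a box of side [h]; its indicator is
   replaced by a bump function to be jointly measurable in [c] and [x]. *)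
Lemma Top_high (r Cp : R) : 1 < r <= 2 -> 0 < Cp -> exists2 K, 0 < K & forall l h e Q x0 k (a : V * V -> R) f,
  0 < l -> 0 < h -> h <= e -> h^-1 <= l -> 0 < Q ->
  (forall i, jet (Derz i) (symB h l) (4 * n) h^-1 (amp n Cp r l h) a) ->
  L1 f -> L1 (fun y => `|f y| `^ r) -> maxbound (fun y => `|f y| `^ r) x0 Q ->
  lr_bound (box x0 e) r (e ^+ n * Q) (Top a k f) (K * (l * h) `^ (- 2^-1)).
Proof.
move=> r12 Cp0; have /andP[r1 r2] := r12; have r0 : 0 < r by apply: lt_trans r1.
have [C C0 HC] := @Top_local_lr R n n0.
set Kw := (1 + n%:R) ^+ 2 * 9 ^+ n * 2 ^+ n * pi ^+ n * (4 ^+ n * 2 ^+ n * 2) : R.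
have X0 p (b : R) : 0 <= b -> 0 <= b ^+ p by move=> b0; rewrite exprn_ge0.
have Kw0 : 0 <= Kw.
  have p0 := X0 n _ (pi_ge0 R); rewrite /Kw; move: (pi ^+ n) p0 => P P0.
  by rewrite !mulr_ge0 ?X0 ?addr_ge0.
set B := C `^ (r / 2) * Cp `^ r * 2 ^+ n.
have B0 : 0 <= B by rewrite /B mulr_ge0 ?exprn_ge0// mulr_ge0 ?powR_ge0.
have BK0 : 0 <= B * (Kw + 4 ^+ n) by rewrite mulr_ge0 ?addr_ge0 ?exprn_ge0.
exists (B * (Kw + 4 ^+ n) + 1); first by rewrite ltr_wpDl.
move=> l h e Q x0 k a f l0 h0 he hl Q0 ja lf lfr HM.
have e0 : 0 < e := lt_le_trans h0 he.
pose F (y : V) := `|f y| `^ r.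
have F0 y : 0 <= F y by exact: powR_ge0.
have e20 : 0 <= 2 * e by rewrite mulr_ge0// ltW.
have [lB2 IB2] := L1_box x0 e20; have [lB1 _] := L1_box x0 (ltW e0).
have [lA IA] := wt_average n0 h0 he Q0 lfr F0 HM.
rewrite -/Kw in IA.
(* The second summand keeps [D c] positive, as the local estimate requires; averaged over the
   centers it is of the same order as the main term. *)
pose D c := Int (fun y => F y / wt c h y) + h ^+ n * Q.
have hQ0 : 0 < h ^+ n * Q by exact: mulr_gt0 (exprn_gt0 _ h0) Q0.
have D0 c : 0 < D c.
  rewrite ltr_wpDl//; apply: Int_ge0 => y; rewrite mulr_ge0 ?F0// invr_ge0.
  exact: (ltW (wt_gt0 _ _ _)).
have ID c : Int (fun y => F y / wt c h y) <= D c by rewrite /D lerDl (ltW hQ0).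
have lh0 : 0 < (l * h) ^+ n by rewrite exprn_gt0// mulr_gt0.
pose B' := B * ((l * h) ^+ n) `^ (- (r / 2)).
have B'0 : 0 <= B' by rewrite mulr_ge0 ?powR_ge0.
pose W x := `|Top a k f x| `^ r.
have W0 x : 0 <= W x by exact: powR_ge0.
have mT : mfn (Top a k f) by exact: (Top_mfn k n0 l0 (jet_bd (ja (Ordinal n0))) lf).
have loc c : L1 (fun x => \1_(box c h) x * W x) /\ Int (fun x => \1_(box c h) x * W x) <= B' * D c.
  have [l1 l2] := HC r Cp l h h (D c) c k a f r12 Cp0 l0 h0 h0 (lexx h) (D0 c) ja lf lfr (ID c).
  split=> //; apply: (le_trans l2); rewrite [h * l]mulrC (powR_sub1 _ lh0) -/B mulrA; exact: lexx.
(* Supported in [box c h], where the local estimate holds, and equal to [1] on the box of half side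
   [h / 2]. *)
pose phi (c x : V) := boxbump (2 * n) c (h / 2) x.
have h20 : 0 < h / 2 by rewrite divr_gt0.
have phi01 c x : 0 <= phi c x <= 1 by exact: boxbump_itv.
have phile c x : phi c x <= \1_(box c h) x.
  have [bx|bx] := pselect (box c h x).
    by rewrite indicE mem_set//; have /andP[] := phi01 c x.
  have hE : 2 * (h / 2) = h by rewrite mulrCA divff ?mulr1.
  by rewrite /phi boxbump0 ?hE// indicE.
pose G2 := \1_(box x0 (2 * e)) : V -> R.
have G0 c : 0 <= G2 c by rewrite /G2 indicE.
have G1 c : G2 c <= 1 by have /andP[] := indic01 (box x0 (2 * e)) c.
pose H x c := \1_(box x0 e) x * W x * (phi c x * G2 c).
have i1 x : 0 <= \1_(box x0 e) x :> R by rewrite indicE.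
have i2 x : \1_(box x0 e) x <= 1 :> R by have /andP[] := indic01 (box x0 e) x.
have mW1 : mfn (fun x => \1_(box x0 e) x * W x) by exact: lr_mfn (L1_mfn lB1) mT.
have mH : mfn2 H.
  apply: mfn2M; first exact: mfn2_fst.
  apply: mfn2M; last exact: mfn2_snd (L1_mfn lB2).
  by apply: mfn2_cont; exact: boxbump_joint.
have H0 x c : 0 <= H x c.
  by have /andP[p0 _] := phi01 c x; exact: (mulr_ge0 (mulr_ge0 (i1 x) (W0 x)) (mulr_ge0 p0 (G0 c))).
have lHx x : L1 (H x).
  apply: (L1_dom _ (L1Z (\1_(box x0 e) x * W x) lB2)); first exact: mfn2_r.
  move=> c; rewrite ger0_norm// /H ler_wpM2l ?mulr_ge0//.
  by have /andP[_ p1] := phi01 c x; rewrite ler_piMl.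
have dH x c : H x c <= G2 c * (\1_(box c h) x * W x).
  rewrite /H [leLHS](_ : _ = \1_(box x0 e) x * (G2 c * (phi c x * W x))); last by ring.
  have s1 : 0 <= G2 c * (phi c x * W x).
    by have /andP[p0 _] := phi01 c x; exact: (mulr_ge0 (G0 c) (mulr_ge0 p0 (W0 x))).
  apply: (le_trans (ler_piMl s1 (i2 x))); rewrite (ler_wpM2l (G0 c))//.
  by rewrite ler_wpM2r.
have lHc c : L1 (H^~ c).
  apply: (L1_dom _ (L1Z (G2 c) (loc c).1)); first exact: mfn2_l.
  by move=> x; rewrite ger0_norm// dH.
pose u c := B' * (G2 c * Int (fun y => F y / wt c h y)) + B' * (h ^+ n * Q) * G2 c.
have lu : L1 u by exact: L1D (L1Z _ lA) (L1Z _ lB2).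
have Hu c : Int (H^~ c) <= u c.
  apply: (le_trans (Int_le (lHc c) (L1Z (G2 c) (loc c).1) (dH^~ c))).
  rewrite (IntZ _ (loc c).1); apply: (le_trans (ler_wpM2l (G0 c) (loc c).2)).
  rewrite /u /D le_eqVlt; apply/orP; left; apply/eqP; by ring.
have Iu : Int u <= B' * (Kw + 4 ^+ n) * (h ^+ n * (e ^+ n * Q)).
  rewrite /u (IntD (L1Z _ lA) (L1Z _ lB2)) (IntZ _ lA) (IntZ _ lB2) IB2.
  apply: (le_trans (lerD (ler_wpM2l B'0 IA) (lexx _))).
  rewrite le_eqVlt; apply/orP; left; apply/eqP.
  rewrite (_ : 2 * (2 * e) = 4 * e) ?exprMn; by ring.
(* For [x] in the large box the centers [c] with [|x_i - c_i| <= h / 2] fill a cube of side [h],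
   contained in the doubled box because [h <= e]. *)
have low x : h ^+ n * (\1_(box x0 e) x * W x) <= Int (H x).
  have [bx|bx] := pselect (box x0 e x); last first.
    have -> : \1_(box x0 e) x = 0 :> R by rewrite indicE memNset.
    by rewrite mul0r mulr0; apply: Int_ge0 => c; exact: H0.
  have [lb Ib] := L1_box x (ltW h20).
  have {}Ib : Int (\1_(box x (h / 2)) : V -> R) = h ^+ n by rewrite Ib; congr (_ ^+ _); field.
  rewrite -Ib.
  rewrite mulrC -(IntZ _ lb); apply: (Int_le (L1Z _ lb) (lHx x)).
  move=> c; apply: (ler_wpM2l (mulr_ge0 (i1 x) (W0 x))).
  have [bc|bc] := pselect (box x (h / 2) c); last first.
    have -> : \1_(box x (h / 2)) c = 0 :> R by rewrite indicE memNset.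
    by have /andP[p0 _] := phi01 c x; exact: (mulr_ge0 p0 (G0 c)).
  have -> : \1_(box x (h / 2)) c = 1 :> R by rewrite indicE mem_set.
  have -> : phi c x = 1 by exact: (boxbump1 _ h20 (box_sym bc)).
  suff -> : G2 c = 1 by rewrite mulr1.
  rewrite /G2 indicE mem_set // => i; clear Ib IB2.
  rewrite -(subrK (x ord0 i) (c ord0 i)) -addrA.
  apply: (le_trans (ler_normD _ _)); apply: (le_trans (lerD (bc i) (bx i))).
  clear -he h0; lra.
have hn0 : 0 < h ^+ n by rewrite exprn_gt0.
have [lIx lIc EI] := tonelli2 mH H0 lHx lHc lu Hu.
have up x : \1_(box x0 e) x * W x <= h ^- n * Int (H x).
  rewrite [leRHS]mulrC (ler_pdivlMr _ _ hn0) mulrC; exact: low.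
have lW : L1 (fun x => \1_(box x0 e) x * W x).
  apply: (L1_dom mW1 (L1Z (h ^- n) lIx)).
  by move=> x; rewrite (ger0_norm (mulr_ge0 (i1 x) (W0 x))); exact: up.
split; [exact: mT|exact: lW|]; apply: (le_trans (Int_le lW (L1Z (h ^- n) lIx) up)); rewrite (IntZ _ lIx) EI.
have lIu : Int (fun c => Int (H^~ c)) <= Int u by exact: Int_le.
have hV0 : 0 <= h ^- n by rewrite invr_ge0 ltW.
apply: (le_trans (ler_wpM2l hV0 (le_trans lIu Iu))).
clear EI; have E0 : 0 <= e ^+ n * Q by rewrite mulr_ge0 ?exprn_ge0// ltW.
rewrite [leLHS](_ : _ = B * (Kw + 4 ^+ n) * ((l * h) ^+ n) `^ (- (r / 2)) * (e ^+ n * Q)); last first.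
  by rewrite /B'; field; rewrite gt_eqF.
rewrite (ler_wpM2r E0)//; apply: theta_bound => //.
by rewrite -(ler_pdivrMr _ _ h0) mul1r; exact: hl.
Qed.
End large_cubes.

(** * Summation over dyadic frequencies *)

Section dyadic_sums.
Variable R : realType.

(* The increments of [ramp] along [t, 2 t, 4 t] and so on dominate [theta], so that
   dyadic sums of [theta] telescope. *)
Definition theta (t : R) := if t < 1 then t else t `^ (- 2^-1).
Definition ramp (t : R) := Num.sqrt t / (1 + Num.sqrt t).

Lemma theta_gt0 t : 0 < t -> 0 < theta t.
Proof. by move=> t0; rewrite /theta; case: ifP => // _; exact: powR_gt0. Qed.

(** With [s] the square root of [t] and [q] that of [2], the increment is
    [(q - 1) s / ((1 + q s) (1 + s))]. The denominator is at most [5] for [s < 1] and at most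
    [5 s ^ 2] otherwise, and [13 (q - 1) >= 5]. *)
Lemma theta_ramp t : 0 < t -> theta t <= 13 * (ramp (2 * t) - ramp t).
Proof.
move=> t0; rewrite /ramp sqrtrM//; set q := Num.sqrt 2; set s := Num.sqrt t.
have q0 : 0 <= q by exact: sqrtr_ge0.
have q2 : q ^+ 2 = 2 by rewrite sqr_sqrtr.
have s0 : 0 < s by rewrite sqrtr_gt0.
have s2 : s ^+ 2 = t by rewrite sqr_sqrtr// ltW.
have q14 : 14 / 10 <= q.
  rewrite -(@ler_pXn2r _ 2)// ?nnegrE// ?divr_ge0// q2; clear; lra.
have q15 : q <= 15 / 10.
  rewrite -(@ler_pXn2r _ 2)// ?nnegrE// ?divr_ge0// q2; clear; lra.
have d1 : 0 < 1 + s by rewrite addr_gt0.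
have d2 : 0 < 1 + q * s by rewrite ltr_pwDl// mulr_ge0// ltW.
have -> : 13 * (q * s / (1 + q * s) - s / (1 + s)) = 13 * (q - 1) * s / ((1 + q * s) * (1 + s)).
  by field; rewrite !gt_eqF.
rewrite ler_pdivlMr ?mulr_gt0//.
have thE : theta t = if s < 1 then s ^+ 2 else s^-1.
  rewrite /theta powRN powR12_sqrt ?(ltW t0)// -/s -s2.
  by rewrite expr_lt1 ?(ltW s0).
rewrite thE; case: ltP => s1.
  rewrite [leLHS](_ : _ = s * (s * ((1 + q * s) * (1 + s)))); last by ring.
  rewrite [leRHS]mulrC ler_pM2l//.
  have h1 : (1 + q * s) * (1 + s) <= 5 / 2 * 2.
    have a1 : 1 + q * s <= 5 / 2.
      have := ler_pM q0 (ltW s0) q15 (ltW s1); clear; lra.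
    have a2 : 1 + s <= 2 by clear -s1; lra.
    exact: (ler_pM (ltW d2) (ltW d1) a1 a2).
  apply: (@le_trans _ _ (1 * (5 / 2 * 2))); first exact: (ler_pM (ltW s0) (mulr_ge0 (ltW d2) (ltW d1)) (ltW s1) h1).
  by clear -q14; lra.
rewrite mulrC ler_pdivrMr//.
have h1 : (1 + q * s) * (1 + s) <= 5 / 2 * s * (2 * s).
  have a1 : 1 + q * s <= 5 / 2 * s.
    have := ler_wpM2r (ltW s0) q15; move: s1; clear; lra.
  have a2 : 1 + s <= 2 * s by clear -s1; lra.
  exact: (ler_pM (ltW d2) (ltW d1) a1 a2).
apply: (le_trans h1).
have -> : 5 / 2 * s * (2 * s) = 5 * (s * s) by field.
rewrite -[leRHS]mulrA ler_wpM2r ?mulr_ge0 ?(ltW s0)//.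
by clear -q14; lra.
Qed.

Lemma ramp_bound t : 0 <= ramp t <= 1.
Proof.
have s0 : 0 <= Num.sqrt t by exact: sqrtr_ge0.
by rewrite /ramp divr_ge0 ?addr_ge0//= ler_pdivrMr ?mul1r ?lerDr// ltr_pwDl.
Qed.

Lemma theta_sum e J : 0 < e -> \sum_(j < J) theta (e * 2 ^+ j) <= 13.
Proof.
move=> e0; apply: (@le_trans _ _ (13 * (ramp (e * 2 ^+ J) - ramp e))).
  elim: J => [|J IH]; first by rewrite big_ord0 expr0 mulr1 subrr mulr0.
  rewrite big_ord_recr /=.
  have t0 : 0 < e * 2 ^+ J by rewrite mulr_gt0// exprn_gt0.
  apply: (le_trans (lerD IH (theta_ramp t0))).
  by rewrite -mulrDr exprS mulrCA addrC addrA subrK.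
rewrite -[leRHS]mulr1 ler_wpM2l//.
have /andP[_ a] := ramp_bound (e * 2 ^+ J); have /andP[b _] := ramp_bound e.
by rewrite (le_trans _ a)// gerBl.
Qed.

Lemma geometric_sum (q : R) J : 0 <= q < 1 -> \sum_(j < J) q ^+ j <= (1 - q)^-1.
Proof.
move=> /andP[q0 q1]; have p0 : 0 < 1 - q by rewrite subr_gt0.
apply: (@le_trans _ _ ((1 - q ^+ J) / (1 - q))); last first.
  by rewrite ler_piMl ?invr_ge0 ?(ltW p0)// gerBl exprn_ge0.
elim: J => [|J IH]; first by rewrite big_ord0 expr0 subrr mul0r.
rewrite big_ord_recr /=; apply: (le_trans (lerD IH (lexx _))).
rewrite le_eqVlt; apply/orP; left; apply/eqP; rewrite exprS; field.
by rewrite gt_eqF.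
Qed.

Lemma dyad_ratio (rho : R) j :
  (2 ^+ j * (2 ^+ j) `^ (- rho)) `^ (- 2^-1) = (2 `^ (- ((1 - rho) / 2))) ^+ j.
Proof.
have l0 : 0 < 2 ^+ j :> R by rewrite exprn_gt0.
rewrite -{1}[2 ^+ j]powRr1 ?(ltW l0)// -powRD; last by rewrite (gt_eqF l0) implybT.
rewrite -[RHS](powR_mulrn _ (powR_ge0 _ _)) -!powRrM -(powR_mulrn j (ler0n R 2)) -powRrM.
by congr (_ `^ _); field.
Qed.
End dyadic_sums.

Section summation.
Variables (R : realType) (n : nat).
Local Notation V := 'rV[R]_n.
Hypothesis n0 : (0 < n)%N.
Variables (m rho r : R) (g : 'rV[R]_(n + n) -> R).
Hypotheses (sg : real_symbol m rho g) (rho01 : 0 < rho < 1) (r12 : 1 < r <= 2)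
  (mr : m <= - ((n%:R / r) * (1 - rho))).

Definition sympiece j (p : V * V) := jder g [::] p * dyad j p.2.

Lemma dyadic_sum : exists2 K, 0 < K & forall k (f : V -> R) x0 Q e, 0 < e -> 0 < Q ->
  L1 f -> L1 (fun y => `|f y| `^ r) -> maxbound (fun y => `|f y| `^ r) x0 Q ->
  exists c : nat -> R, (forall j, 1 <= e * 2 ^+ j -> c j = 0) /\
  forall J, lr_bound (box x0 e) r (e ^+ n * Q) (fun x => \sum_(j < J.+1) (Top (sympiece j) k f x - c j)) K.
Proof.
have /andP[r1 r2] := r12; have r0 : 0 < r by apply: lt_trans r1.
have [Cp Cp0 HC] := symbol_piece n0 sg rho01 r1 mr.
have /andP[rho0 rho1] := rho01.
have [K1 K10 H1] := @Top_low R n n0.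
have [K2 K20 H2] := @Top_mid R n n0 r Cp r12 Cp0.
have [K3 K30 H3] := @Top_high R n n0 r Cp r12 Cp0.
(* The ratio of the values of [(l h) ^ (- 1 / 2)] for consecutive [j], less than [1] because
   [rho < 1]. *)
pose q : R := 2 `^ (- ((1 - rho) / 2)).
have q0 : 0 < q by exact: powR_gt0.
have q1 : q < 1.
  have d : 0 < (1 - rho) / 2 by rewrite divr_gt0// subr_gt0.
  rewrite /q powRN invf_lt1 ?powR_gt0// -[ltLHS](congr1 (@^~ ((1 - rho) / 2)) (powR1 R)).
  by apply: gt0_ltr_powR; rewrite ?nnegrE ?ltr1n.
pose K := K1 * Cp + K2 + K3; have K0 : 0 < K by rewrite !addr_gt0// mulr_gt0.
exists (K * (13 + (1 - q)^-1)); first by rewrite mulr_gt0// addr_gt0// invr_gt0 subr_gt0.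
move=> k f x0 Q e e0 Q0 lf lfr HM.
exists (fun j => if e * 2 ^+ j < 1 then Top (sympiece j) k f x0 else 0).
split; first by move=> j ej; rewrite ltNge ej.
move=> J; have D0 : 0 <= e ^+ n * Q by rewrite mulr_ge0 ?exprn_ge0// ltW.
have mB : mfn (\1_(box x0 e) : V -> R) by exact: (L1_mfn (L1_box x0 (ltW e0)).1).
(* Every [j] is charged with both quantities, whatever its regime, so the two series can be summed
   separately and uniformly in [e]. *)
pose t j := K * (theta (e * 2 ^+ j) + q ^+ j).
have p2 j : 0 < 2 ^+ j :> R by rewrite exprn_gt0.
have th0 j : 0 < theta (e * 2 ^+ j) by apply: theta_gt0; rewrite mulr_gt0.
have t0 j : 0 < t j by rewrite /t mulr_gt0// addr_gt0// exprn_gt0.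
have key j : lr_bound (box x0 e) r (e ^+ n * Q)
    (fun x => Top (sympiece j) k f x - (if e * 2 ^+ j < 1 then Top (sympiece j) k f x0 else 0)) (t j).
  pose l : R := 2 ^+ j; pose h := l `^ (- rho).
  have l1 : 1 <= l by rewrite exprn_ege1// ler1n.
  have l0 : 0 < l by exact: p2.
  have h0 : 0 < h by exact: powR_gt0.
  have hl : h^-1 <= l by rewrite /h powRN invrK ler1_powR// ltW.
  have ja i : jet (Derz i) (symB h l) (4 * n) h^-1 (amp n Cp r l h) (sympiece j) by exact: HC.
  have Kge (K' : R) s : 0 <= K' -> K' <= K -> 0 <= s -> s <= theta (e * 2 ^+ j) + q ^+ j -> K' * s <= t j.
    by move=> K'0 K'K s0 st; exact: ler_pM.
  have qj0 : 0 <= q ^+ j by rewrite exprn_ge0// ltW.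
  have K12 : 0 <= K1 * Cp by rewrite mulr_ge0 ?ltW.
  case: ltP => ej.
    (* In the low-frequency regime [e < 1 / l <= h], so the box is within the scale of the piece. *)
    have eh : e <= h.
      apply: (@le_trans _ _ l^-1); last by rewrite -(invrK h) lef_pV2 ?posrE ?invr_gt0.
      by rewrite -[leRHS]mul1r ler_pdivlMr// ltW.
    have := H1 r Cp l h e Q x0 k (sympiece j) f r12 Cp0 l0 h0 e0 eh hl Q0 ja lf lfr HM.
    have el0 : 0 <= e * l by rewrite mulr_ge0 ?ltW.
    apply: (lr_bound_mono (ltW r0) D0); first by rewrite mulr_ge0.
    apply: Kge => //; first by rewrite /K -addrA lerDl addr_ge0 ?ltW.
    by rewrite /theta ej lerDl.
  have E : (fun x => Top (sympiece j) k f x - 0) = Top (sympiece j) k f by apply/funext => x; rewrite subr0.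
  rewrite E; have [eh|eh] := leP e h.
    have := H2 l h e Q x0 k (sympiece j) f l0 h0 e0 eh ej Q0 ja lf lfr HM.
    apply: (lr_bound_mono (ltW r0) D0); first by rewrite mulr_ge0 ?powR_ge0 ?ltW.
    apply: Kge; [exact: ltW| |exact: powR_ge0|].
      by rewrite /K addrAC lerDr; exact: (addr_ge0 K12 (ltW K30)).
    by rewrite /theta ltNge ej lerDl.
  have := H3 l h e Q x0 k (sympiece j) f l0 h0 (ltW eh) hl Q0 ja lf lfr HM.
  apply: (lr_bound_mono (ltW r0) D0); first by rewrite mulr_ge0 ?powR_ge0 ?ltW.
  apply: Kge; [exact: ltW| |exact: powR_ge0|].
    by rewrite /K lerDr; exact: (addr_ge0 K12 (ltW K20)).
  rewrite (_ : (l * h) `^ _ = q ^+ j); first by rewrite lerDr ltW.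
  exact: dyad_ratio.
have := lr_bound_sum J mB (ltW r1) D0 t0 key.
apply: (lr_bound_mono (ltW r0) D0); first by apply: sumr_ge0 => j _; exact: ltW.
rewrite /t -mulr_sumr ler_wpM2l ?(ltW K0)// big_split /=.
by rewrite lerD ?theta_sum// geometric_sum// (ltW q0).
Qed.
End summation.

(** * From finitely many pieces to the whole symbol *)

Section full_operator.
Variables (R : realType) (n : nat).
Local Notation V := 'rV[R]_n.
Hypothesis n0 : (0 < n)%N.

Lemma boxbump_cts p (c : V) L : continuous (boxbump p c L).
Proof. by apply: (slice_cts (f := fun q : V * V => boxbump p q.2 L q.1)); exact: boxbump_joint. Qed.

(** Dominated convergence: each [z] eventually lies where the bump equals [1]. *)
Lemma tail_small p (H : V -> R) eps : 0 < eps -> L1 H -> (forall z, 0 <= H z) ->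
  exists J0, forall J, (J0 <= J)%N -> Int (fun z => H z * (1 - boxbump p 0 (2 ^+ J) z)) <= eps.
Proof.
move=> e0 lH H0.
pose f J (z : V) := H z * (1 - boxbump p 0 (2 ^+ J) z).
have f01 J z : 0 <= f J z <= H z.
  have /andP[b0 b1] := boxbump_itv p 0 (2 ^+ J) z.
  by rewrite /f mulr_ge0 ?subr_ge0//= ler_piMr// gerBl.
have mf J : mfn (f J).
  exact: (measurable_funM (L1_mfn lH) (mfn_cont (ctsB (@cts_cst _ _ _) (@boxbump_cts p 0 (2 ^+ J))))).
have lf J : L1 (f J).
  by apply: (L1_dom (mf J) lH) => z; have /andP[f0 f1] := f01 J z; rewrite ger0_norm.
have ev z : exists J0, forall J, (J0 <= J)%N -> f J z = 0.
  have [N HN] : exists N : nat, forall i, `|z ord0 i| <= N%:R.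
    have HN := truncnS_gt (\sum_i `|z ord0 i|).
    exists (Num.truncn (\sum_i `|z ord0 i|)).+1 => i; apply: le_trans (ltW HN).
    by rewrite (bigD1 i)//= lerDl sumr_ge0.
  exists N => J NJ; rewrite /f boxbump1 ?subrr ?mulr0 ?exprn_gt0// => i.
  rewrite mxE subr0; have HNi := HN i; apply: (le_trans HNi).
  rewrite -natrX ler_nat (leq_trans NJ)// ltnW// ltn_expl//.
have cv : (fun J => Int (f J)) @ \oo --> (0 : R).
  pose M := model R n; pose mu := mmu M.
  have : (fun J => \int[mu]_t (f J (mv t))%:E)%E @ \oo --> (\int[mu]_t (0 : \bar R))%E.
    apply: (@dominated_cvg _ _ _ mu setT measurableT (fun J t => (f J (mv t))%:E) (cst 0%E) (fun t => (H (mv t))%:E)) => //.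
    - by move=> J; apply/measurable_EFinP; exact: mf.
    - move=> t _; have [J0 HJ] := ev (mv t).
      by apply: cvg_near_cst; near=> J; rewrite HJ//; near: J; exists J0.
    - by move=> J t _; rewrite lee_fin; have /andP[f0 f1] := f01 J (mv t); rewrite ger0_norm.
  by rewrite integral0 => cve; exact: (fine_cvg cve).
have /cvgrPdist_le/(_ _ e0)[J0 _ HJ] := cv.
exists J0 => J /HJ /=; rewrite sub0r normrN => /(le_trans (ler_norm _)).
exact.
Unshelve. all: by end_near. Qed.

Variables (m rho r : R) (g : 'rV[R]_(n + n) -> R).
Hypotheses (sg : real_symbol m rho g) (rho01 : 0 < rho < 1) (r12 : 1 < r <= 2)
  (mr : m <= - ((n%:R / r) * (1 - rho))).

Lemma mfn2D (h k : V -> V -> R) : mfn2 h -> mfn2 k -> mfn2 (fun x y => h x y + k x y).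
Proof. by move=> mh mk; exact: measurable_funD. Qed.

Lemma symbol_bounded : exists2 C, 0 < C & forall x z, `|jder g [::] (x, z)| <= C.
Proof.
have [_ [C C0 HC]] := sg; exists C => // x z.
have := HC (Ordinal n0) (Ordinal n0) 0%N 0%N x z isT isT.
rewrite !mulr0 addr0 subr0 => /le_trans; apply; rewrite -[leRHS]mulr1 ler_wpM2l ?(ltW C0)//.
have e1 : 1 <= 1 + enorm z by rewrite lerDl sqrtr_ge0.
have /andP[r1 _] := r12; have /andP[_ rho1] := rho01.
have m0 : m <= 0.
  apply: (le_trans mr); rewrite oppr_le0 mulr_ge0 ?divr_ge0 ?subr_ge0 ?(ltW rho1)//.
  by rewrite (le_trans ler01)// ltW.
by have := ler_powR e1 m0; rewrite powRr0.
Qed.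

Definition Tfull k (f : V -> R) (x : V) : R :=
  Int (fun z => jder g [::] (x, z) * Int (fun y => f y * wave k (x - y) z)).

Lemma Tfull_mfn2 k f : L1 f ->
  mfn2 (fun x z => jder g [::] (x, z) * Int (fun y => f y * wave k (x - y) z)).
Proof.
move=> lf; apply: mfn2M; first by apply: mfn2_cont; apply: jder_cts; case: sg.
have -> : (fun x z : V => Int (fun y => f y * wave k (x - y) z)) =
    (fun x z => wave k x z * hat 0 f z + wave (k - pi / 2) x z * hat (- (pi / 2)) f z).
  by apply/funext => x; apply/funext => z; exact: hat_split.
by apply: mfn2D; apply: mfn2M; try exact: wave_mfn2; apply: mfn2_snd; apply: hat_mfn; exact: L1_mfn.
Qed.

(** The number of pieces may depend on [f], [e] and [Q]: what is discarded is made at most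
    [Q ^ (1 / r)] uniformly in [x] by the integrable majorant [H], which costs [2 ^ n] in the
    constant, while the bound for the retained sum does not depend on the number of pieces. *)
Lemma full_operator : exists2 K, 0 < K & forall k (f H : V -> R) x0 Q e, 0 < e -> 0 < Q ->
  L1 f -> L1 (fun y => `|f y| `^ r) -> maxbound (fun y => `|f y| `^ r) x0 Q ->
  L1 H -> (forall x z, `|Int (fun y => f y * wave k (x - y) z)| <= H z) ->
  exists c : R, (1 <= e -> c = 0) /\ lr_bound (box x0 e) r (e ^+ n * Q) (fun x => Tfull k f x - c) K.
Proof.
have [K K0 HK] := dyadic_sum n0 sg rho01 r12 mr.
have [Cg Cg0 HCg] := symbol_bounded.
have /andP[r1 r2] := r12; have r0 : 0 < r by apply: lt_trans r1.
have [Cp Cp0 HC] := symbol_piece n0 sg rho01 r1 mr.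
exists (K + 1 * 2 ^+ n); first by rewrite addr_gt0// mul1r exprn_gt0.
move=> k f H x0 Q e e0 Q0 lf lfr HM lH HH.
have [c [c0 Hc]] := HK k f x0 Q e e0 Q0 lf lfr HM.
have H0 z : 0 <= H z by exact: le_trans (normr_ge0 _) (HH 0 z).
have [N HN] : exists N, forall j, (N <= j)%N -> 1 <= e * 2 ^+ j.
  have eN := truncnS_gt e^-1; exists (Num.truncn e^-1).+1 => j Nj.
  rewrite mulrC -ler_pdivrMr// mul1r; apply: (le_trans (ltW eN)).
  by rewrite -natrX ler_nat (leq_trans Nj)// ltnW// ltn_expl.
pose G x z := Int (fun y => f y * wave k (x - y) z).
have mG := Tfull_mfn2 k lf.
have lG x : L1 (fun z => jder g [::] (x, z) * G x z).
  apply: (L1_dom (mfn2_r x mG) (L1Z Cg lH)) => z; rewrite normrM.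
  exact: (ler_pM (normr_ge0 _) (normr_ge0 _) (HCg x z) (HH x z)).
(* Multiplied by the bound [Cg] of the symbol, this tolerance becomes [Q ^ (1 / r)]. *)
have eps0 : 0 < Q `^ r^-1 / Cg by rewrite divr_gt0// powR_gt0.
have [J0 HJ0] := tail_small (4 * n) eps0 lH H0.
pose J := maxn N J0.
have lp j x : L1 (fun z => sympiece g j (x, z) * G x z).
  have jb := jet_bd (HC j (Ordinal n0)).
  have sn := nice_L1 (sym_nice n0 x jb).
  have ws := wave_swap k x sn lf.
  exact: ws.1.
have SJ x : \sum_(j < J.+1) Top (sympiece g j) k f x =
    Int (fun z => jder g [::] (x, z) * G x z * boxbump (4 * n) 0 (2 ^+ J) z).
  rewrite /Top -(Int_sum _ (fun j : 'I_J.+1 => lp j x)); congr Int; apply/funext => z.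
  rewrite mulrAC -dyad_sum mulr_sumr mulr_suml; apply: eq_bigr => j _; exact: erefl.
exists (\sum_(j < J.+1) c j); split.
  by move=> e1; apply: big1 => j _; apply: c0; rewrite -[leLHS]mulr1; apply: ler_pM => //; rewrite exprn_ege1// ler1n.
have D0 : 0 <= e ^+ n * Q by rewrite mulr_ge0 ?exprn_ge0// ltW.
have mB : mfn (\1_(box x0 e) : V -> R) by exact: (L1_mfn (L1_box x0 (ltW e0)).1).
have two0 : 0 < 1 * 2 ^+ n :> R by rewrite mul1r exprn_gt0.
have mS := let: And3 a _ _ := Hc J in a.
have mT : mfn (Tfull k f) by exact: (mfn_Int mG).
pose E x := Tfull k f x - \sum_(j < J.+1) Top (sympiece g j) k f x.
have mE : mfn E.
  have -> : E = (fun x => Tfull k f x -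
     (\sum_(j < J.+1) (Top (sympiece g j) k f x - c j) + \sum_(j < J.+1) c j)).
    by apply/funext => x; rewrite /E sumrB subrK.
  apply: (measurable_funB mT); apply: (measurable_funD mS).
  exact: measurable_cst.
have Eb x : box x0 e x -> `|E x| <= 1 * Q `^ r^-1.
  move=> _; rewrite mul1r /E SJ /Tfull.
  have lGb : L1 (fun z => jder g [::] (x, z) * G x z * boxbump (4 * n) 0 (2 ^+ J) z).
    have mb : mfn (boxbump (4 * n) 0 (2 ^+ J) : V -> R) by apply: mfn_cont; exact: boxbump_cts.
    apply: (L1_dom (measurable_funM (L1_mfn (lG x)) mb) (L1_abs (lG x))) => z.
    have /andP[b0 b1] := boxbump_itv (4 * n) 0 (2 ^+ J) z.
    by rewrite normrM (ger0_norm b0) ler_piMr.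
  rewrite -(IntB (lG x) lGb).
  have lb : L1 (fun z => H z * (1 - boxbump (4 * n) 0 (2 ^+ J) z)).
    have mb : mfn (fun z : V => 1 - boxbump (4 * n) 0 (2 ^+ J) z).
      by apply: mfn_cont; apply: ctsB; [exact: cts_cst|exact: boxbump_cts].
    apply: (L1_dom (measurable_funM (L1_mfn lH) mb) lH) => z.
    have /andP[b0 b1] := boxbump_itv (4 * n) 0 (2 ^+ J) z.
    by rewrite normrM (ger0_norm (H0 z)) ger0_norm ?subr_ge0// ler_piMr// gerBl.
  apply: (@le_trans _ _ (Int (fun z => Cg * (H z * (1 - boxbump (4 * n) 0 (2 ^+ J) z))))).
    apply: Int_abs_le; [exact: (L1_mfn (L1B (lG x) lGb))|exact: L1Z|].
    move=> z; rewrite -{1}[_ * G x z]mulr1 -mulrBr normrM mulrA.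
    have /andP[_ b1] := boxbump_itv (4 * n) 0 (2 ^+ J) z.
    rewrite (ger0_norm (x := 1 - _)) ?subr_ge0// ler_wpM2r ?subr_ge0// normrM.
    exact: (ler_pM (normr_ge0 _) (normr_ge0 _) (HCg x z) (HH x z)).
  rewrite (IntZ _ lb) mulrC -ler_pdivlMr//; apply: HJ0; exact: leq_maxr.
have bE := lr_bound_sup r1 e0 Q0 ler01 mE Eb.
have := lr_boundD mB (ltW r1) D0 K0 two0 (Hc J) bE.
congr lr_bound; apply/funext => x; rewrite /E sumrB; ring.
Qed.
End full_operator.

(** * The complex operator *)

Section schwartz_functions.
Variables (R : realType) (n : nat).
Local Notation V := 'rV[R]_n.
Hypothesis n0 : (0 < n)%N.

(** Expanding the product of the [1 + x_j ^ 2] over subsets of coordinates gives finitely many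
    monomials, each controlled by one Schwartz seminorm. *)
Lemma schwartz_decay (f : V -> complex R) i p : schwartz f -> exists C, forall x,
  cmod (cpdseq (nseq p i) f x) <= C * Pk 1 x.
Proof.
move=> [_ H]; rewrite -(mlist_single i p); set a : mindex n := (fun j : 'I_n => _).
have HJ (J : {set 'I_n}) : exists M, forall x,
    `|mpow x (fun j => if j \in J then 2%N else 0%N)| * cmod (cDm a f x) <= M by exact: H.
have [M HM] := choice HJ.
exists (\sum_(J : {set 'I_n}) M J) => x.
have P0 : 0 < \prod_(j < n) (1 + (1 * x ord0 j) ^+ 2).
  by apply: prodr_gt0 => j _; rewrite ltr_pwDl// sqr_ge0.
rewrite /Pk prodfV ler_pdivlMr// mulrC.
have -> : \prod_(j < n) (1 + (1 * x ord0 j) ^+ 2) =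
    \sum_(J : {set 'I_n}) `|mpow x (fun j => if j \in J then 2%N else 0%N)|.
  under eq_bigr do rewrite mul1r addrC.
  rewrite bigA_distr; apply: eq_bigr => J _.
  rewrite /mpow normr_prod; apply: eq_bigr => j _.
  by case: (j \in J); rewrite ?expr0 ?normr1// ger0_norm// sqr_ge0.
rewrite mulr_suml; apply: ler_sum => J _; exact: HM.
Qed.

Definition decaying (u : V -> R) := smooth u /\
  forall i p, exists C, forall x, `|pdseq (nseq p i) u x| <= C * Pk 1 x.

Lemma schwartz_parts (f : V -> complex R) : schwartz f ->
  decaying (fun y => cre (f y)) /\ decaying (fun y => cim (f y)).
Proof.
move=> sf; have [[s1 s2] _] := sf; split; split=> // i p; have [C HC] := schwartz_decay i p sf;
  exists C => x; apply: le_trans (HC x).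
  exact: (le_trans _ (cre_le _)).
exact: (le_trans _ (cim_le _)).
Qed.

Lemma decaying_nice u i p : decaying u -> nice (pdseq (nseq p i) u).
Proof. by move=> [su du]; split; [case: (su (nseq p i))|exact: du]. Qed.

Lemma decaying_nice0 u : decaying u -> nice u.
Proof. exact: (@decaying_nice u (Ordinal n0) 0). Qed.

Lemma decaying_nderiv u i : decaying u -> forall p q, nderiv i p (pdseq (nseq q i) u) (pdseq (nseq (q + p) i) u).
Proof.
move=> du; elim=> [|p IH] q; split; try exact: decaying_nice; first by rewrite addn0.
exists (pdseq (nseq q.+1 i) u); split; last by rewrite addnS -addSn; exact: IH.
move=> x; apply/derivableP; exact: (du.1 (nseq q i)).2.
Qed.

(** [oscillation] at scale [1], with pure derivatives of order [2 n]; the doubled constant covers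
    the two terms of [hat_split]. *)
Lemma decaying_hat u : decaying u -> exists2 C, 0 <= C &
  (forall k z, `|hat k u z| <= C * Pk 1 z) /\
  (forall k x z, `|Int (fun y => u y * wave k (x - y) z)| <= C * Pk 1 z).
Proof.
move=> du; have nu := decaying_nice0 du; have lu := nice_L1 nu.
pose G i := pdseq (nseq (2 * n) i) u.
pose D := Int (fun x => `|u x|) + \sum_(i < n) Int (fun x => `|G i x|).
have I0 (v : V -> R) : 0 <= Int (fun x => `|v x|) by apply: Int_ge0.
have D0 : 0 <= D by rewrite addr_ge0 ?sumr_ge0.
have H k z : `|hat k u z| <= 2 ^+ n * D * Pk 1 z.
  apply: oscillation => //; first by rewrite /D lerDl sumr_ge0.
  move=> i; exists (G i); first exact: (decaying_nderiv i du (2 * n) 0).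
  by rewrite expr1n invr1 mulr1 /D (bigD1 i)//= addrCA lerDl addr_ge0// sumr_ge0.
exists (2 * (2 ^+ n * D)); first by rewrite !mulr_ge0 ?exprn_ge0.
split=> [k z|k x z].
  apply: (le_trans (H k z)); rewrite ler_wpM2r ?Pk_ge0// ler_peMl ?ler1n//.
  by rewrite mulr_ge0 ?exprn_ge0.
rewrite hat_split//; apply: (le_trans (ler_normD _ _)); rewrite !normrM.
have h1 := H 0 z; have h2 := H (- (pi / 2)) z.
have W k' (t b : R) : 0 <= t -> t <= b -> `|wave k' x z| * t <= b.
  by move=> t0; apply: le_trans; rewrite ler_piMl// wave_le1.
have h := lerD (W k _ _ (normr_ge0 _) h1) (W (k - pi / 2) _ _ (normr_ge0 _) h2).
apply: (le_trans h); rewrite le_eqVlt; apply/orP; left; apply/eqP; ring.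
Qed.

Lemma creM (a b : complex R) : cre (a * b) = cre a * cre b - cim a * cim b.
Proof. by case: a; case: b. Qed.

Lemma cimM (a b : complex R) : cim (a * b) = cre a * cim b + cim a * cre b.
Proof. by case: a; case: b. Qed.

Lemma fourier_parts (f : V -> complex R) (z : V) : schwartz f ->
  let f1 y := cre (f y) in let f2 y := cim (f y) in
  cre (fourier f z) = hat 0 f1 z + hat (- (pi / 2)) f2 z /\
  cim (fourier f z) = - hat (- (pi / 2)) f1 z + hat 0 f2 z.
Proof.
move=> sf f1 f2; have [d1 d2] := schwartz_parts sf.
have n1 := decaying_nice0 d1; have n2 := decaying_nice0 d2.
have [c1 [C1 b1]] := n1; have [c2 [C2 b2]] := n2.
have l1 := nice_L1 n1; have l2 := nice_L1 n2.
have bw u C k k' v C' (s s' : R) : `|s| <= 1 -> `|s'| <= 1 ->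
    (forall x, `|u x| <= C * Pk 1 x) -> (forall x, `|v x| <= C' * Pk 1 x) ->
    forall x, `|s * (u x * wave k x z) + s' * (v x * wave k' x z)| <= (C + C') * Pk 1 x.
  move=> s1 s1' bu bv x; rewrite mulrDl; apply: (le_trans (ler_normD _ _)); rewrite !normrM.
  have W (e a t b : R) : 0 <= a -> 0 <= e -> 0 <= t -> e <= 1 -> a <= 1 -> t <= b -> e * (t * a) <= b.
    move=> a0 e0 t0 e1 a1 tb; apply: le_trans tb; apply: (@le_trans _ _ (t * a)).
      by rewrite ler_piMl// mulr_ge0.
    by rewrite ler_piMr.
  by apply: lerD; apply: W; rewrite ?wave_le1.
have N1 : `|-1 : R| <= 1 by rewrite normrN1.
have P1 : `|1 : R| <= 1 by rewrite normr1.
split.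
  have E : (fun y => cre (f y * expi (- (2 * pi * dotp y z)))) =
      (fun y => 1 * (f1 y * wave 0 y z) + 1 * (f2 y * wave (- (pi / 2)) y z)).
    apply/funext => y; rewrite creM /= /cre /cim /= cosN sinN cos_wave sin_wave -/(cre (f y)) -/(cim (f y)).
    by rewrite /f1 /f2; ring.
  rewrite /fourier /cint {1}/cre /= E.
  rewrite (Int_rint _ (bw _ _ 0 (- (pi / 2)) _ _ 1 1 P1 P1 b1 b2)).2.
    rewrite IntD ?IntZ ?mul1r//; try exact: L1_wave; by apply: L1Z; exact: L1_wave.
  exact: (measurable_funD (L1_mfn (L1Z 1 (L1_wave 0 z l1))) (L1_mfn (L1Z 1 (L1_wave (- (pi / 2)) z l2)))).
have E : (fun y => cim (f y * expi (- (2 * pi * dotp y z)))) =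
    (fun y => -1 * (f1 y * wave (- (pi / 2)) y z) + 1 * (f2 y * wave 0 y z)).
  apply/funext => y; rewrite cimM /= /cre /cim /= cosN sinN cos_wave sin_wave -/(cre (f y)) -/(cim (f y)).
  by rewrite /f1 /f2; ring.
rewrite /fourier /cint {1}/cim /= E.
rewrite (Int_rint _ (bw _ _ (- (pi / 2)) 0 _ _ (-1) 1 N1 P1 b1 b2)).2.
  rewrite IntD ?IntZ ?mul1r ?mulN1r//; try exact: L1_wave; by apply: L1Z; exact: L1_wave.
exact: (measurable_funD (L1_mfn (L1Z (-1) (L1_wave (- (pi / 2)) z l1))) (L1_mfn (L1Z 1 (L1_wave 0 z l2)))).
Qed.
End schwartz_functions.

(** * Reduction of the complex operator to real ones *)

Section real_form.
Variables (R : realType) (n : nat).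
Local Notation V := 'rV[R]_n.
Hypothesis n0 : (0 < n)%N.
Variables (m rho r : R).
Hypotheses (rho01 : 0 < rho < 1) (r12 : 1 < r <= 2) (mr : m <= - ((n%:R / r) * (1 - rho))).

Lemma phase_pi k (u : V -> R) (x z : V) : L1 u ->
  Int (fun y => u y * wave (k + pi) (x - y) z) = - Int (fun y => u y * wave k (x - y) z).
Proof.
move=> lu; rewrite -mulN1r -IntZ.
  by congr Int; apply/funext => y; rewrite wave_pi; ring.
apply: (L1_dom _ (L1_abs lu)).
  exact: (measurable_funM (L1_mfn lu) (mfn2_r z (waveB_mfn2 k x))).
by move=> y; rewrite normrM ler_piMr// wave_le1.
Qed.

Definition kern (g : 'rV[R]_(n + n) -> R) k (u : V -> R) (x z : V) :=
  jder g [::] (x, z) * Int (fun y => u y * wave k (x - y) z).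

Lemma kern_bound g u : real_symbol m rho g -> decaying u -> exists C, forall k x z, `|kern g k u x z| <= C * Pk 1 z.
Proof.
move=> sg du; have [C1 C10 H1] := symbol_bounded n0 sg rho01 r12 mr.
have [C2 C20 [_ H2]] := decaying_hat n0 du.
exists (C1 * C2) => k x z; rewrite normrM -mulrA.
exact: (ler_pM (normr_ge0 _) (normr_ge0 _) (H1 x z) (H2 k x z)).
Qed.

Lemma kern_mfn g k u x : real_symbol m rho g -> L1 u -> mfn (kern g k u x).
Proof. by move=> sg lu; exact: (mfn2_r x (Tfull_mfn2 sg k lu)). Qed.

Lemma rintD (h h' : V -> R) : mfn h -> mfn h' -> (exists C, forall z, `|h z| <= C * Pk 1 z) ->
  (exists C, forall z, `|h' z| <= C * Pk 1 z) ->
  [/\ mfn (fun z => h z + h' z), exists C, forall z, `|h z + h' z| <= C * Pk 1 z &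
   Int (fun z => h z + h' z) = Int h + Int h'].
Proof.
move=> mh mh' [C HC] [C' HC']; split; first exact: measurable_funD.
  exists (C + C') => z; rewrite mulrDl; apply: (le_trans (ler_normD _ _)).
  exact: lerD.
by rewrite IntD//; [exact: (Int_rint mh HC).1|exact: (Int_rint mh' HC').1].
Qed.

Lemma fourier_wave_parts (f : V -> complex R) x z : schwartz f ->
  let f1 y := cre (f y) in let f2 y := cim (f y) in
  let G k u := Int (fun y => u y * wave k (x - y) z) in
  cre (fourier f z * expi (2 * pi * dotp x z)) = G 0 f1 + G (pi / 2) f2 /\
  cim (fourier f z * expi (2 * pi * dotp x z)) = G (- (pi / 2)) f1 + G 0 f2.
Proof.
move=> sf f1 f2 G; have [d1 d2] := schwartz_parts sf.
have l1 := nice_L1 (decaying_nice0 n0 d1); have l2 := nice_L1 (decaying_nice0 n0 d2).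
have [F1 F2] := fourier_parts n0 z sf.
have e1 : cre (expi (2 * pi * dotp x z)) = wave 0 x z by rewrite /cre /= cos_wave.
have e2 : cim (expi (2 * pi * dotp x z)) = wave (- (pi / 2)) x z by rewrite /cim /= sin_wave.
have w1 : wave (pi / 2) x z = - wave (- (pi / 2)) x z.
  by rewrite -wave_pi; congr wave; field.
have w2 : wave (- (pi / 2) - pi / 2) x z = - wave 0 x z.
  have := wave_pi (- (pi / 2) - pi / 2) x z.
  rewrite (_ : - (pi / 2) - pi / 2 + pi = 0); last by field.
  by move=> ->; rewrite opprK.
rewrite /G; split.
  by rewrite creM F1 F2 e1 e2 !hat_split// sub0r subrr w1; ring.
by rewrite cimM F1 F2 e1 e2 !hat_split// sub0r w2; ring.
Qed.

(** Two parts of the symbol and two of [f], for each of the two parts of the result. The minus signs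
    of complex multiplication are absorbed into the phases by [phase_pi], so each term is a plain
    [Tfull]. *)
Lemma psido_parts s (f : V -> complex R) x : symbol_class m rho rho s -> schwartz f ->
  let f1 y := cre (f y) in let f2 y := cim (f y) in
  let g1 z := cre (joint s z) in let g2 z := cim (joint s z) in
  cre (psido s f x) = Tfull g1 0 f1 x + Tfull g1 (pi / 2) f2 x + (Tfull g2 (pi / 2) f1 x + Tfull g2 pi f2 x) /\
  cim (psido s f x) = Tfull g1 (- (pi / 2)) f1 x + Tfull g1 0 f2 x + (Tfull g2 0 f1 x + Tfull g2 (pi / 2) f2 x).
Proof.
move=> ss sf f1 f2 g1 g2; have [d1 d2] := schwartz_parts sf.
have [s1 s2] := symbol_parts ss.
have l1 := nice_L1 (decaying_nice0 n0 d1); have l2 := nice_L1 (decaying_nice0 n0 d2).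
have b g u k : real_symbol m rho g -> decaying u -> exists C, forall z, `|kern g k u x z| <= C * Pk 1 z.
  by move=> sg du; have [C HC] := kern_bound sg du; exists C => z; exact: HC.
have four k1 k2 k3 k4 : rint (fun z => kern g1 k1 f1 x z + kern g1 k2 f2 x z + (kern g2 k3 f1 x z + kern g2 k4 f2 x z)) =
    Tfull g1 k1 f1 x + Tfull g1 k2 f2 x + (Tfull g2 k3 f1 x + Tfull g2 k4 f2 x).
  have [ma ba Ea] := rintD (kern_mfn k1 x s1 l1) (kern_mfn k2 x s1 l2) (b _ _ k1 s1 d1) (b _ _ k2 s1 d2).
  have [mb bb Eb] := rintD (kern_mfn k3 x s2 l1) (kern_mfn k4 x s2 l2) (b _ _ k3 s2 d1) (b _ _ k4 s2 d2).
  have [mc [C HC] Ec] := rintD ma mb ba bb.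
  by rewrite (Int_rint mc HC).2 Ec Ea Eb.
have jg1 z : jder g1 [::] (x, z) = cre (s x z) by rewrite /jder /g1 /joint /= row_mxKl row_mxKr.
have jg2 z : jder g2 [::] (x, z) = cim (s x z) by rewrite /jder /g2 /joint /= row_mxKl row_mxKr.
split.
  rewrite -four /psido /cint {1}/cre /=; congr rint; apply/funext => z.
  have [E1 E2] := fourier_wave_parts x z sf.
  rewrite -mulrA creM E1 E2 /kern jg1 jg2.
  have p1 : - Int (fun y => f1 y * wave (- (pi / 2)) (x - y) z) = Int (fun y => f1 y * wave (pi / 2) (x - y) z).
    by rewrite -phase_pi//; congr Int; apply/funext => y; congr (_ * wave _ _ _); field.
  have p2 : - Int (fun y => f2 y * wave 0 (x - y) z) = Int (fun y => f2 y * wave pi (x - y) z).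
    by rewrite -phase_pi// add0r.
  rewrite -p1 -p2; ring.
rewrite -four /psido /cint {1}/cim /=; congr rint; apply/funext => z.
have [E1 E2] := fourier_wave_parts x z sf.
rewrite -mulrA cimM E1 E2 /kern jg1 jg2; ring.
Qed.
End real_form.

Lemma sum4B (R : realType) (a b c d a' b' c' d' : R) :
  a + b + (c + d) - (a' + b' + (c' + d')) = a - a' + (b - b') + (c - c' + (d - d')).
Proof. by ring. Qed.

Section local_norm_of_psido.
Variables (R : realType) (n : nat).
Local Notation V := 'rV[R]_n.
Hypothesis n0 : (0 < n)%N.

Lemma L1_powR r C (u : V -> R) : 1 < r -> 0 <= C -> mfn u -> (forall x, `|u x| <= C * Pk 1 x) ->
  L1 (fun x => `|u x| `^ r).
Proof.
move=> r1 C0 mu uC.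
have lP : L1 (fun x : V => C `^ r * Pk 1 x).
  have [lP _] := L1_Pk (0 : V) (ltr01 : 0 < (1 : R)); apply: L1Z.
  by move: lP; congr L1; apply/funext => x; rewrite subr0.
apply: (L1_dom _ lP).
  by apply: (measurableT_comp (f := fun t : R => t `^ r)); [exact: measurable_powR|exact: measurableT_comp].
move=> x; rewrite ger0_norm ?powR_ge0//.
apply: (@le_trans _ _ ((C * Pk 1 x) `^ r)).
  by apply: ge0_ler_powR; rewrite ?nnegrE ?mulr_ge0 ?Pk_ge0// ltW// (lt_trans ltr01).
rewrite powRM ?Pk_ge0// ler_wpM2l ?powR_ge0// ge1r_powR ?(ltW r1)//.
by rewrite Pk_gt0 Pk_le1.
Qed.

Lemma cmod_le (z : complex R) : cmod z <= `|cre z| + `|cim z|.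
Proof.
rewrite /cmod -[leRHS]ger0_norm ?addr_ge0// -sqrtr_sqr ler_wsqrtr//.
rewrite sqrrD !real_normK ?num_real// lerD2r lerDl mulrn_wge0// mulr_ge0//.
Qed.

Lemma cmod_ge0 (z : complex R) : 0 <= cmod z.
Proof. exact: sqrtr_ge0. Qed.

Lemma cmod_mfn (F : V -> complex R) : mfn (fun y => cre (F y)) -> mfn (fun y => cim (F y)) ->
  mfn (fun y => cmod (F y)).
Proof.
move=> m1 m2; rewrite /mfn /cmod.
apply: (measurableT_comp (f := @Num.sqrt R)).
  by apply: continuous_measurable_fun; exact: sqrt_continuous.
by apply: measurable_funD; apply: measurable_funX.
Qed.

Lemma creB (a b : complex R) : cre (a - b) = cre a - cre b.
Proof. by case: a; case: b. Qed.

Lemma cimB (a b : complex R) : cim (a - b) = cim a - cim b.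
Proof. by case: a; case: b. Qed.

Lemma lr_bound_abs (S : set V) r D (u : V -> R) t : lr_bound S r D u t -> lr_bound S r D (fun x => `|u x|) t.
Proof.
move=> [mu lu Iu]; rewrite /lr_bound.
have E : (fun x => \1_S x * `| `|u x| | `^ r) = (fun x => \1_S x * `|u x| `^ r).
  by apply/funext => x; rewrite normr_id.
by rewrite E; split=> //; exact: measurableT_comp.
Qed.

Variables (m rho r : R).
Hypotheses (rho01 : 0 < rho < 1) (r12 : 1 < r <= 2) (mr : m <= - ((n%:R / r) * (1 - rho))).
Variable s : V -> V -> complex R.
Hypothesis ss : symbol_class m rho rho s.

Lemma schwartz_cmod (f : V -> complex R) : schwartz f ->
  mfn (fun y => cmod (f y)) /\ L1 (fun y => cmod (f y) `^ r).
Proof.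
move=> sf; have [d1 d2] := schwartz_parts sf; have /andP[r1 r2] := r12.
have [c1 [C1 b1]] := decaying_nice0 n0 d1; have [c2 [C2 b2]] := decaying_nice0 n0 d2.
have mc : mfn (fun y => cmod (f y)) by apply: cmod_mfn; exact: mfn_cont.
split=> //.
have E : (fun y => cmod (f y) `^ r) = (fun y => `|cmod (f y)| `^ r).
  by apply/funext => y; rewrite ger0_norm// cmod_ge0.
rewrite E; apply: (@L1_powR r (`|C1| + `|C2|)) => //.
move=> x; rewrite (ger0_norm (cmod_ge0 _)) (le_trans (cmod_le _))// mulrDl lerD//.
  by apply: (le_trans (b1 x)); rewrite ler_wpM2r ?Pk_ge0// ler_norm.
by apply: (le_trans (b2 x)); rewrite ler_wpM2r ?Pk_ge0// ler_norm.
Qed.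

(** The real and imaginary parts of [f] are at most its modulus and inherit its maximal bound.
    Conversely the modulus of the result is at most the sum of the absolute values of its parts, to
    which four real operators each contribute. *)
Lemma psido_local : exists2 K, 0 < K & forall (f : V -> complex R) x Q e, schwartz f -> 0 < e -> 0 < Q ->
  maxbound (fun y => cmod (f y) `^ r) x Q ->
  exists c : complex R, [/\ 1 <= e -> c = 0, mfn (fun y => cmod (psido s f y - c)),
    L1 (fun y => \1_(box x e) y * cmod (psido s f y - c) `^ r) &
    Int (fun y => \1_(box x e) y * cmod (psido s f y - c) `^ r) <= K `^ r * (e ^+ n * Q)].
Proof.
have [s1 s2] := symbol_parts ss; have /andP[r1 r2] := r12.
have r0 : 0 < r by apply: lt_trans r1.
set g1 := (fun z => cre (joint s z)) in s1; set g2 := (fun z => cim (joint s z)) in s2.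
have [K1 K10 H1] := full_operator n0 s1 rho01 r12 mr.
have [K2 K20 H2] := full_operator n0 s2 rho01 r12 mr.
pose K0 := K1 + K1 + (K2 + K2).
have K00 : 0 < K0 by rewrite !addr_gt0.
exists (K0 + K0); first by rewrite addr_gt0.
move=> f x Q e sf e0 Q0 HM.
have [d1 d2] := schwartz_parts sf; have [mc lc] := schwartz_cmod sf.
set f1 := (fun y => cre (f y)) in d1; set f2 := (fun y => cim (f y)) in d2.
have D0 : 0 <= e ^+ n * Q by rewrite mulr_ge0 ?exprn_ge0// ltW.
have lB := (L1_box x (ltW e0)).1; have mB := L1_mfn lB.
have part u : decaying u -> (forall y, `|u y| <= cmod (f y)) ->
    [/\ L1 u, L1 (fun y => `|u y| `^ r) & maxbound (fun y => `|u y| `^ r) x Q].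
  move=> du uf; have lu := nice_L1 (decaying_nice0 n0 du).
  have pw y : `|u y| `^ r <= cmod (f y) `^ r.
    by apply: ge0_ler_powR; rewrite ?nnegrE ?cmod_ge0// ltW.
  have mp : mfn (fun y => `|u y| `^ r).
    apply: (measurableT_comp (f := fun t : R => t `^ r)); first exact: measurable_powR.
    by apply: measurableT_comp => //; exact: L1_mfn.
  have lp : L1 (fun y => `|u y| `^ r).
    by apply: (L1_dom mp lc) => y; rewrite ger0_norm ?powR_ge0.
  split; [exact: lu|exact: lp|move=> a l l0 ax; apply: le_trans (HM a l l0 ax)].
  have lq (v : V -> R) : L1 v -> L1 (fun y => \1_(cube a l) y * v y).
    move=> lv; apply: (L1_dom _ (L1_abs lv)); first exact: (measurable_funM (indic_mfn n0 a l) (L1_mfn lv)).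
    by move=> y; rewrite normrM ler_piMl// indicE; case: (_ \in _); rewrite ?normr1 ?normr0.
  apply: (Int_le (lq _ lp) (lq _ lc)) => y; rewrite ler_wpM2l ?pw// indicE; by [].
have [l1 p1 M1] := part f1 d1 (fun y => cre_le (f y)).
have [l2 p2 M2] := part f2 d2 (fun y => cim_le (f y)).
have [C1 C10 [_ h1]] := decaying_hat n0 d1; have [C2 C20 [_ h2]] := decaying_hat n0 d2.
have lP C : L1 (fun z : V => C * Pk 1 z).
  have [lP _] := L1_Pk (0 : V) (ltr01 : 0 < (1 : R)); apply: L1Z.
  by move: lP; congr L1; apply/funext => z; rewrite subr0.
have op1 k := H1 k f1 _ x Q e e0 Q0 l1 p1 M1 (lP C1) (h1 k).
have op2 k := H1 k f2 _ x Q e e0 Q0 l2 p2 M2 (lP C2) (h2 k).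
have op3 k := H2 k f1 _ x Q e e0 Q0 l1 p1 M1 (lP C1) (h1 k).
have op4 k := H2 k f2 _ x Q e e0 Q0 l2 p2 M2 (lP C2) (h2 k).
have four k1 k2 k3 k4 (P : V -> R) : (forall y, P y = Tfull g1 k1 f1 y + Tfull g1 k2 f2 y + (Tfull g2 k3 f1 y + Tfull g2 k4 f2 y)) ->
    exists c : R, (1 <= e -> c = 0) /\ lr_bound (box x e) r (e ^+ n * Q) (fun y => P y - c) K0.
  move=> PE; have [c1 [z1 b1]] := op1 k1; have [c2 [z2 b2]] := op2 k2.
  have [c3 [z3 b3]] := op3 k3; have [c4 [z4 b4]] := op4 k4.
  exists (c1 + c2 + (c3 + c4)); split.
    by move=> e1; rewrite z1// z2// z3// z4// !addr0.
  have a1 := lr_boundD mB (ltW r1) D0 K10 K10 b1 b2.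
  have a2 := lr_boundD mB (ltW r1) D0 K20 K20 b3 b4.
  have E : (fun y => P y - (c1 + c2 + (c3 + c4))) = (fun y => Tfull g1 k1 f1 y - c1 + (Tfull g1 k2 f2 y - c2) +
      (Tfull g2 k3 f1 y - c3 + (Tfull g2 k4 f2 y - c4))).
    by apply/funext => y; rewrite PE; exact: sum4B.
  by rewrite E; exact: (lr_boundD mB (ltW r1) D0 (addr_gt0 K10 K10) (addr_gt0 K20 K20) a1 a2).
have [a [za ba]] := four _ _ _ _ _ (fun y => (psido_parts n0 rho01 r12 mr y ss sf).1).
have [b [zb bb]] := four _ _ _ _ _ (fun y => (psido_parts n0 rho01 r12 mr y ss sf).2).
have mP : mfn (fun y => cmod (psido s f y - Complex a b)).
  apply: cmod_mfn.
    have [mu _ _] := ba; have E : (fun y => cre (psido s f y - Complex a b)) = (fun y => cre (psido s f y) - a).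
      by apply/funext => y; rewrite creB.
    by rewrite E.
  have [mu _ _] := bb; have E : (fun y => cim (psido s f y - Complex a b)) = (fun y => cim (psido s f y) - b).
    by apply/funext => y; rewrite cimB.
  by rewrite E.
have [_ lw Iw] := lr_boundD mB (ltW r1) D0 K00 K00 (lr_bound_abs ba) (lr_bound_abs bb).
have pw y : \1_(box x e) y * cmod (psido s f y - Complex a b) `^ r <=
    \1_(box x e) y * `| `|cre (psido s f y) - a| + `|cim (psido s f y) - b| | `^ r.
  apply: ler_wpM2l; first by rewrite indicE.
  apply: (ge0_ler_powR (ltW r0)); rewrite ?nnegrE ?cmod_ge0//.
  by rewrite ger0_norm ?addr_ge0// (le_trans (cmod_le _))// creB cimB.
have lP' : L1 (fun y => \1_(box x e) y * cmod (psido s f y - Complex a b) `^ r).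
  apply: (L1_dom _ lw).
    apply: (measurable_funM mB).
    by apply: (measurableT_comp (f := fun t : R => t `^ r)); first exact: measurable_powR.
  by move=> y; rewrite ger0_norm ?pw// mulr_ge0 ?powR_ge0.
exists (Complex a b); split; [|exact: mP|exact: lP'|exact: (le_trans (Int_le lP' lw pw) Iw)].
by move=> e1; rewrite za// zb.
Qed.
End local_norm_of_psido.

(** A cube of side [l] through [x] lies in the box of half side [l] centered at [x]; hence local
    estimates are needed only for boxes centered at the given point. *)
Lemma Int_cube_box (R : realType) n (F : 'rV[R]_n -> R) (x a : 'rV[R]_n) l : (0 < n)%N -> 0 < l -> cube a l x ->
  mfn F -> (forall y, 0 <= F y) -> L1 (fun y => \1_(box x l) y * F y) ->
  L1 (fun y => \1_(cube a l) y * F y) /\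
  Int (fun y => \1_(cube a l) y * F y) <= Int (fun y => \1_(box x l) y * F y).
Proof.
move=> n0 l0 ax mF F0 lb.
have sub y : cube a l y -> box x l y.
  move=> ay i; have /andP[x1 x2] := ax i; have /andP[y1 y2] := ay i.
  rewrite ler_norml; apply/andP; split.
    by clear -x1 x2 y1 y2; lra.
  by clear -x1 x2 y1 y2; lra.
have pw y : \1_(cube a l) y * F y <= \1_(box x l) y * F y.
  apply: ler_wpM2r => //; have [ay|ay] := pselect (cube a l y).
    by rewrite !indicE !mem_set//; exact: sub.
  by rewrite indicE memNset// indicE.
have lc : L1 (fun y => \1_(cube a l) y * F y).
  apply: (L1_dom _ lb); first exact: (measurable_funM (indic_mfn n0 a l) mF).
  by move=> y; rewrite ger0_norm ?pw// mulr_ge0// indicE.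
by split=> //; exact: Int_le.
Qed.

Lemma avg_rE (R : realType) n r (F : 'rV[R]_n -> complex R) c (a : 'rV[R]_n) l :
  L1 (fun y => \1_(cube a l) y * cmod (F y - c) `^ r) ->
  avg_r r F c a l = (((l ^+ n)^-1 * Int (fun y => \1_(cube a l) y * cmod (F y - c) `^ r)) `^ r^-1)%:E.
Proof.
move=> lF; rewrite /avg_r L1_eint// => y.
by rewrite mulr_ge0 ?powR_ge0// indicE.
Qed.

Lemma maxr_ge0 (R : realType) n r (f : 'rV[R]_n -> complex R) x : (0 <= maxr r f x)%E.
Proof.
apply: (@le_trans _ _ (avg_r r f 0%R x 1)); first exact: poweR_ge0.
apply: ereal_sup_ubound; exists x, 1; do 2![split=> //].
by move=> i; rewrite lexx lerDl ler01.
Qed.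

(** The increase by [e] provides a positive [Q], which the local estimates divide by, even where the
    maximal function vanishes. *)
Lemma maxr_maxbound (R : realType) n r (f : 'rV[R]_n -> complex R) x M e : (0 < n)%N -> 0 < r ->
  mfn (fun y => cmod (f y)) -> L1 (fun y => cmod (f y) `^ r) -> maxr r f x = M%:E -> 0 < e ->
  maxbound (fun y => cmod (f y) `^ r) x ((M + e) `^ r).
Proof.
move=> n0 r0 mf lf ME e0 a l l0 ax.
have M0 : 0 <= M by rewrite -lee_fin -ME maxr_ge0.
have lc : L1 (fun y => \1_(cube a l) y * cmod (f y) `^ r).
  apply: (L1_dom _ lf); first exact: (measurable_funM (indic_mfn n0 a l) (L1_mfn lf)).
  move=> y; rewrite normrM (ger0_norm (powR_ge0 _ _)) ler_piMl ?powR_ge0//.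
  by rewrite indicE; case: (_ \in _); rewrite ?normr1 ?normr0.
have E : (fun y => \1_(cube a l) y * cmod (f y - 0) `^ r) = (fun y => \1_(cube a l) y * cmod (f y) `^ r).
  by apply/funext => y; rewrite subr0.
have := @avg_rE R n r f 0 a l; rewrite E => /(_ lc) avE.
have : (avg_r r f 0%R a l <= maxr r f x)%E by apply: ereal_sup_ubound; exists a, l.
rewrite avE ME lee_fin; set I := Int _ => H.
have I0 : 0 <= I by apply: Int_ge0 => y; rewrite mulr_ge0 ?powR_ge0// indicE.
have ln0 : 0 < l ^+ n by rewrite exprn_gt0.
have A0 : 0 <= (l ^+ n)^-1 * I by rewrite mulr_ge0// invr_ge0 ltW.
have : ((l ^+ n)^-1 * I) <= (M + e) `^ r.
  rewrite -[leLHS]powRr1// -[X in _ `^ X](mulVf (lt0r_neq0 r0)) powRrM.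
  apply: (ge0_ler_powR (ltW r0)); rewrite ?nnegrE ?powR_ge0 ?addr_ge0 ?(ltW e0)//.
  by rewrite (le_trans H)// lerDl ltW.
by rewrite mulrC ler_pdivrMr// mulrC.
Qed.

Lemma avg_psido_le (R : realType) n r rho m (s : 'rV[R]_n -> 'rV[R]_n -> complex R) :
  (0 < n)%N -> 1 < r <= 2 -> 0 < rho < 1 -> m <= - ((n%:R / r) * (1 - rho)) -> symbol_class m rho rho s ->
  exists2 K, 0 < K & forall f x M e a l, schwartz f -> maxr r f x = M%:E -> 0 < e -> 0 < l -> cube a l x ->
  exists c : complex R, (1 <= l -> c = 0) /\ (avg_r r (psido s f) c a l <= (K * (M + e))%:E)%E.
Proof.
move=> n0 r12 rho01 mr ss; have /andP[r1 r2] := r12; have r0 : 0 < r by apply: lt_trans r1.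
have [K K0 HK] := psido_local n0 rho01 r12 mr ss; exists K => // f x M e a l sf ME e0 l0 ax.
have [mf lf] := schwartz_cmod n0 r12 sf.
have M0 : 0 <= M by rewrite -lee_fin -ME maxr_ge0.
have Me0 : 0 < M + e by rewrite ltr_wpDl.
have HM := maxr_maxbound n0 r0 mf lf ME e0.
have Q0 : 0 < (M + e) `^ r by exact: powR_gt0.
have [c [c0 mP lP IP]] := HK f x _ l sf l0 Q0 HM; exists c; split=> //.
have mp : mfn (fun y => cmod (psido s f y - c) `^ r).
  by apply: (measurableT_comp (f := fun t : R => t `^ r)); first exact: measurable_powR.
have [lc Ic] := Int_cube_box n0 l0 ax mp (fun y => powR_ge0 _ _) lP.
rewrite (avg_rE lc) lee_fin.
have {}Ic := le_trans Ic IP.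
have ln0 : 0 < l ^+ n by rewrite exprn_gt0.
have I0 : 0 <= Int (fun y => \1_(cube a l) y * cmod (psido s f y - c) `^ r).
  by apply: Int_ge0 => y; rewrite mulr_ge0 ?powR_ge0// indicE.
move: (Int _) I0 Ic => I I0 Ic.
have h : (l ^+ n)^-1 * I <= (K * (M + e)) `^ r.
  rewrite powRM ?(ltW K0) ?(ltW Me0)// mulrC ler_pdivrMr//.
  by rewrite (le_trans Ic)// le_eqVlt; apply/orP; left; apply/eqP; ring.
have KM0 : 0 <= K * (M + e) by rewrite mulr_ge0 ?ltW.
rewrite -[leRHS]powRr1// -[X in _ <= _ `^ X](mulfV (lt0r_neq0 r0)) powRrM.
have ri0 : 0 <= r^-1 by rewrite invr_ge0 ltW.
by apply: (ge0_ler_powR ri0); rewrite ?nnegrE ?powR_ge0// mulr_ge0// invr_ge0 ltW.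
Qed.

Theorem theorem1p1 (R : realType) (n : nat) (r rho m : R)
  (s : 'rV[R]_n -> 'rV[R]_n -> complex R) :
  (1 <= n)%N -> 1 < r <= 2 -> 0 < rho < 1 ->
  m <= - ((n%:R / r) * (1 - rho)) ->
  symbol_class m rho rho s ->
  exists C : R, 0 < C /\
    forall (f : 'rV[R]_n -> complex R), schwartz f ->
      forall x : 'rV[R]_n,
        (sharp_maxr r (psido s f) x <= C%:E * maxr r f x)%E.
Proof.
move=> n0 r12 rho01 mr ss; have [K K0 HK] := avg_psido_le n0 r12 rho01 mr ss.
exists (2 * K); split; first by rewrite mulr_gt0.
move=> f sf x; have := maxr_ge0 r f x; case ME : (maxr r f x) => [M| |] // M0; last first.
  by rewrite gt0_muley ?leey// lte_fin mulr_gt0.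
apply/lee_addgt0Pr => e e0.
(* Chosen so that raising the maximal function by [d] in both halves of the sharp function adds
   exactly [e]. *)
pose d := e / (2 * K); have d0 : 0 < d by rewrite divr_gt0// mulr_gt0.
have -> : ((2 * K)%:E * M%:E + e%:E = (K * (M + d))%:E + (K * (M + d))%:E)%E.
  by rewrite -EFinM -!EFinD; congr (_%:E); rewrite /d; field; rewrite gt_eqF.
apply: leeD.
  apply: ge_ereal_sup => _ [a [l [l1 [ax ->]]]].
  have l0 : 0 < l := lt_le_trans ltr01 l1.
  by have [c [c0]] := HK f x M d a l sf ME d0 l0 ax; rewrite c0.
apply: ge_ereal_sup => _ [a [l [/andP[l0 l1] [ax ->]]]].
have [c [_ Hc]] := HK f x M d a l sf ME d0 l0 ax.
by apply: le_trans Hc; apply: ereal_inf_lbound; exists c.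
Qed.
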